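(* Let $n\ge3$ be odd and let $q\in\Bbbk$ be a primitive $n$-th root of unity. The Drinfel'd double $D(u_q(\mathfrak{sl}_2))$ is generated as an algebra by $a,b,c,d,E,F,K$ subject to the relations $$a^n=d^n=K^n=1,\qquad b^n=c^n=E^n=F^n=0,$$ $$ba=qab,\quad db=qbd,\quad ca=qac,\quad dc=qcd,\quad bc=cb,\quad ad=q^{-1}bc+1,$$ $$KE=q^2EK,\quad KF=q^{-2}FK,\quad EF-FE=\frac{K-K^{-1}}{q-q^{-1}},$$ $$Ka=aK,\quad Kb=q^{-2}bK,\quad Kc=q^2cK,\quad Kd=dK,$$ $$Ea=q^{-1}aE-q^{-1}c,\quad Eb=q^{-1}bE+q^{-1}aK-q^{-1}d,\quad Ec=qcE,\quad Ed=qdE+qcK,$$ $$Fa=q^{-1}aF+b,\quad Fb=qbF,\quad Fc=q^{-1}cF-aK^{-1}+d,\quad Fd=qdF-q^2bK^{-1}.$$ The comultiplication and counit are given by $$\Delta(a)=a\otimes a+c\otimes b,\quad \Delta(b)=b\otimes a+d\otimes b,\quad \Delta(c)=a\otimes c+c\otimes d,\quad \Delta(d)=b\otimes c+d\otimes d,$$ $$\Delta(K)=K\otimes K,\quad \Delta(E)=1\otimes E+E\otimes K,\quad \Delta(F)=K^{-1}\otimes F+F\otimes 1,$$ $$\epsilon(a)=\epsilon(d)=\epsilon(K)=1,\quad \epsilon(b)=\epsilon(c)=\epsilon(E)=\epsilon(F)=0.$$ The antipode is given by $$S(a)=d,\quad S(b)=-q^{-1}b,\quad S(c)=-qc,\quad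 S(d)=a,\quad S(K)=K^{-1},\quad S(E)=-EK^{-1},\quad S(F)=-KF.$$
   Context: $\Bbbk$ is an algebraically closed field of characteristic $0$. $u_q(\mathfrak{sl}_2)$ is the Hopf algebra generated by $K,E,F$ subject to $K^n=1$, $E^n=F^n=0$, $KE=q^2EK$, $KF=q^{-2}FK$, $EF-FE=\frac{K-K^{-1}}{q-q^{-1}}$, with $\Delta(K)=K\otimes K$, $\Delta(E)=1\otimes E+E\otimes K$, $\Delta(F)=K^{-1}\otimes F+F\otimes 1$, $\epsilon(K)=1$, $\epsilon(E)=\epsilon(F)=0$. For a finite-dimensional Hopf algebra $H$ with antipode $S$, the Drinfel'd double $D(H)$ is $H^{*\mathrm{cop}}\otimes H$ as a coalgebra, with unit $\epsilon\otimes1$ and multiplication $$(p\otimes h)(p'\otimes h')=\langle p'_{(1)},S^{-1}(h_{(3)})\rangle\langle p'_{(3)},h_{(1)}\rangle\;p\,p'_{(2)}\otimes h_{(2)}h',$$ where $H^*$ is the dual Hopf algebra (multiplication dual to $\Delta_H$, comultiplication dual to the multiplication of $H$). One writes $p$ for $p\otimes1$ and $h$ for $\epsilon\otimes h$. Here $K,E,F$ are the generators of $u_q(\mathfrak{sl}_2)$, and $a,b,c,d\in u_q(\mathfrak{sl}_2)^*$ are the matrix coefficients of the two-dimensional representation $\rho$ with $\rho(E)=\begin{pmatrix}0&1\\0&0\end{pmatrix}$, $\rho(F)=\begin{pmatrix}0&0\\1&0\end{pmatrix}$, $\rho(K)=\begin{pmatrix}q&0\\0&q^{-1}\end{pmatrix}$,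 i.e. $\rho(v)=\begin{pmatrix}\langle a,v\rangle&\langle b,v\rangle\\\langle c,v\rangle&\langle d,v\rangle\end{pmatrix}$ for $v\in u_q(\mathfrak{sl}_2)$. *)

(* Defs.v *)
From HB Require Import structures.
From mathcomp Require Import all_boot all_order all_algebra all_field.
From mathcomp Require Import finmap.
From mathcomp.multinomials Require Import monalg.

Set Implicit Arguments.
Unset Strict Implicit.
Unset Printing Implicit Defensive.

Import GRing.Theory.
Local Open Scope ring_scope.

Section TensorProduct.
Variable k : fieldType.

(* The tensor product of two finite-dimensional spaces, by coordinates in the
   bases [vbasis {:V}] and [vbasis {:W}]: the matrix (X i j) stands for
   \sum_(i, j) X i j *: (e_i (x) f_j). *)
Definition tensor (V W : vectType k) : vectType k :=
  'M[k]_(\dim {:V}, \dim {:W}).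

Definition tpure (V W : vectType k) (v : V) (w : W) : tensor V W :=
  \matrix_(i < \dim {:V}, j < \dim {:W})
    (coord (vbasis {:V}) i v * coord (vbasis {:W}) j w).

(* The linear map out of the tensor product induced by a bilinear map B, i.e.
   [tlift B X] is \sum B(x', x'') for X = \sum x' (x) x'' (see [tliftE]).
   In particular [tlift B (Delta h)] is the Sweedler sum of B(h_(1), h_(2)). *)
Definition tlift (V W : vectType k) (L : lmodType k) (B : V -> W -> L)
    (X : tensor V W) : L :=
  \sum_(i < \dim {:V}) \sum_(j < \dim {:W})
    (X : 'M[k]_(\dim {:V}, \dim {:W})) i j
      *: B (vbasis {:V})`_i (vbasis {:W})`_j.

End TensorProduct.

Notation "v ⊗ w" := (tpure v w) (at level 38, left associativity) : ring_scope.

Section TensorTheory.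
Variables (k : fieldType) (V W : vectType k) (L : lmodType k).

Lemma tlift_is_linear (B : V -> W -> L) : linear (tlift B).
Proof.
move=> c X Y; rewrite /tlift scaler_sumr -big_split; apply: eq_bigr => i _ /=.
rewrite scaler_sumr -big_split; apply: eq_bigr => j _ /=.
by rewrite !mxE scalerDl scalerA.
Qed.

Lemma tlift_param_linear (T : lmodType k) (B : T -> V -> W -> L) X :
  (forall v w, linear (fun t => B t v w)) -> linear (fun t => tlift (B t) X).
Proof.
move=> Bl c s t; rewrite /tlift scaler_sumr -big_split; apply: eq_bigr => i _ /=.
rewrite scaler_sumr -big_split; apply: eq_bigr => j _ /=.
by rewrite Bl scalerDr !scalerA mulrC.
Qed.

Lemma tpure_linearl (w : W) : linear (fun v : V => v ⊗ w).
Proof.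
by move=> c v v'; apply/matrixP=> i j; rewrite !mxE linearP mulrDl -mulrA.
Qed.

Lemma tpure_linearr (v : V) : linear (fun w : W => v ⊗ w).
Proof.
by move=> c w w'; apply/matrixP=> i j; rewrite !mxE linearP mulrDr mulrCA.
Qed.

Lemma tliftE (B : V -> W -> L) :
  (forall w, linear (B^~ w)) -> (forall v, linear (B v)) ->
  forall v w, tlift B (v ⊗ w) = B v w.
Proof.
move=> Bl Br v w.
pose bl w := GRing.isLinear.Build k V L *:%R (B^~ w) (Bl w).
pose Bw w : {linear V -> L} := HB.pack (B^~ w) (bl w).
pose br v := GRing.isLinear.Build k W L *:%R (B v) (Br v).
pose Bv v : {linear W -> L} := HB.pack (B v) (br v).
rewrite /tlift -[RHS]/(Bw w v) {2}(coord_vbasis (memvf v)) linear_sum.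
apply: eq_bigr => i _; rewrite linearZ /=.
rewrite -[B _ w]/(Bv (vbasis {:V})`_i w) {2}(coord_vbasis (memvf w)).
rewrite linear_sum scaler_sumr; apply: eq_bigr => j _.
by rewrite linearZ scalerA mxE.
Qed.

End TensorTheory.

Section HopfAlgebra.
Variable k : fieldType.

(* The multiplication (x (x) y)(x' (x) y') = xx' (x) yy' on H (x) H. *)
Definition tmul (H : falgType k) (X Y : tensor H H) : tensor H H :=
  tlift (fun x y => tlift (fun x' y' => (x * x') ⊗ (y * y')) Y) X.

Definition is_antipode (V : vectType k) (mul : V -> V -> V) (one : V)
    (Delta : V -> tensor V V) (eps : V -> k) (S : V -> V) : Prop :=
  forall h, tlift (fun h1 h2 => mul (S h1) h2) (Delta h) = eps h *: one
         /\ tlift (fun h1 h2 => mul h1 (S h2)) (Delta h) = eps h *: one.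

Record is_hopf (H : falgType k) (Delta : 'Hom(H, tensor H H))
    (eps : 'Hom(H, k^o)) (S : 'End(H)) : Prop := IsHopf {
  hopf_coassoc : forall h,
    tlift (fun h1 h2 => Delta h1 ⊗ h2) (Delta h)
    = tlift (fun h1 h23 => tlift (fun h2 h3 => (h1 ⊗ h2) ⊗ h3) (Delta h23))
        (Delta h);
  hopf_counitl : forall h, tlift (fun h1 h2 => eps h1 *: h2) (Delta h) = h;
  hopf_counitr : forall h, tlift (fun h1 h2 => eps h2 *: h1) (Delta h) = h;
  hopf_comul1 : Delta 1 = 1 ⊗ 1;
  hopf_comulM : forall x y, Delta (x * y) = tmul (Delta x) (Delta y);
  hopf_counit1 : eps 1 = 1;
  hopf_counitM : forall x y, eps (x * y) = eps x * eps y;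
  hopf_antipode : is_antipode *%R 1 Delta eps S
}.

End HopfAlgebra.

Section DrinfeldDouble.
Variables (k : fieldType) (H : falgType k).
Variables (Delta : 'Hom(H, tensor H H)) (eps : 'Hom(H, k^o)) (S : 'End(H)).

Definition dual_space : vectType k := 'Hom(H, k^o).

(* The product of H^*, dual to Delta; its unit is eps. *)
Definition dual_mul (p p' : dual_space) : dual_space :=
  linfun (fun h => tlift (fun h1 h2 => p h1 * p' h2 : k^o) (Delta h)).

Definition dual_basis (i : 'I_(\dim {:H})) : dual_space :=
  linfun (coord (vbasis {:H}) i : H -> k^o).

(* The coproduct of H^*, dual to the product of H; expanding on the dual basis,
   Delta p = \sum_(i, j) p (e_i e_j) *: (e^i (x) e^j) (see [dual_comulE]). *)
Definition dual_comul (p : dual_space) : tensor dual_space dual_space :=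
  \sum_(i < \dim {:H}) \sum_(j < \dim {:H})
    p ((vbasis {:H})`_i * (vbasis {:H})`_j) *: (dual_basis i ⊗ dual_basis j).

Definition drinfeld_double : vectType k := tensor dual_space H.

(* <p'_(1), S^-1 h_(3)> <p'_(3), h_(1)>  p p'_(2) (x) h_(2) h'.
   The linear inverse [S^-1] is a genuine inverse: the antipode of a
   finite-dimensional Hopf algebra is bijective. *)
Definition double_mul_pure (p : dual_space) (h : H) (p' : dual_space) (h' : H) :
    drinfeld_double :=
  tlift (fun p1 p23 : dual_space => tlift (fun p2 p3 : dual_space =>
    tlift (fun h1 h23 => tlift (fun h2 h3 =>
      (p1 ((S^-1)%VF h3) * p3 h1) *: (dual_mul p p2 ⊗ (h2 * h')))
    (Delta h23)) (Delta h))
  (dual_comul p23)) (dual_comul p').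

Definition double_mul (X Y : drinfeld_double) : drinfeld_double :=
  tlift (fun p h => tlift (fun p' h' => double_mul_pure p h p' h') Y) X.

Definition double_one : drinfeld_double := (eps : dual_space) ⊗ (1 : H).

(* The coalgebra H^{*cop} (x) H. *)
Definition double_comul (X : drinfeld_double) :
    tensor drinfeld_double drinfeld_double :=
  tlift (fun (p : dual_space) h =>
    tlift (fun p1 p2 : dual_space => tlift (fun h1 h2 =>
      ((p2 ⊗ h1 : drinfeld_double) ⊗ (p1 ⊗ h2 : drinfeld_double))) (Delta h))
    (dual_comul p)) X.

Definition double_counit (X : drinfeld_double) : k :=
  tlift (fun (p : dual_space) h => p 1 * eps h : k^o) X.

Definition of_dual (p : dual_space) : drinfeld_double := p ⊗ (1 : H).
Definition of_alg (h : H) : drinfeld_double := (eps : dual_space) ⊗ h.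

Lemma dual_mulE p p' h :
  dual_mul p p' h = tlift (fun h1 h2 => p h1 * p' h2 : k^o) (Delta h).
Proof.
pose f h := tlift (fun h1 h2 => p h1 * p' h2 : k^o) (Delta h).
have fl : linear f by move=> c x y; rewrite /f linearP tlift_is_linear.
pose fL := GRing.isLinear.Build k H k^o *:%R f fl.
pose F : {linear H -> k^o} := HB.pack f fL.
exact: (lfunE F h).
Qed.

Lemma dual_comulE p x y :
  tlift (fun p1 p2 : dual_space => p1 x * p2 y : k^o) (dual_comul p) = p (x * y).
Proof.
pose TL := GRing.isLinear.Build k (tensor dual_space dual_space) k^o *:%R _
  (@tlift_is_linear k dual_space dual_space k^o
     (fun p1 p2 : dual_space => p1 x * p2 y : k^o)).
pose T : {linear tensor dual_space dual_space -> k^o} := HB.pack (tlift _) TL.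
rewrite -[LHS]/(T _) [in RHS](coord_vbasis (memvf x)) mulr_suml !linear_sum.
apply: eq_bigr => i _.
rewrite [in RHS](coord_vbasis (memvf y)) mulr_sumr !linear_sum.
apply: eq_bigr => j _; rewrite linearZ /= tliftE; first 1 last.
- by move=> w c u v; rewrite add_lfunE scale_lfunE mulrDl scalerAl.
- by move=> w c u v; rewrite add_lfunE scale_lfunE mulrDr scalerAr.
rewrite /dual_basis !lfunE /= -scalerAl -scalerAr !linearZ /= scalerA.
by rewrite -[LHS]mulrA; congr (_ * _); apply: mulrC.
Qed.

Lemma dual_mul_linearl p' : linear (dual_mul^~ p').
Proof.
move=> c p r; apply/lfunP=> h; rewrite add_lfunE scale_lfunE !dual_mulE.
pose B (p : dual_space) h1 h2 : k^o := p h1 * p' h2.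
suff Bl: linear (fun p => tlift (B p) (Delta h)) by exact: Bl.
apply: tlift_param_linear => h1 h2 e u v.
by rewrite /B add_lfunE scale_lfunE mulrDl -scalerAl.
Qed.

Lemma dual_comul_linear : linear dual_comul.
Proof.
move=> c p r; rewrite /dual_comul scaler_sumr -big_split.
apply: eq_bigr => i _ /=; rewrite scaler_sumr -big_split.
apply: eq_bigr => j _ /=.
by rewrite add_lfunE scale_lfunE scalerDl scalerA.
Qed.

Lemma double_mulE p h p' h' :
  double_mul (p ⊗ h) (p' ⊗ h') = double_mul_pure p h p' h'.
Proof.
rewrite /double_mul !tliftE //.
- move=> r c u v; rewrite /double_mul_pure dual_comul_linear.
  exact: tlift_is_linear.
- move=> r; rewrite /double_mul_pure.
  do 4!apply: tlift_param_linear => ? ?.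
  move=> c u v.
  by rewrite mulrDr -scalerAr tpure_linearr scalerDr !scalerA mulrC.
- move=> r; apply: tlift_param_linear => p0 h0; rewrite /double_mul_pure.
  do 4!apply: tlift_param_linear => ? ?.
  move=> c u v.
  by rewrite dual_mul_linearl tpure_linearl scalerDr !scalerA mulrC.
- move=> r; apply: tlift_param_linear => p0 h0; rewrite /double_mul_pure.
  do 2!apply: tlift_param_linear => ? ?.
  by move=> c u v; rewrite linearP; exact: tlift_is_linear.
Qed.

End DrinfeldDouble.

Arguments dual_space {k} H.
Arguments drinfeld_double {k} H.

Section Presentation.
Variable k : fieldType.

(* The free k-algebra on g generators: the monoid algebra of the free monoid. *)
Definition free_alg (g : nat) : lalgType k := {malg k[{fmonom 'I_g}]}.

Definition fgen (g : nat) (i : 'I_g) : free_alg g := << fmu i >>.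

(* The two-sided ideal generated by the differences l - r, (l, r) in rels. *)
Inductive rel_ideal (A : nzRingType) (rels : seq (A * A)) : A -> Prop :=
| RelIdealRel l r : (l, r) \in rels -> rel_ideal rels (l - r)
| RelIdeal0 : rel_ideal rels 0
| RelIdealD x y : rel_ideal rels x -> rel_ideal rels y -> rel_ideal rels (x + y)
| RelIdealMl x y : rel_ideal rels y -> rel_ideal rels (x * y)
| RelIdealMr x y : rel_ideal rels x -> rel_ideal rels (x * y).

(* (V, mul, one) is the algebra generated by gens subject to rels: the
   algebra map from the free algebra sending the free generators to gens
   exists, is onto, and its kernel is the ideal generated by rels. *)
Definition presented_by (g : nat) (V : lmodType k) (mul : V -> V -> V) (one : V)
    (gens : g.-tuple V) (rels : seq (free_alg g * free_alg g)) : Prop :=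
  exists phi : {linear free_alg g -> V},
    [/\ phi 1 = one /\ {morph phi : P Q / P * Q >-> mul P Q},
        forall i, phi (fgen i) = tnth gens i,
        forall v, exists P, phi P = v
      & forall P, phi P = 0 <-> rel_ideal rels P].

End Presentation.

Arguments fgen {k g} i.

Section SmallQuantumGroup.
Variables (k : fieldType) (n : nat) (q : k).

(* As K^n = 1, the inverse of K is written K^(n-1) in the free algebra. *)
Definition uq_rels (A : lalgType k) (E F K : A) : seq (A * A) :=
  [:: (K ^+ n, 1); (E ^+ n, 0); (F ^+ n, 0);
      (K * E, q ^+ 2 *: (E * K)); (K * F, q ^- 2 *: (F * K));
      (E * F - F * E, (q - q^-1)^-1 *: (K - K ^+ n.-1))].

Record is_uq_sl2 (U : falgType k) (Delta : 'Hom(U, tensor U U))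
    (eps : 'Hom(U, k^o)) (S : 'End(U)) (E F K : U) : Prop := IsUqSl2 {
  uq_hopf : is_hopf Delta eps S;
  uq_presented : presented_by *%R 1 [tuple E; F; K]
    (uq_rels (fgen (inord 0 : 'I_3)) (fgen (inord 1)) (fgen (inord 2)));
  uq_comulK : Delta K = K ⊗ K;
  uq_comulE : Delta E = 1 ⊗ E + E ⊗ K;
  uq_comulF : Delta F = K^-1 ⊗ F + F ⊗ 1;
  uq_counitK : eps K = 1;
  uq_counitE : eps E = 0;
  uq_counitF : eps F = 0
}.

Definition double_rels (A : lalgType k) (a b c d E F K : A) : seq (A * A) :=
  let Ki := K ^+ n.-1 in
  [:: (a ^+ n, 1); (d ^+ n, 1); (b ^+ n, 0); (c ^+ n, 0);
      (b * a, q *: (a * b)); (d * b, q *: (b * d));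
      (c * a, q *: (a * c)); (d * c, q *: (c * d));
      (b * c, c * b); (a * d, q^-1 *: (b * c) + 1)]
  ++ uq_rels E F K ++
  [:: (K * a, a * K); (K * b, q ^- 2 *: (b * K));
      (K * c, q ^+ 2 *: (c * K)); (K * d, d * K);
      (E * a, q^-1 *: (a * E) - q^-1 *: c);
      (E * b, q^-1 *: (b * E) + q^-1 *: (a * K) - q^-1 *: d);
      (E * c, q *: (c * E));
      (E * d, q *: (d * E) + q *: (c * K));
      (F * a, q^-1 *: (a * F) + b);
      (F * b, q *: (b * F));
      (F * c, q^-1 *: (c * F) - a * Ki + d);
      (F * d, q *: (d * F) - q ^+ 2 *: (b * Ki))].

Definition mx2 (w x y z : k) : 'M[k]_2 :=
  \matrix_(i, j) (if i == 0 then (if j == 0 then w else x)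
                  else (if j == 0 then y else z)).

End SmallQuantumGroup.

(* Main.v *)
Require Import Defs.
From HB Require Import structures.
From mathcomp Require Import all_boot all_order all_algebra all_field.
From mathcomp Require Import finmap.
From mathcomp.multinomials Require Import monalg.
From mathcomp Require Import ring.

Set Implicit Arguments.
Unset Strict Implicit.
Unset Printing Implicit Defensive.

Import GRing.Theory.
Local Open Scope ring_scope.

(** Sending p (x) h to x |-> p(x) h embeds the double in the linear maps H -> H, and
    turns its product into
      (f g)(x) = f(x_1)_2 g(S^-1(f(x_1)_3) x_2 f(x_1)_1).
    This product is associative as soon as left multiplication by each h in H is
    compatible with it; that property is multiplicative in h, so for u_q(sl_2) it is
    a computation with K, E and F.  The antipode is S_D(p h) = S(h) (p o S^-1), and
    it is unique because it is a convolution inverse.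

    All relations hold in the double: those between a, b, c, d because functionals
    vanishing at 1 and spanning a space stable under p |-> p(- E), p(- F), p(- K) are
    zero, and the mixed ones from the values of the coefficients on K, E, F.
    Conversely, the relations reduce every word to a combination of the n^6 monomials
    a^i b^j c^l F^s K^t E^r.  The pairing of a^i b^j c^l with F^s K^t E^r vanishes
    unless (j, l) = (r, s), and is then a nonzero multiple of q^(t (i + j + l)).  By
    Vandermonde it is nondegenerate, so both families are bases, and the n^6 monomials
    form a basis of the double. *)

(** * Tensors and multilinearity *)

(* The tensor products are coordinate matrices, so the double starts as a mere vector space with a
   product formula, and it must become a ring before words in its generators can be computed with.
   Testing $h(XY)=(hX)Y$ is enough because a factor $p\otimes1$ on the left only splits the argument
   $x$, which coassociativity handles.

   The letter $d$ is absent from the normal form: $a^n=1$ makes $a$ invertible, and $ad=q^{-1}bc+1$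
   then expresses $d$. Oddness of $n$ makes $q^2$ a primitive $n$-th root of unity as well, so that
   the quantum integers appearing in the pairing are nonzero below $n$.

   No dimension is known in advance. The relations only bound from above, through spanning families;
   the pairing then yields at once the independence of the monomials in $U$, the fact that $a,b,c$
   generate $U^*$, and the independence of the products in the double, hence the exact kernel of the
   presentation. *)
Reserved Notation "\tens_ ( x , y <- X ) B"
  (at level 41, x name, y name, X at level 50, B at level 41,
   format "'[' \tens_ ( x ,  y  <-  X ) '/  '  B ']'").
Notation "\tens_ ( x , y <- X ) B" := (tlift (fun x y => B) X) : ring_scope.

Section Linearity.
Variables (k : fieldType) (T V W L : lmodType k).

Lemma linear_id : linear (fun t : T => t).
Proof. by []. Qed.

Lemma linear_comp (f : V -> L) (g : T -> V) :
  linear f -> linear g -> linear (fun t => f (g t)).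
Proof. by move=> fl gl c s t; rewrite gl fl. Qed.

Lemma linear_linear (f : {linear V -> L}) (g : T -> V) :
  linear g -> linear (fun t => f (g t)).
Proof. by apply: linear_comp; apply: linearP. Qed.

Lemma linear_add (f g : T -> V) :
  linear f -> linear g -> linear (fun t => f t + g t).
Proof. by move=> fl gl c s t; rewrite fl gl scalerDr addrACA. Qed.

Lemma linear_opp (f : T -> V) : linear f -> linear (fun t => - f t).
Proof. by move=> fl c s t; rewrite fl opprD scalerN. Qed.

Lemma linear_scalel (f : T -> k^o) (v : V) :
  linear f -> linear (fun t => (f t : k) *: v).
Proof. by move=> fl c s t; rewrite fl scalerDl scalerA. Qed.

Lemma linear_scaler (c : k) (f : T -> V) :
  linear f -> linear (fun t => c *: f t).
Proof. by move=> fl e s t; rewrite fl scalerDr !scalerA mulrC. Qed.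

Lemma linear_mull (A : algType k) (f : T -> A) (x : A) :
  linear f -> linear (fun t => f t * x).
Proof. by move=> fl c s t; rewrite fl mulrDl scalerAl. Qed.

Lemma linear_mulr (A : algType k) (f : T -> A) (x : A) :
  linear f -> linear (fun t => x * f t).
Proof. by move=> fl c s t; rewrite fl mulrDr scalerAr. Qed.

End Linearity.

Section TensorLinearity.
Variables (k : fieldType) (T L : lmodType k) (V W : vectType k).

Lemma linear_lfun (f : 'Hom(V, W)) (g : T -> V) :
  linear g -> linear (fun t => f (g t)).
Proof. by apply: linear_comp; apply: linearP. Qed.

Lemma linear_tpurel (f : T -> V) (w : W) :
  linear f -> linear (fun t => f t ⊗ w).
Proof. exact: (linear_comp (tpure_linearl w)). Qed.

Lemma linear_tpurer (v : V) (f : T -> W) :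
  linear f -> linear (fun t => v ⊗ f t).
Proof. exact: (linear_comp (tpure_linearr v)). Qed.

Lemma linear_tliftr (B : V -> W -> L) (f : T -> tensor V W) :
  linear f -> linear (fun t => \tens_(x, y <- f t) B x y).
Proof. exact: (linear_comp (tlift_is_linear B)). Qed.

End TensorLinearity.

Lemma linear_funD (k : fieldType) (V W : lmodType k) (f : V -> W) x y :
  linear f -> f (x + y) = f x + f y.
Proof. by move=> fl; have := fl 1 x y; rewrite !scale1r. Qed.

Lemma linear_funZ (k : fieldType) (V W : lmodType k) (f : V -> W) c x :
  linear f -> f (c *: x) = c *: f x.
Proof.
move=> fl; pose fL := GRing.isLinear.Build k V W *:%R f fl.
pose F : {linear V -> W} := HB.pack f fL; exact: (linearZ_LR F).
Qed.

Lemma linear_funN (k : fieldType) (V W : lmodType k) (f : V -> W) x :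
  linear f -> f (- x) = - f x.
Proof.
move=> fl; pose fL := GRing.isLinear.Build k V W *:%R f fl.
pose F : {linear V -> W} := HB.pack f fL; exact: (linearN F).
Qed.

(** [tlift] takes bare functions, so every manipulation of a Sweedler sum leaves linearity
    conditions. This search follows the shape of the function and ends with hypotheses of the
    context, applied directly or composed; what [lin] cannot close is left to the caller. *)
Ltac lin_step := first
  [ exact: linear_id
  | exact: linearP
  | assumption
  | apply: linear_add | apply: linear_opp
  | apply: linear_scaler | apply: linear_scalel
  | apply: linear_mull | apply: linear_mulr
  | apply: linear_tpurel | apply: linear_tpurer
  | apply: linear_tliftr
  | apply: tlift_param_linear => ? ?
  | apply: linear_lfun
  | apply: linear_linear
  | match goal with H : _ |- _ => apply: H end
  | match goal with H : _ |- _ => first [ apply: (linear_comp H)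
      | apply: (linear_comp (H _)) | apply: (linear_comp (H _ _)) ] end ].
Ltac lin := lazymatch goal with
  | |- forall _, _ => let x := fresh "x" in intro x; lin
  | |- _ => do ?lin_step end.

Section TliftTheory.
Variables (k : fieldType) (V W : vectType k) (L : lmodType k).
Implicit Types (X : tensor V W).

Lemma eq_tlift (B B' : V -> W -> L) X :
  (forall v w, B v w = B' v w) -> tlift B X = tlift B' X.
Proof.
by move=> eB; apply: eq_bigr => i _; apply: eq_bigr => j _; rewrite eB.
Qed.

Lemma tlift_comp (L' : lmodType k) (f : L -> L') (B : V -> W -> L) X :
  linear f -> f (tlift B X) = \tens_(v, w <- X) f (B v w).
Proof.
move=> fl; pose fL := GRing.isLinear.Build k L L' *:%R f fl.
pose F : {linear L -> L'} := HB.pack f fL.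
rewrite -[f]/(F : L -> L') linear_sum; apply: eq_bigr => i _.
by rewrite linear_sum; apply: eq_bigr => j _; rewrite linearZ.
Qed.

Lemma tlift_swap (V' W' : vectType k) (B : V -> W -> V' -> W' -> L) X
    (Y : tensor V' W') :
  \tens_(v, w <- X) \tens_(v', w' <- Y) B v w v' w'
  = \tens_(v', w' <- Y) \tens_(v, w <- X) B v w v' w'.
Proof.
rewrite /tlift [LHS]pair_big [RHS]pair_big /=.
under eq_bigr => p _ do rewrite pair_big scaler_sumr /=.
rewrite exchange_big /=; apply: eq_bigr => p' _.
rewrite pair_big scaler_sumr /=; apply: eq_bigr => p _.
by rewrite !scalerA mulrC.
Qed.

Lemma tlift_sum (I : finType) (B : I -> V -> W -> L) X :
  \tens_(v, w <- X) (\sum_i B i v w) = \sum_i tlift (B i) X.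
Proof.
rewrite /tlift [RHS]exchange_big /=; apply: eq_bigr => i _.
by rewrite [RHS]exchange_big /=; apply: eq_bigr => j _; rewrite scaler_sumr.
Qed.

Lemma tlift_add (B B' : V -> W -> L) X :
  \tens_(v, w <- X) (B v w + B' v w) = tlift B X + tlift B' X.
Proof.
rewrite /tlift -big_split; apply: eq_bigr => i _; rewrite -big_split.
by apply: eq_bigr => j _; rewrite scalerDr.
Qed.

(** Reduces statements about arbitrary tensors to pure ones. *)
Lemma tensorE X : X = \tens_(v, w <- X) v ⊗ w.
Proof.
rewrite [LHS]matrix_sum_delta; apply: eq_bigr => i _; apply: eq_bigr => j _.
congr (_ *: _); apply/matrixP => i' j'; rewrite !mxE.
rewrite !coord_free ?(basis_free (vbasisP _)) //.
by rewrite -natrM mulnb [i == _]eq_sym [j == _]eq_sym.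
Qed.

End TliftTheory.

(** Iterated coproducts are nested sums over two tensors; this exchanges two of them, as needed when
    $p'$ and $h$ are both split in three. *)
Lemma tlift_swap2 (k : fieldType) (V W V' W' : vectType k) (L : lmodType k)
    (A : V -> W -> tensor V W) (X : tensor V W)
    (A' : V' -> W' -> tensor V' W') (Y : tensor V' W')
    (B : V -> W -> V -> W -> V' -> W' -> V' -> W' -> L) :
  \tens_(v, w <- X) \tens_(x, y <- A v w)
    \tens_(v', w' <- Y) \tens_(x', y' <- A' v' w') B v w x y v' w' x' y'
  = \tens_(v', w' <- Y) \tens_(x', y' <- A' v' w')
    \tens_(v, w <- X) \tens_(x, y <- A v w) B v w x y v' w' x' y'.
Proof.
transitivity (\tens_(v, w <- X) \tens_(v', w' <- Y)
  \tens_(x', y' <- A' v' w') \tens_(x, y <- A v w) B v w x y v' w' x' y').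
  apply: eq_tlift => v w; rewrite tlift_swap; apply: eq_tlift => v' w'.
  exact: tlift_swap.
by rewrite tlift_swap; apply: eq_tlift => v' w'; rewrite tlift_swap.
Qed.

(** * Antipodes *)

Section HopfTheory.
Variables (k : fieldType) (H : falgType k).
Variables (Delta : 'Hom(H, tensor H H)) (eps : 'Hom(H, k^o)) (S : 'End(H)).
Hypothesis hH : is_hopf Delta eps S.
Variable L : lmodType k.

(** Coassociativity equates two elements of $(H\otimes H)\otimes H$; the map [T] induced by the
    trilinear [B] turns this into an exchange rule for nested Sweedler sums. *)
Lemma comul_coassoc (B : H -> H -> H -> L) h :
  (forall y z, linear (fun x => B x y z)) ->
  (forall x z, linear (fun y => B x y z)) ->
  (forall x y, linear (fun z => B x y z)) ->
  \tens_(h1, h2 <- Delta h) \tens_(x, y <- Delta h1) B x y h2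
  = \tens_(h1, h2 <- Delta h) \tens_(x, y <- Delta h2) B h1 x y.
Proof.
move=> B1 B2 B3.
pose T (X : tensor (tensor H H) H) :=
  \tens_(Y, z <- X) \tens_(x, y <- Y) B x y z.
have Tl : linear T by rewrite /T; lin.
have TE Y z : T (Y ⊗ z) = \tens_(x, y <- Y) B x y z.
  by rewrite /T tliftE //; lin.
have := congr1 T (hopf_coassoc hH h); rewrite !tlift_comp //= => e.
under eq_tlift do rewrite -TE; rewrite e; apply: eq_tlift => h1 h2.
rewrite tlift_comp //; apply: eq_tlift => x y.
by rewrite TE tliftE.
Qed.

Lemma comul_counitl (f : H -> L) h :
  linear f -> \tens_(x, y <- Delta h) ((eps x : k) *: f y) = f h.
Proof.
move=> fl; rewrite -[in RHS](hopf_counitl hH h) tlift_comp //.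
by apply: eq_tlift => x y; rewrite (scalable_linear fl).
Qed.

Lemma comul_counitr (f : H -> L) h :
  linear f -> \tens_(x, y <- Delta h) ((eps y : k) *: f x) = f h.
Proof.
move=> fl; rewrite -[in RHS](hopf_counitr hH h) tlift_comp //.
by apply: eq_tlift => x y; rewrite (scalable_linear fl).
Qed.

Lemma comul_mul (B : H -> H -> L) g h :
  (forall y, linear (fun x => B x y)) -> (forall x, linear (fun y => B x y)) ->
  \tens_(x, y <- Delta (g * h)) B x y
  = \tens_(x, y <- Delta g) \tens_(x', y' <- Delta h) B (x * x') (y * y').
Proof.
move=> B1 B2; rewrite (hopf_comulM hH) /tmul.
rewrite (tlift_comp (f := tlift B)); last by lin.
apply: eq_tlift => x y; rewrite (tlift_comp (f := tlift B)); last by lin.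
by apply: eq_tlift => x' y'; rewrite tliftE.
Qed.

Lemma antipode_mull (f : H -> L) h :
  linear f -> \tens_(x, y <- Delta h) f (S x * y) = (eps h : k) *: f 1.
Proof.
move=> fl; rewrite -(scalable_linear fl) -(proj1 (hopf_antipode hH h)).
by rewrite tlift_comp.
Qed.

Lemma antipode_mulr (f : H -> L) h :
  linear f -> \tens_(x, y <- Delta h) f (x * S y) = (eps h : k) *: f 1.
Proof.
move=> fl; rewrite -(scalable_linear fl) -(proj2 (hopf_antipode hH h)).
by rewrite tlift_comp.
Qed.

End HopfTheory.

Section AntipodeTheory.
Variables (k : fieldType) (H : falgType k).
Variables (Delta : 'Hom(H, tensor H H)) (eps : 'Hom(H, k^o)) (S : 'End(H)).
Hypothesis hH : is_hopf Delta eps S.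

Lemma antipode1 : S 1 = 1.
Proof.
have := proj1 (hopf_antipode hH 1); rewrite (hopf_comul1 hH) tliftE; [|lin..].
by rewrite mulr1 (hopf_counit1 hH) scale1r.
Qed.

(** $S(gh)$ and $S(h)S(g)$ are both convolution inverses of the multiplication $H\otimes H\to H$. In
    [T] they stand on the two sides of $g_2h_2$: collapsing the right half leaves the first,
    collapsing the left half leaves the second. *)
Lemma antipodeM g h : S (g * h) = S h * S g.
Proof.
pose T := \tens_(g1, g' <- Delta g) \tens_(h1, h' <- Delta h)
  \tens_(g2, g3 <- Delta g') \tens_(h2, h3 <- Delta h')
  (S (g1 * h1) * (g2 * h2) * (S h3 * S g3)).
transitivity T.
  rewrite /T -[LHS](comul_counitr hH (f := fun g => S (g * h))); last by lin.
  apply: eq_tlift => g1 g'.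
  rewrite -[S _](comul_counitr hH (f := fun h => S (g1 * h))); last by lin.
  rewrite [LHS]tlift_comp; last by lin.
  apply: eq_tlift => h1 h'.
  transitivity (\tens_(g2, g3 <- Delta g')
     ((eps h' : k) *: (S (g1 * h1) * g2 * 1 * S g3))).
    transitivity (\tens_(g2, g3 <- Delta g')
      ((eps h' : k) *: (S (g1 * h1) * (g2 * S g3)))).
      have -> := antipode_mulr hH g'
        (f := fun z => (eps h' : k) *: (S (g1 * h1) * z)); last by lin.
      by rewrite mulr1 scalerA mulrC.
      by apply: eq_tlift => g2 g3; rewrite mulr1 !mulrA.
  apply: eq_tlift => g2 g3.
  have <- := antipode_mulr hH h' (f := fun z => S (g1 * h1) * g2 * z * S g3).
    by apply: eq_tlift => h2 h3; rewrite !mulrA.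
  by lin.
symmetry.
(* For the left half to collapse, both coproducts are regrouped so that their first two legs come
   from one splitting. *)
transitivity (\tens_(g', g3 <- Delta g) \tens_(h', h3 <- Delta h)
  \tens_(g1, g2 <- Delta g') \tens_(h1, h2 <- Delta h')
  (S (g1 * h1) * (g2 * h2) * (S h3 * S g3))); last first.
  rewrite /T.
  transitivity (\tens_(g', g3 <- Delta g) \tens_(g1, g2 <- Delta g')
   \tens_(h', h3 <- Delta h) \tens_(h1, h2 <- Delta h')
   (S (g1 * h1) * (g2 * h2) * (S h3 * S g3))).
    by apply: eq_tlift => g' g3; rewrite tlift_swap.
  rewrite (comul_coassoc hH (B := fun g1 g2 g3 => \tens_(h', h3 <- Delta h)
    \tens_(h1, h2 <- Delta h') (S (g1 * h1) * (g2 * h2) * (S h3 * S g3))));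
    [|lin..].
  apply: eq_tlift => g1 g'; rewrite [RHS]tlift_swap; apply: eq_tlift => g2 g3.
  rewrite (comul_coassoc hH (B := fun h1 h2 h3 =>
    S (g1 * h1) * (g2 * h2) * (S h3 * S g3))); [|lin..].
  by [].
rewrite -[LHS](comul_counitl hH (f := fun g => S h * S g)); last by lin.
apply: eq_tlift => g' g3.
rewrite -[S h](comul_counitl hH (f := fun h => S h)); last by lin.
rewrite (tlift_comp (f := fun z => (eps g' : k) *: (z * S g3))); last by lin.
apply: eq_tlift => h' h3.
rewrite -(comul_mul hH (B := fun x y => S x * y * (S h3 * S g3))); [|lin..].
rewrite (antipode_mull hH (f := fun z => z * (S h3 * S g3))); last by lin.
by rewrite mul1r -scalerAl scalerA (hopf_counitM hH).
Qed.

Hypothesis S_inj : lker S == 0%VS.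
Local Notation Si := (S^-1)%VF.

Lemma antipode_invK : cancel Si S. Proof. exact: lker0_lfunVK. Qed.
Lemma antipodeK : cancel S Si. Proof. exact: lker0_lfunK. Qed.

Lemma antipode_invM g h : Si (g * h) = Si h * Si g.
Proof.
by apply: (can_inj antipodeK); rewrite antipodeM !antipode_invK.
Qed.

Lemma antipode_inv1 : Si 1 = 1.
Proof. by rewrite -[in LHS]antipode1 antipodeK. Qed.

(** $S^{-1}$ reverses products, so applying it to $x\,S(y)$ exchanges the two factors: $S^{-1}$
    meets the legs of the coproduct in the order opposite to that of $S$. *)
Lemma antipode_inv_mull (L : lmodType k) (f : H -> L) h :
  linear f -> \tens_(x, y <- Delta h) f (y * Si x) = (eps h : k) *: f 1.
Proof.
move=> fl.
have := antipode_mulr hH h (f := fun z => f (Si z)); rewrite antipode_inv1 => <-.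
  by apply: eq_tlift => x y; rewrite antipode_invM antipodeK.
by lin.
Qed.

Lemma antipode_inv_mulr (L : lmodType k) (f : H -> L) h :
  linear f -> \tens_(x, y <- Delta h) f (Si y * x) = (eps h : k) *: f 1.
Proof.
move=> fl.
have := antipode_mull hH h (f := fun z => f (Si z)); rewrite antipode_inv1 => <-.
  by apply: eq_tlift => x y; rewrite antipode_invM antipodeK.
by lin.
Qed.

End AntipodeTheory.

(** * The dual algebra and the Drinfeld double *)

Section DualAlgebra.
Variables (k : fieldType) (H : falgType k).
Variables (Delta : 'Hom(H, tensor H H)) (eps : 'Hom(H, k^o)) (S : 'End(H)).

(** The convolution product depends on [Delta] and [eps]; a synonym carrying the Hopf structure
    gives the ring instances something to depend on. *)
Definition dual_alg of is_hopf Delta eps S : Type := dual_space H.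

Variable hH : is_hopf Delta eps S.

HB.instance Definition _ := Vector.copy (dual_alg hH) (dual_space H).

Local Notation mul := (dual_mul Delta).

Lemma dual_mulA : associative mul.
Proof.
move=> p p' p''; apply/lfunP => h; rewrite !dual_mulE.
under eq_tlift do rewrite dual_mulE.
under [RHS]eq_tlift do rewrite dual_mulE.
transitivity (\tens_(h1, h' <- Delta h) \tens_(h2, h3 <- Delta h')
  (p h1 * p' h2 * p'' h3 : k^o)).
  apply: eq_tlift => h1 h'; rewrite (tlift_comp (f := fun z : k^o => p h1 * z)).
    by apply: eq_tlift => h2 h3; rewrite mulrA.
  by lin.
rewrite -(comul_coassoc hH (B := fun h1 h2 h3 => p h1 * p' h2 * p'' h3 : k^o));
  [|lin..].
apply: eq_tlift => h1 h'.
by rewrite (tlift_comp (f := fun z : k^o => z * p'' h' : k^o)) //; lin.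
Qed.

Lemma dual_mul1 : left_id (eps : dual_space H) mul.
Proof.
move=> p; apply/lfunP => h; rewrite dual_mulE.
by rewrite -[RHS](comul_counitl hH); [|lin].
Qed.

Lemma dual_mulr1 : right_id (eps : dual_space H) mul.
Proof.
move=> p; apply/lfunP => h; rewrite dual_mulE.
rewrite -[RHS](comul_counitr hH); [|lin].
by apply: eq_tlift => x y; rewrite mulrC.
Qed.

Lemma dual_mul_linearr p : linear (mul p).
Proof.
move=> c p' p''; apply/lfunP => h; rewrite add_lfunE scale_lfunE !dual_mulE.
pose B (p' : dual_space H) h1 h2 : k^o := p h1 * p' h2.
suff Bl: linear (fun p => tlift (B p) (Delta h)) by exact: Bl.
apply: tlift_param_linear => h1 h2 e u v.
by rewrite /B add_lfunE scale_lfunE mulrDr -scalerAr.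
Qed.

Fact dual_mulDl : left_distributive mul +%R.
Proof.
move=> p p' p''; rewrite -[p in LHS]scale1r.
by rewrite (dual_mul_linearl Delta p'' 1) scale1r.
Qed.

Fact dual_mulDr : right_distributive mul +%R.
Proof.
move=> p p' p''; rewrite -[p' in LHS]scale1r.
by rewrite (dual_mul_linearr p 1) scale1r.
Qed.

Fact dual_one_neq0 : (eps : dual_space H) != 0.
Proof.
apply/eqP => /(congr1 (fun p : dual_space H => p 1)) /eqP.
by rewrite (hopf_counit1 hH) zero_lfunE oner_eq0.
Qed.

HB.instance Definition _ := GRing.Zmodule_isNzRing.Build (dual_alg hH)
  dual_mulA dual_mul1 dual_mulr1 dual_mulDl dual_mulDr dual_one_neq0.

Fact dual_scaleAl (c : k) (p p' : dual_alg hH) : c *: (p * p') = (c *: p) * p'.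
Proof.
have e0 : mul 0 p' = 0 by exact: (mul0r p').
by have := dual_mul_linearl Delta p' c p 0; rewrite addr0 e0 addr0.
Qed.

HB.instance Definition _ :=
  GRing.Lmodule_isLalgebra.Build k (dual_alg hH) dual_scaleAl.

Fact dual_scaleAr (c : k) (p p' : dual_alg hH) : c *: (p * p') = p * (c *: p').
Proof.
have e0 : mul p 0 = 0 by exact: (mulr0 p).
by have := dual_mul_linearr p c p' 0; rewrite addr0 e0 addr0.
Qed.

HB.instance Definition _ :=
  GRing.Lalgebra_isAlgebra.Build k (dual_alg hH) dual_scaleAr.

Lemma dual_algME (p p' : dual_alg hH) h :
  (p * p' : dual_space H) h
  = \tens_(h1, h2 <- Delta h) ((p : dual_space H) h1 * (p' : dual_space H) h2 : k^o).
Proof. exact: dual_mulE. Qed.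

End DualAlgebra.

(** * The double as linear endomorphisms of $H$ *)

Section Evaluation.
Variables (k : fieldType) (H : falgType k).

(* An element of the double is determined by this linear map H -> H. *)
Definition ev (X : drinfeld_double H) (x : H) : H :=
  tlift (fun (p : dual_space H) h => (p x : k) *: h) X.

Lemma ev_linearr X : linear (ev X).
Proof.
by rewrite /ev; apply: tlift_param_linear => p h; apply: linear_scalel; lin.
Qed.

Lemma ev_linearl x : linear (ev^~ x).
Proof. by rewrite /ev; lin. Qed.

Lemma ev_pure p h x : ev (p ⊗ h) x = (p x : k) *: h.
Proof.
rewrite /ev tliftE //; last by lin.
by move=> h' c p' p''; rewrite add_lfunE scale_lfunE scalerDl scalerA.
Qed.

Lemma evD X Y x : ev (X + Y) x = ev X x + ev Y x.
Proof. by have := ev_linearl x 1 X Y; rewrite !scale1r. Qed.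

Lemma evZ c X x : ev (c *: X) x = c *: ev X x.
Proof. exact: (scalable_linear (ev_linearl x)). Qed.

(** At a fixed $x$, independence of the basis of $H$ kills each coefficient. As $x$ varies, each
    coefficient is a combination of basis functionals of $H^*$, whose independence then kills the
    coordinates of $X$. *)
Lemma ev_eq0 X : (forall x, ev X x = 0) -> X = 0.
Proof.
move=> X0; apply/matrixP => i j; rewrite [RHS]mxE.
have /freeP := basis_free (vbasisP {:dual_space H}).
move=> /(_ (fun i => (X : 'M_(_, _)) i j)); apply; apply/lfunP => x.
rewrite zero_lfunE sum_lfunE.
transitivity (\sum_i (X : 'M_(_, _)) i j *: (((vbasis {:dual_space H})`_i : dual_space H) x)).
  by apply: eq_bigr => i' _; rewrite scale_lfunE.
have /freeP := basis_free (vbasisP {:H}).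
move=> /(_ (fun j => \sum_i (X : 'M_(_, _)) i j *: ((vbasis {:dual_space H})`_i : dual_space H) x)).
apply; rewrite -[RHS](X0 x) /ev /tlift exchange_big /=; apply: eq_bigr => j' _.
by rewrite scaler_suml; apply: eq_bigr => i' _; rewrite scalerA.
Qed.

Lemma ev_inj X Y : (forall x, ev X x = ev Y x) -> X = Y.
Proof.
move=> eXY; apply/eqP; rewrite -subr_eq0; apply/eqP/ev_eq0 => x.
by rewrite -scaleN1r evD evZ eXY scaleN1r subrr.
Qed.

End Evaluation.

Section DoubleAction.
Variables (k : fieldType) (H : falgType k).
Variables (Delta : 'Hom(H, tensor H H)) (eps : 'Hom(H, k^o)) (S : 'End(H)).
Hypothesis hH : is_hopf Delta eps S.
Hypothesis S_inj : lker S == 0%VS.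
Local Notation Si := (S^-1)%VF.

(* Left multiplication by eps (x) h, and below the full product, read through
   [ev]. *)
Definition act (h : H) (g : H -> H) (y : H) : H :=
  \tens_(h1, h' <- Delta h) \tens_(h2, h3 <- Delta h')
    (h2 * g (Si h3 * y * h1)).

Definition conv (f g : H -> H) (x : H) : H :=
  \tens_(x1, x2 <- Delta x) act (f x1) g x2.

Lemma eq_act h g g' y : g =1 g' -> act h g y = act h g' y.
Proof.
by move=> eg; apply: eq_tlift => h1 h'; apply: eq_tlift => h2 h3; rewrite eg.
Qed.

Lemma act_linearh g y : linear g -> linear (fun h => act h g y).
Proof. by by move=> gl; rewrite /act; lin.
Qed.

Lemma act_lineary h g : linear g -> linear (act h g).
Proof.
move=> gl; rewrite /act; lin. Qed.

Lemma act_tlift (V W : vectType k) h (B : V -> W -> H -> H) X y :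
  act h (fun z => \tens_(v, w <- X) B v w z) y
  = \tens_(v, w <- X) act h (B v w) y.
Proof.
rewrite /act tlift_swap; apply: eq_tlift => h1 h'.
rewrite tlift_swap; apply: eq_tlift => h2 h3.
by rewrite tlift_comp; last lin.
Qed.

Lemma act1 g y : linear g -> act 1 g y = g y.
Proof.
move=> gl; rewrite /act (hopf_comul1 hH) tliftE; [|lin..].
rewrite (hopf_comul1 hH) tliftE; [|lin..].
by rewrite mul1r (antipode_inv1 hH) ?mul1r ?mulr1.
Qed.

(** The iterated coproduct is multiplicative and $S^{-1}$ reverses products, so the two
    substitutions $y\mapsto S^{-1}(h_3)\,y\,h_1$ nest in the right order. *)
Lemma actM h h' g y : linear g -> act (h * h') g y = act h (act h' g) y.
Proof.
move=> gl; rewrite {1}/act.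
rewrite (comul_mul hH (B := fun z1 z' => \tens_(z2, z3 <- Delta z')
  (z2 * g (Si z3 * y * z1)))); [|lin..].
apply: eq_tlift => h1 h''.
transitivity (\tens_(k1, k' <- Delta h') \tens_(h2, h3 <- Delta h'')
  \tens_(k2, k3 <- Delta k') (h2 * k2 * g (Si (h3 * k3) * y * (h1 * k1)))).
  apply: eq_tlift => k1 k'.
  rewrite (comul_mul hH (B := fun z2 z3 => z2 * g (Si z3 * y * (h1 * k1))));
    [|lin..].
  by [].
rewrite tlift_swap; apply: eq_tlift => h2 h3.
rewrite /act [RHS]tlift_comp; last by lin.
apply: eq_tlift => k1 k'; rewrite [RHS]tlift_comp; last by lin.
by apply: eq_tlift => k2 k3; rewrite (antipode_invM hH) // !mulrA.
Qed.

Lemma conv_linear f g : linear f -> linear g -> linear (conv f g).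
Proof. by move=> fl gl; rewrite /conv; lin. Qed.

Lemma eq_conv f f' g g' : f =1 f' -> g =1 g' -> conv f g =1 conv f' g'.
Proof.
move=> ef eg x; apply: eq_tlift => x1 x2; rewrite ef; exact: eq_act.
Qed.

Lemma ev_mul_pure p h p' h' x :
  ev (double_mul_pure Delta S p h p' h') x
  = \tens_(x1, x2 <- Delta x)
      ((p x1 : k) *: act h (fun y => (p' y : k) *: h') x2).
Proof.
(* Contracting $p$ with the first leg of $x$ reduces $pp_2$ at $x$ to $p_2$ at [w]; the three legs
   of $p'$ then recombine into $p'(S^{-1}(h_3)\,w\,h_1)$. *)
pose w := \tens_(x1, x2 <- Delta x) ((p x1 : k) *: x2).
have hl : linear (fun y => (p' y : k) *: h') by apply: linear_scalel; lin.
transitivity (act h (fun y => (p' y : k) *: h') w); last first.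
  rewrite /w (tlift_comp (f := act h _)); last by apply: act_lineary.
  apply: eq_tlift => x1 x2; exact: (scalable_linear (act_lineary h hl)).
have wE (p2 : dual_space H) : dual_mul Delta p p2 x = p2 w.
  rewrite dual_mulE /w tlift_comp; last by lin.
  by apply: eq_tlift => x1 x2; rewrite linearZ.
rewrite /double_mul_pure.
transitivity (\tens_(p1, p23 <- dual_comul p') \tens_(p2, p3 <- dual_comul p23)
  \tens_(h1, h23 <- Delta h) \tens_(h2, h3 <- Delta h23)
   (((p1 : dual_space H) (Si h3) * ((p2 : dual_space H) w * (p3 : dual_space H) h1) : k)
      *: (h2 * h'))).
  rewrite (tlift_comp (f := fun X => ev X x)); last by apply: ev_linearl.
  apply: eq_tlift => p1 p23.
  rewrite (tlift_comp (f := fun X => ev X x)); last by apply: ev_linearl.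
  apply: eq_tlift => p2 p3.
  rewrite (tlift_comp (f := fun X => ev X x)); last by apply: ev_linearl.
  apply: eq_tlift => h1 h23.
  rewrite (tlift_comp (f := fun X => ev X x)); last by apply: ev_linearl.
  apply: eq_tlift => h2 h3.
  by rewrite evZ ev_pure wE scalerA mulrAC mulrA.
rewrite tlift_swap2; apply: eq_tlift => h1 h23; apply: eq_tlift => h2 h3.
rewrite -scalerAr -mulrA -dual_comulE.
rewrite (tlift_comp (f := fun c : k^o => (c : k) *: (h2 * h'))); last first.
  by apply: linear_scalel; lin.
apply: eq_tlift => p1 p23.
rewrite -dual_comulE.
rewrite (tlift_comp (f := fun c : k^o => (p1 (Si h3) * c : k) *: (h2 * h'))) //.
by apply: linear_scalel; lin.
Qed.

Lemma ev_double_mul X Y x :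
  ev (double_mul Delta S X Y) x = conv (ev X) (ev Y) x.
Proof.
transitivity (tlift (fun (p : dual_space H) h =>
  tlift (fun (p' : dual_space H) h' => \tens_(x1, x2 <- Delta x)
      ((p x1 : k) *: act h (fun y => (p' y : k) *: h') x2)) Y) X).
  rewrite /double_mul (tlift_comp (f := fun X => ev X x)); last by apply: ev_linearl.
  apply: eq_tlift => p h.
  rewrite (tlift_comp (f := fun X => ev X x)); last by apply: ev_linearl.
  by apply: eq_tlift => p' h'; rewrite ev_mul_pure.
transitivity (tlift (fun (p : dual_space H) h => \tens_(x1, x2 <- Delta x)
      ((p x1 : k) *: act h (ev Y) x2)) X).
  apply: eq_tlift => p h; rewrite tlift_swap; apply: eq_tlift => x1 x2.
  rewrite /ev act_tlift (tlift_comp (f := fun z => (p x1 : k) *: z)) //.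
  by lin.
rewrite tlift_swap; apply: eq_tlift => x1 x2.
rewrite [in RHS]/ev.
rewrite (tlift_comp (f := fun h => act h (ev Y) x2)); last first.
  exact: (act_linearh _ (ev_linearr Y)).
apply: eq_tlift => p h.
by rewrite (scalable_linear (act_linearh _ (ev_linearr Y))).
Qed.

(** The last hypothesis is associativity with the first factor replaced by some $h\in H$. It is
    applied at $h=f(x_1)$, the only way in which [f] enters [conv]. *)
Lemma conv_assoc f g g' x : linear f -> linear g -> linear g' ->
  (forall h y, act h (conv g g') y = conv (act h g) g' y) ->
  conv (conv f g) g' x = conv f (conv g g') x.
Proof.
move=> fl gl g'l cA; rewrite /conv.
transitivity (\tens_(x12, x3 <- Delta x) \tens_(x1, x2 <- Delta x12)
   act (act (f x1) g x2) g' x3).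
  apply: eq_tlift => x12 x3; rewrite (tlift_comp (f := fun h => act h g' x3)) //.
  exact: act_linearh.
rewrite (comul_coassoc hH (B := fun x1 x2 x3 => act (act (f x1) g x2) g' x3)).
- by apply: eq_tlift => x1 x'; rewrite cA.
- move=> y z; apply: (linear_comp (act_linearh _ g'l)).
  by apply: (linear_comp (act_linearh _ gl)).
- move=> y z; apply: (linear_comp (act_linearh _ g'l)); exact: act_lineary.
- by move=> y z; apply: act_lineary.
Qed.

End DoubleAction.

(** * Ring structure of the double *)

Section DoubleAlgebra.
Variables (k : fieldType) (H : falgType k).
Variables (Delta : 'Hom(H, tensor H H)) (eps : 'Hom(H, k^o)) (S : 'End(H)).

(* That is, h (X Y) = (h X) Y in the double. *)
Definition act_conv_stable : Prop :=
  forall f g, linear f -> linear g ->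
  forall h y, act Delta S h (conv Delta S f g) y
              = conv Delta S (act Delta S h f) g y.

(** As for [dual_alg], the parameters record the facts from which the ring laws are derived. *)
Definition double_alg of is_hopf Delta eps S & lker S == 0%VS & act_conv_stable
  : Type := drinfeld_double H.

Variables (hH : is_hopf Delta eps S) (S_inj : lker S == 0%VS).
Variable hA : act_conv_stable.

Local Notation Si := (S^-1)%VF.
Local Notation mul := (double_mul Delta S).
Local Notation one := (double_one eps).
Local Notation act := (act Delta S).
Local Notation conv := (conv Delta S).
Local Notation of_alg := (of_alg eps).

HB.instance Definition _ := Vector.copy (double_alg hH S_inj hA) (drinfeld_double H).

Lemma ev_of_dual p x : ev (of_dual p) x = (p x : k) *: (1 : H).
Proof. exact: ev_pure. Qed.

Lemma ev_of_alg h x : ev (of_alg h) x = (eps x : k) *: h.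
Proof. exact: ev_pure. Qed.

Lemma ev_of_dual_mul p X x :
  ev (mul (of_dual p) X) x = \tens_(x1, x2 <- Delta x) ((p x1 : k) *: ev X x2).
Proof.
rewrite ev_double_mul; apply: eq_tlift => x1 x2; rewrite ev_of_dual.
rewrite (scalable_linear (act_linearh _ _ _ (ev_linearr X))).
by rewrite (act1 hH) //; apply: ev_linearr.
Qed.

Lemma ev_of_alg_mul h X x : ev (mul (of_alg h) X) x = act h (ev X) x.
Proof.
have l y := act_linearh Delta S y (ev_linearr X).
rewrite ev_double_mul -[RHS](comul_counitl hH (f := act h (ev X))).
  by apply: eq_tlift => x1 x2; rewrite ev_of_alg (scalable_linear (l x2)).
by apply: act_lineary; apply: ev_linearr.
Qed.

(** Apply $\epsilon$ to $S^{-1}(x_2)x_1=\epsilon(x)1$. *)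
Lemma counit_antipode_inv x : eps (Si x) = eps x.
Proof.
rewrite -[LHS](comul_counitl hH (f := fun x => eps (Si x))); last by lin.
have -> : eps x = (eps x : k) *: (eps 1 : k^o).
  by rewrite (hopf_counit1 hH) -[RHS]/(_ * 1) mulr1.
rewrite -(antipode_inv_mulr hH S_inj (f := eps)); last by lin.
by apply: eq_tlift => x1 x2; rewrite (hopf_counitM hH) mulrC.
Qed.

(** The value $\epsilon(S^{-1}(h_3)\,y\,h_1)$ factors, and the counit axioms absorb $h_1$ and $h_3$.
    This gives both the right unit law and the embedding of $H$ as a subalgebra. *)
Lemma act_counit h z y :
  act h (fun y => (eps y : k) *: z) y = (eps y : k) *: (h * z).
Proof.
transitivity (\tens_(h1, h' <- Delta h)
  ((eps h1 : k) *: ((eps y : k) *: (h' * z)))).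
  apply: eq_tlift => h1 h'.
  rewrite -(comul_counitr hH
    (f := fun h' => (eps h1 : k) *: ((eps y : k) *: (h' * z)))).
    apply: eq_tlift => h2 h3.
    rewrite !(hopf_counitM hH) counit_antipode_inv -scalerAr !scalerA.
    by congr (_ *: _); rewrite -[LHS]mulrA [_ * eps h1]mulrC.
  by lin.
by rewrite (comul_counitl hH (f := fun h' => (eps y : k) *: (h' * z))); last lin.
Qed.

Fact double_mulA : associative mul.
Proof.
move=> X Y Z; apply: ev_inj => x; rewrite !ev_double_mul.
rewrite (eq_conv _ _ (ev_double_mul Delta S X Y) (frefl (ev Z))).
rewrite (eq_conv _ _ (frefl (ev X)) (ev_double_mul Delta S Y Z)).
symmetry; apply: (conv_assoc hH); try exact: ev_linearr.
by move=> h y; apply: hA; apply: ev_linearr.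
Qed.

Fact double_mul1 : left_id one mul.
Proof.
move=> X; apply: ev_inj => x; rewrite ev_of_alg_mul (act1 hH) //.
exact: ev_linearr.
Qed.

Fact double_mulr1 : right_id one mul.
Proof.
move=> X; apply: ev_inj => x; rewrite ev_double_mul.
rewrite -[RHS](comul_counitr hH (f := ev X)); last exact: ev_linearr.
apply: eq_tlift => x1 x2.
rewrite (eq_act _ _ _ _ (ev_pure (eps : dual_space H) 1)) act_counit mulr1.
by [].
Qed.

Lemma double_mul_linearl Y : linear (mul^~ Y).
Proof. by rewrite /double_mul; lin. Qed.

Lemma double_mul_linearr X : linear (mul X).
Proof. by rewrite /double_mul; lin. Qed.

Fact double_mulDl : left_distributive mul +%R.
Proof.
by move=> X Y Z; have := double_mul_linearl Z 1 X Y; rewrite !scale1r.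
Qed.

Fact double_mulDr : right_distributive mul +%R.
Proof.
by move=> X Y Z; have := double_mul_linearr X 1 Y Z; rewrite !scale1r.
Qed.

Fact double_one_neq0 : one != 0.
Proof.
apply/eqP => /(congr1 (fun X => ev X 1)) /eqP.
rewrite ev_pure (hopf_counit1 hH) scale1r.
by rewrite (_ : ev 0 1 = 0) ?oner_eq0 // -[0 in LHS](scale0r 0) evZ scale0r.
Qed.

HB.instance Definition _ := GRing.Zmodule_isNzRing.Build (double_alg hH S_inj hA)
  double_mulA double_mul1 double_mulr1 double_mulDl double_mulDr double_one_neq0.

Fact double_scaleAl (c : k) (X Y : double_alg hH S_inj hA) :
  c *: (X * Y) = (c *: X) * Y.
Proof. by symmetry; apply: (scalable_linear (double_mul_linearl Y)). Qed.

HB.instance Definition _ :=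
  GRing.Lmodule_isLalgebra.Build k (double_alg hH S_inj hA) double_scaleAl.

Fact double_scaleAr (c : k) (X Y : double_alg hH S_inj hA) :
  c *: (X * Y) = X * (c *: Y).
Proof. by symmetry; apply: (scalable_linear (double_mul_linearr X)). Qed.

HB.instance Definition _ :=
  GRing.Lalgebra_isAlgebra.Build k (double_alg hH S_inj hA) double_scaleAr.

Lemma of_dualM p p' : of_dual (dual_mul Delta p p') = mul (of_dual p) (of_dual p').
Proof.
apply: ev_inj => x; rewrite ev_of_dual_mul ev_of_dual dual_mulE.
rewrite (tlift_comp (f := fun c : k^o => (c : k) *: (1 : H))); last first.
  by apply: linear_scalel; lin.
by apply: eq_tlift => x1 x2; rewrite ev_of_dual scalerA.
Qed.

Lemma of_algM h h' : of_alg (h * h') = mul (of_alg h) (of_alg h').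
Proof.
apply: ev_inj => x; rewrite ev_of_alg ev_of_alg_mul.
by rewrite (eq_act _ _ _ _ (ev_of_alg h')) act_counit.
Qed.

Lemma of_dual_algM p h : mul (of_dual p) (of_alg h) = p ⊗ h.
Proof.
apply: ev_inj => x; rewrite ev_of_dual_mul ev_pure.
rewrite -(comul_counitr hH (f := fun x => (p x : k) *: h)); last first.
  by apply: linear_scalel; lin.
by apply: eq_tlift => x1 x2; rewrite ev_of_alg !scalerA mulrC.
Qed.

Definition double_of_dual (p : dual_alg hH) : double_alg hH S_inj hA := of_dual p.

Fact double_of_dual_linear : linear double_of_dual.
Proof. exact: tpure_linearl. Qed.

Fact double_of_dual_monoid : GRing.monoid_morphism double_of_dual.
Proof. by split=> // p p'; apply: of_dualM. Qed.

HB.instance Definition _ := GRing.isLinear.Build k (dual_alg hH)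
  (double_alg hH S_inj hA) *:%R double_of_dual double_of_dual_linear.
HB.instance Definition _ := GRing.isMonoidMorphism.Build (dual_alg hH)
  (double_alg hH S_inj hA) double_of_dual double_of_dual_monoid.

Definition double_of_alg (x : H) : double_alg hH S_inj hA := of_alg x.

Fact double_of_alg_linear : linear double_of_alg.
Proof. exact: tpure_linearr. Qed.

Fact double_of_alg_monoid : GRing.monoid_morphism double_of_alg.
Proof. by split=> // x y; apply: of_algM. Qed.

HB.instance Definition _ := GRing.isLinear.Build k H
  (double_alg hH S_inj hA) *:%R double_of_alg double_of_alg_linear.
HB.instance Definition _ := GRing.isMonoidMorphism.Build H
  (double_alg hH S_inj hA) double_of_alg double_of_alg_monoid.

Lemma double_of_dual_alg p x :
  double_of_dual p * double_of_alg x = (p : dual_space H) ⊗ x :> drinfeld_double H.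
Proof. exact: of_dual_algM. Qed.

End DoubleAlgebra.

(** * Coalgebra structure and antipode of the double *)

Section DoubleCoalgebra.
Variables (k : fieldType) (H : falgType k).
Variables (Delta : 'Hom(H, tensor H H)) (eps : 'Hom(H, k^o)) (S : 'End(H)).
Hypothesis hH : is_hopf Delta eps S.

Local Notation D := (drinfeld_double H).
Local Notation DeltaD := (double_comul Delta).
Local Notation epsD := (double_counit eps).

Lemma dual_comulZ (L : lmodType k) (p : dual_space H) x y (v : L) :
  tlift (fun p1 p2 : dual_space H => (p1 x * p2 y : k) *: v) (dual_comul p)
  = (p (x * y) : k) *: v.
Proof.
rewrite -dual_comulE (tlift_comp (f := fun c : k^o => (c : k) *: v)) //.
by apply: linear_scalel; lin.
Qed.

Lemma dual_basisE (p : dual_space H) :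
  p = \sum_(i < \dim {:H}) (p (vbasis {:H})`_i : k) *: dual_basis i.
Proof.
apply/lfunP => x; rewrite sum_lfunE [in LHS](coord_vbasis (memvf x)) linear_sum.
by apply: eq_bigr => i _; rewrite linearZ scale_lfunE lfunE /= [LHS]mulrC.
Qed.

Lemma linear_dual_basis (L : lmodType k) (f : dual_space H -> L) p :
  linear f -> f p = \sum_(i < \dim {:H}) (p (vbasis {:H})`_i : k) *: f (dual_basis i).
Proof.
move=> fl; pose fL := GRing.isLinear.Build k (dual_space H) L *:%R f fl.
pose F : {linear dual_space H -> L} := HB.pack f fL.
rewrite {1}[p]dual_basisE -[f]/(F : _ -> _) linear_sum.
by apply: eq_bigr => i _; rewrite linearZ.
Qed.

Lemma dual_comul_tlift (L : lmodType k) (B : dual_space H -> dual_space H -> L) p :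
  (forall y, linear (fun x => B x y)) -> (forall x, linear (fun y => B x y)) ->
  tlift B (dual_comul p)
  = \sum_(i < \dim {:H}) \sum_(j < \dim {:H}) (p ((vbasis {:H})`_i * (vbasis {:H})`_j) : k)
      *: B (dual_basis i) (dual_basis j).
Proof.
move=> B1 B2; rewrite /dual_comul.
pose BL := GRing.isLinear.Build k _ L *:%R _ (tlift_is_linear B).
pose F : {linear _ -> L} := HB.pack (tlift B) BL.
rewrite -[tlift B]/(F : _ -> _) !linear_sum; apply: eq_bigr => i _.
by rewrite linear_sum; apply: eq_bigr => j _; rewrite linearZ /= tliftE.
Qed.

(** Expanded on the dual basis, both sides have the coefficients $p(e_ie_je_l)$: coassociativity of
    $H^*$ is associativity of $H$. *)
Lemma dual_comul_coassoc (L : lmodType k)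
    (B : dual_space H -> dual_space H -> dual_space H -> L) p :
  (forall y z, linear (fun x => B x y z)) ->
  (forall x z, linear (fun y => B x y z)) ->
  (forall x y, linear (fun z => B x y z)) ->
  \tens_(p', p3 <- dual_comul p) \tens_(p1, p2 <- dual_comul p') B p1 p2 p3
  = \tens_(p1, p' <- dual_comul p) \tens_(p2, p3 <- dual_comul p') B p1 p2 p3.
Proof.
move=> B1 B2 B3; pose e := vbasis {:H}.
transitivity (\sum_(i < \dim {:H}) \sum_(j < \dim {:H})
  \sum_(l < \dim {:H}) (p (e`_i * e`_j * e`_l) : k)
   *: B (dual_basis i) (dual_basis j) (dual_basis l)).
  transitivity (\tens_(p', p3 <- dual_comul p) \sum_(i < \dim {:H})
    \sum_(j < \dim {:H}) \sum_(l < \dim {:H})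
    ((p' : dual_space H) (e`_i * e`_j) * (p3 : dual_space H) e`_l : k)
      *: B (dual_basis i) (dual_basis j) (dual_basis l)).
    apply: eq_tlift => p' p3; rewrite dual_comul_tlift //.
    apply: eq_bigr => i _; apply: eq_bigr => j _.
    rewrite (linear_dual_basis _ (B3 _ _)) scaler_sumr.
    by apply: eq_bigr => l _; rewrite scalerA.
  rewrite tlift_sum; apply: eq_bigr => i _.
  rewrite tlift_sum; apply: eq_bigr => j _.
  rewrite tlift_sum; apply: eq_bigr => l _.
  by rewrite dual_comulZ.
symmetry.
transitivity (\tens_(p1, p' <- dual_comul p) \sum_(i < \dim {:H})
    \sum_(j < \dim {:H}) \sum_(l < \dim {:H})
  ((p1 : dual_space H) e`_i * (p' : dual_space H) (e`_j * e`_l) : k)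
    *: B (dual_basis i) (dual_basis j) (dual_basis l)).
  apply: eq_tlift => p1 p'.
  rewrite (linear_dual_basis (f := fun p1 => \tens_(p2, p3 <- dual_comul p') B p1 p2 p3));
    last by lin.
  apply: eq_bigr => i _; rewrite dual_comul_tlift // scaler_sumr.
  apply: eq_bigr => j _; rewrite scaler_sumr.
  by apply: eq_bigr => l _; rewrite scalerA.
rewrite tlift_sum; apply: eq_bigr => i _.
rewrite tlift_sum; apply: eq_bigr => j _.
rewrite tlift_sum; apply: eq_bigr => l _.
by rewrite dual_comulZ mulrA.
Qed.

Lemma linear_dual_comul (T : lmodType k) (f : T -> dual_space H) :
  linear f -> linear (fun t => dual_comul (f t)).
Proof. by apply: linear_comp; apply: dual_comul_linear. Qed.

Lemma double_comul_linear : linear DeltaD.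
Proof. by rewrite /double_comul; lin. Qed.

Lemma double_comul_pure p h :
  DeltaD (p ⊗ h) = \tens_(p1, p2 <- dual_comul p) \tens_(h1, h2 <- Delta h)
    ((p2 ⊗ h1 : D) ⊗ (p1 ⊗ h2 : D)).
Proof.
rewrite /double_comul tliftE //; last by lin.
by move=> h'; apply: linear_tliftr; apply: linear_dual_comul; lin.
Qed.

Lemma double_comul_tlift (L : lmodType k) (F : D -> D -> L) p h :
  (forall y, linear (fun x => F x y)) -> (forall x, linear (fun y => F x y)) ->
  tlift F (DeltaD (p ⊗ h)) = \tens_(p1, p2 <- dual_comul p)
     \tens_(h1, h2 <- Delta h) F (p2 ⊗ h1) (p1 ⊗ h2).
Proof.
move=> F1 F2; rewrite double_comul_pure.
rewrite (tlift_comp (f := tlift F)); last by lin.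
apply: eq_tlift => p1 p2; rewrite (tlift_comp (f := tlift F)); last by lin.
by apply: eq_tlift => h1 h2; rewrite tliftE.
Qed.

Lemma double_counit_linear : linear (epsD : D -> k^o).
Proof. exact: tlift_is_linear. Qed.

Lemma double_counit_pure p h : epsD (p ⊗ h) = p 1 * eps h.
Proof.
rewrite /double_counit tliftE //.
  move=> w c u v; rewrite add_lfunE scale_lfunE mulrDl; congr (_ + _).
  by rewrite -[LHS]mulrA.
by move=> v c u w; rewrite linearP mulrDr; congr (_ + _); rewrite mulrCA.
Qed.

Lemma double_ind (P : D -> Prop) :
  (forall X Y, P X -> P Y -> P (X + Y)) -> (forall c X, P X -> P (c *: X)) ->
  (forall p h, P (p ⊗ h)) -> forall X, P X.
Proof.
move=> PD PZ Pp X; rewrite [X]tensorE.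
have P0 : P 0 by rewrite -(scale0r (0 ⊗ 0)); apply: PZ.
by do 2!apply: big_ind => // ? _; apply: PZ.
Qed.

Lemma eq_double (L : lmodType k) (f g : D -> L) : linear f -> linear g ->
  (forall p h, f (p ⊗ h) = g (p ⊗ h)) -> f =1 g.
Proof.
move=> fl gl e; apply: double_ind => // [X Y eX eY|c X eX].
  by have := fl 1 X Y; have := gl 1 X Y; rewrite !scale1r eX eY => -> ->.
by rewrite (scalable_linear fl) eX (scalable_linear gl).
Qed.

Lemma double_comul_coassoc (L : lmodType k) (B : D -> D -> D -> L) X :
  (forall y z, linear (fun x => B x y z)) ->
  (forall x z, linear (fun y => B x y z)) ->
  (forall x y, linear (fun z => B x y z)) ->
  \tens_(X', X3 <- DeltaD X) \tens_(X1, X2 <- DeltaD X') B X1 X2 X3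
  = \tens_(X1, X' <- DeltaD X) \tens_(X2, X3 <- DeltaD X') B X1 X2 X3.
Proof.
move=> B1 B2 B3; have DDl := double_comul_linear.
pose f X := \tens_(X', X3 <- DeltaD X) \tens_(X1, X2 <- DeltaD X') B X1 X2 X3.
pose g X := \tens_(X1, X' <- DeltaD X) \tens_(X2, X3 <- DeltaD X') B X1 X2 X3.
have fl : linear f by rewrite /f; lin.
have gl : linear g by rewrite /g; lin.
apply: (eq_double fl gl) => {X} p h; rewrite /f /g.
rewrite double_comul_tlift; [|lin..].
rewrite double_comul_tlift; [|lin..].
transitivity (\tens_(p1, p' <- dual_comul p) \tens_(p2, p3 <- dual_comul p')
  \tens_(h', h3 <- Delta h) \tens_(h1, h2 <- Delta h')
   B (p3 ⊗ h1) (p2 ⊗ h2) (p1 ⊗ h3)).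
  apply: eq_tlift => p1 p'; rewrite [RHS]tlift_swap; apply: eq_tlift => h' h3.
  by rewrite double_comul_tlift.
(* The first factor is co-opposite: splitting the left leg of the double splits the first leg of $h$
   but the second of $p$, so the two coassociativity laws are used in opposite directions. *)
rewrite -(dual_comul_coassoc (B := fun p1 p2 p3 =>
  \tens_(h', h3 <- Delta h) \tens_(h1, h2 <- Delta h')
   B (p3 ⊗ h1) (p2 ⊗ h2) (p1 ⊗ h3))); [|lin..].
apply: eq_tlift => p' p3.
transitivity (\tens_(p1, p2 <- dual_comul p')
  \tens_(h1, h' <- Delta h) \tens_(h2, h3 <- Delta h')
   B (p3 ⊗ h1) (p2 ⊗ h2) (p1 ⊗ h3)).
  apply: eq_tlift => p1 p2.
  rewrite (comul_coassoc hH (B := fun h1 h2 h3 =>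
    B (p3 ⊗ h1) (p2 ⊗ h2) (p1 ⊗ h3))); [|lin..].
  by [].
rewrite tlift_swap; apply: eq_tlift => h1 h'.
by rewrite double_comul_tlift.
Qed.

Lemma dual_comul_counitl (L : lmodType k) (f : dual_space H -> L) p :
  linear f ->
  tlift (fun p1 p2 : dual_space H => (p1 1 : k) *: f p2) (dual_comul p) = f p.
Proof.
move=> fl; rewrite dual_comul_tlift; first last.
- by move=> p1; apply: linear_scaler.
- by move=> p2; apply: linear_scalel => c x y; rewrite add_lfunE scale_lfunE.
rewrite exchange_big (linear_dual_basis _ fl); apply: eq_bigr => j _ /=.
rewrite -{2}[(vbasis _)`_j]mul1r [in RHS](coord_vbasis (memvf (1 : H))).
rewrite mulr_suml linear_sum scaler_suml; apply: eq_bigr => i _.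
by rewrite -scalerAl !linearZ /= !scalerA /dual_basis lfunE /=; congr (_ *: _); rewrite linearZ.
Qed.

Lemma dual_comul_counitr (L : lmodType k) (f : dual_space H -> L) p :
  linear f ->
  tlift (fun p1 p2 : dual_space H => (p2 1 : k) *: f p1) (dual_comul p) = f p.
Proof.
move=> fl; rewrite dual_comul_tlift; first last.
- by move=> p2; apply: linear_scalel => c x y; rewrite add_lfunE scale_lfunE.
- by move=> p1; apply: linear_scaler.
rewrite (linear_dual_basis _ fl); apply: eq_bigr => j _ /=.
rewrite -{2}[(vbasis _)`_j]mulr1 [in RHS](coord_vbasis (memvf (1 : H))).
rewrite mulr_sumr linear_sum scaler_suml; apply: eq_bigr => i _.
by rewrite -scalerAr !linearZ /= !scalerA /dual_basis lfunE /=; congr (_ *: _); rewrite linearZ.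
Qed.

Lemma double_counitl (L : lmodType k) (f : D -> L) X : linear f ->
  \tens_(X1, X2 <- DeltaD X) (epsD X1 *: f X2) = f X.
Proof.
move=> fl; have DDl := double_comul_linear; have el := double_counit_linear.
have e2 : forall Y, linear (fun X : D => epsD X *: f Y).
  by move=> Y; apply: (linear_scalel _ el).
pose g X := \tens_(X1, X2 <- DeltaD X) (epsD X1 *: f X2).
have gl : linear g by rewrite /g; lin.
apply: (eq_double gl fl) => {X} p h; rewrite /g.
rewrite double_comul_tlift; [|lin..].
rewrite -(dual_comul_counitr (f := fun p => f (p ⊗ h))); last by lin.
apply: eq_tlift => p1 p2.
rewrite -(comul_counitl hH (f := fun h => (p2 1 : k) *: f (p1 ⊗ h))); last by lin.
by apply: eq_tlift => h1 h2; rewrite double_counit_pure scalerA mulrC.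
Qed.

Lemma double_counitr (L : lmodType k) (f : D -> L) X : linear f ->
  \tens_(X1, X2 <- DeltaD X) (epsD X2 *: f X1) = f X.
Proof.
move=> fl; have DDl := double_comul_linear; have el := double_counit_linear.
have e2 : forall Y, linear (fun X : D => epsD X *: f Y).
  by move=> Y; apply: (linear_scalel _ el).
pose g X := \tens_(X1, X2 <- DeltaD X) (epsD X2 *: f X1).
have gl : linear g by rewrite /g; lin.
apply: (eq_double gl fl) => {X} p h; rewrite /g.
rewrite double_comul_tlift; [|lin..].
rewrite -(dual_comul_counitl (f := fun p => f (p ⊗ h))); last by lin.
apply: eq_tlift => p1 p2.
rewrite -(comul_counitr hH (f := fun h => (p1 1 : k) *: f (p2 ⊗ h))); last by lin.
by apply: eq_tlift => h1 h2; rewrite double_counit_pure scalerA mulrC.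
Qed.

End DoubleCoalgebra.

Section DoubleAntipode.
Variables (k : fieldType) (H : falgType k).
Variables (Delta : 'Hom(H, tensor H H)) (eps : 'Hom(H, k^o)) (S : 'End(H)).
Variables (hH : is_hopf Delta eps S) (S_inj : lker S == 0%VS).
Variable hA : act_conv_stable Delta S.

Local Notation D := (drinfeld_double H).
Local Notation Si := (S^-1)%VF.
Local Notation mul := (double_mul Delta S).
Local Notation one := (double_one eps).
Local Notation of_alg := (of_alg eps).
Local Notation DeltaD := (double_comul Delta).
Local Notation epsD := (double_counit eps).

(** An antipode reverses products, hence the order. On the co-opposite of $H^*$ it is the inverse of
    the transpose of $S$, hence $p\circ S^{-1}$. *)
Definition double_antipode_fun (X : D) : D :=
  tlift (fun (p : dual_space H) h =>
    mul (of_alg (S h)) (of_dual (p \o Si)%VF)) X.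

Definition double_antipode : 'End(D) := linfun double_antipode_fun.

Lemma linear_double_mull (T : lmodType k) (f : T -> D) Y :
  linear f -> linear (fun t => mul (f t) Y).
Proof. exact: linear_comp (double_mul_linearl Delta S Y). Qed.

Lemma linear_double_mulr (T : lmodType k) (f : T -> D) X :
  linear f -> linear (fun t => mul X (f t)).
Proof. exact: linear_comp (double_mul_linearr Delta S X). Qed.

Lemma comp_linearl (f : 'End(H)) : linear (fun p : dual_space H => (p \o f)%VF).
Proof.
move=> c p r; apply/lfunP => x.
by rewrite !(comp_lfunE, add_lfunE, scale_lfunE).
Qed.

Lemma of_dual_linear : linear (@of_dual k H).
Proof. exact: tpure_linearl. Qed.

Lemma of_alg_linear : linear of_alg.
Proof. exact: tpure_linearr. Qed.

Lemma double_antipodeE X : double_antipode X = double_antipode_fun X.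
Proof.
have l : linear double_antipode_fun by rewrite /double_antipode_fun; lin.
pose fL := GRing.isLinear.Build k D D *:%R _ l.
pose F : {linear D -> D} := HB.pack double_antipode_fun fL.
exact: (lfunE F X).
Qed.

Lemma double_antipode_pure p h :
  double_antipode (p ⊗ h) = mul (of_alg (S h)) (of_dual (p \o Si)%VF).
Proof.
have ol := of_dual_linear; have al := of_alg_linear.
have cl := comp_linearl Si.
rewrite double_antipodeE /double_antipode_fun tliftE //.
- by move=> h'; apply: linear_double_mulr; lin.
- by move=> p'; apply: linear_double_mull; lin.
Qed.

(** Evaluated at $x$, the sum is $p(x_2S^{-1}(x_1))$ times the unit, so the identity is an antipode
    axiom for $S^{-1}$ in $H$. *)
Lemma of_dual_antipodel p :
  \tens_(p1, p2 <- dual_comul p) of_dual (dual_mul Delta (p2 \o Si)%VF p1)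
  = (p 1 : k) *: one.
Proof.
apply: ev_inj => x; rewrite (tlift_comp (f := fun X => ev X x)); last first.
  exact: ev_linearl.
transitivity (\tens_(x1, x2 <- Delta x) ((p (x2 * Si x1) : k) *: (1 : H))).
  transitivity (\tens_(p1, p2 <- dual_comul p) \tens_(x1, x2 <- Delta x)
     (((p1 : dual_space H) x2 * (p2 : dual_space H) (Si x1) : k) *: (1 : H))).
    apply: eq_tlift => p1 p2; rewrite ev_of_dual dual_mulE.
    rewrite (tlift_comp (f := fun c : k^o => (c : k) *: (1 : H))); last first.
      by apply: linear_scalel; lin.
    by apply: eq_tlift => x1 x2; rewrite comp_lfunE mulrC.
  by rewrite tlift_swap; apply: eq_tlift => x1 x2; rewrite dual_comulZ.
rewrite (antipode_inv_mull hH S_inj (f := fun z => (p z : k) *: (1 : H))).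
  by rewrite evZ ev_pure !scalerA mulrC.
by apply: linear_scalel; lin.
Qed.

Lemma of_dual_antipoder p :
  \tens_(p1, p2 <- dual_comul p) of_dual (dual_mul Delta p2 (p1 \o Si)%VF)
  = (p 1 : k) *: one.
Proof.
apply: ev_inj => x; rewrite (tlift_comp (f := fun X => ev X x)); last first.
  exact: ev_linearl.
transitivity (\tens_(x1, x2 <- Delta x) ((p (Si x2 * x1) : k) *: (1 : H))).
  transitivity (\tens_(p1, p2 <- dual_comul p) \tens_(x1, x2 <- Delta x)
     (((p1 : dual_space H) (Si x2) * (p2 : dual_space H) x1 : k) *: (1 : H))).
    apply: eq_tlift => p1 p2; rewrite ev_of_dual dual_mulE.
    rewrite (tlift_comp (f := fun c : k^o => (c : k) *: (1 : H))); last first.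
      by apply: linear_scalel; lin.
    by apply: eq_tlift => x1 x2; rewrite comp_lfunE mulrC.
  by rewrite tlift_swap; apply: eq_tlift => x1 x2; rewrite dual_comulZ.
rewrite (antipode_inv_mulr hH S_inj (f := fun z => (p z : k) *: (1 : H))).
  by rewrite evZ ev_pure !scalerA mulrC.
by apply: linear_scalel; lin.
Qed.

(** In $S_D(X_1)X_2$ the functionals stand between $S(h_1)$ and $h_2$ and contract first; in
    $X_1S_D(X_2)$ the factor $h_1S(h_2)$ stands between the functionals and contracts first. The
    outer two factors then become adjacent and contract in turn. *)
Lemma double_antipodeP : is_antipode mul one DeltaD epsD double_antipode.
Proof.
have ol := of_dual_linear; have al := of_alg_linear.
have ml Y : linear (mul^~ Y) by exact: double_mul_linearl.
have mr Y : linear (mul Y) by exact: double_mul_linearr.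
have DDl := double_comul_linear Delta; have el := double_counit_linear eps.
have e2 : linear (fun X : D => epsD X *: (one : D)).
  exact: (linear_scalel _ el).
have mA := double_mulA hH hA.
move=> X; split.
  pose f X := \tens_(X1, X2 <- DeltaD X) mul (double_antipode X1) X2.
  have fl : linear f by rewrite /f; lin.
  apply: (eq_double fl e2) => {X} p h; rewrite /f double_counit_pure.
  rewrite double_comul_tlift; [|lin..].
  rewrite tlift_swap.
  transitivity (\tens_(h1, h2 <- Delta h) ((p 1 : k) *: of_alg (S h1 * h2))).
    apply: eq_tlift => h1 h2.
    transitivity (\tens_(p1, p2 <- dual_comul p)
      (mul (mul (of_alg (S h1))
        (of_dual (dual_mul Delta (p2 \o Si)%VF p1))) (of_alg h2))).
      apply: eq_tlift => p1 p2; rewrite double_antipode_pure (of_dualM hH S_inj).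
      by rewrite -(of_dual_algM hH S_inj) !mA.
    rewrite -(tlift_comp (f := fun Y => mul (mul (of_alg (S h1)) Y) (of_alg h2)));
      last by lin.
    rewrite of_dual_antipodel (of_algM hH S_inj) (scalable_linear (mr _)).
    by rewrite (scalable_linear (ml _)) (double_mulr1 hH S_inj).
  rewrite (antipode_mull hH (f := fun z => (p 1 : k) *: of_alg z)); last by lin.
  by rewrite scalerA mulrC.
pose f X := \tens_(X1, X2 <- DeltaD X) mul X1 (double_antipode X2).
have fl : linear f by rewrite /f; lin.
apply: (eq_double fl e2) => {X} p h; rewrite /f double_counit_pure.
rewrite double_comul_tlift; [|lin..].
transitivity (\tens_(p1, p2 <- dual_comul p)
  ((eps h : k) *: of_dual (dual_mul Delta p2 (p1 \o Si)%VF))).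
  apply: eq_tlift => p1 p2.
  transitivity (\tens_(h1, h2 <- Delta h)
    (mul (mul (of_dual p2) (of_alg (h1 * S h2))) (of_dual (p1 \o Si)%VF))).
    apply: eq_tlift => h1 h2; rewrite double_antipode_pure (of_algM hH S_inj).
    by rewrite -(of_dual_algM hH S_inj) !mA.
  rewrite (antipode_mulr hH
    (f := fun z => mul (mul (of_dual p2) (of_alg z)) (of_dual (p1 \o Si)%VF)));
    last by lin.
  by rewrite (of_dualM hH S_inj) (double_mulr1 hH S_inj).
rewrite -(tlift_comp (f := fun Y => (eps h : k) *: Y)); last by lin.
by rewrite of_dual_antipoder scalerA mulrC.
Qed.

(** The convolution of [double_antipode], the identity and [T] equals the first or the last of them
    according to the bracketing. *)
Lemma double_antipode_unique (T : 'End(D)) :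
  is_antipode mul one DeltaD epsD T -> double_antipode = T.
Proof.
move=> hT; apply/lfunP => X.
have ml Y : linear (mul^~ Y) by exact: double_mul_linearl.
have mr Y : linear (mul Y) by exact: double_mul_linearr.
have mA := double_mulA hH hA.
rewrite -[LHS](double_counitr hH (f := double_antipode)); last by lin.
transitivity (\tens_(X1, X' <- DeltaD X) \tens_(X2, X3 <- DeltaD X')
   mul (mul (double_antipode X1) X2) (T X3)).
  apply: eq_tlift => X1 X'.
  transitivity (mul (double_antipode X1) (epsD X' *: one)).
    by rewrite (scalable_linear (mr _)) (double_mulr1 hH S_inj).
  rewrite -(proj2 (hT X')) (tlift_comp (f := mul (double_antipode X1))) //.
  by apply: eq_tlift => X2 X3; rewrite mA.
rewrite -(double_comul_coassoc hH (B := fun X1 X2 X3 =>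
  mul (mul (double_antipode X1) X2) (T X3))); [|lin..].
rewrite -[RHS](double_counitl hH (f := T)); last by lin.
apply: eq_tlift => X' X3.
rewrite -(tlift_comp (f := fun Y => mul Y (T X3))) // (proj1 (double_antipodeP X')).
by rewrite (scalable_linear (ml _)) (double_mul1 hH S_inj).
Qed.

End DoubleAntipode.

(** * Free algebras *)

Lemma malgZU (k : fieldType) (g : nat) (c : k) (m : {fmonom 'I_g}) :
  << c *g m >> = c *: << m >> :> {malg k[{fmonom 'I_g}]}.
Proof.
by apply/malgP => m'; rewrite mcoeffZ !mcoeffU; case: eqP; rewrite ?mulr1 ?mulr0.
Qed.

Section FreeAlgebra.
Variables (k : fieldType) (g : nat).
Local Notation FA := (free_alg k g).

Lemma fgen_cons (i : 'I_g) (s : seq 'I_g) :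
  << FMonom (i :: s) >> = fgen i * << FMonom s >> :> FA.
Proof.
rewrite /fgen -[RHS]/(fgmul _ _) fgmulUU mulr1; congr << 1 *g _ >>.
by apply: val_inj; rewrite /= fmM fmU.
Qed.

Lemma fgen_rcons (i : 'I_g) (s : seq 'I_g) :
  << FMonom (rcons s i) >> = << FMonom s >> * fgen i :> FA.
Proof.
rewrite /fgen -[RHS]/(fgmul _ _) fgmulUU mulr1; congr << 1 *g _ >>.
by apply: val_inj; rewrite /= fmM fmU cats1.
Qed.

Lemma fgen_nil : << FMonom [::] >> = 1 :> FA.
Proof. by congr << 1 *g _ >>; apply: val_inj; rewrite /= fm1. Qed.

Lemma free_alg_ind (P : FA -> Prop) :
  (forall x y, P x -> P y -> P (x + y)) -> (forall c x, P x -> P (c *: x)) ->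
  (forall s, P << FMonom s >>) -> forall x, P x.
Proof.
move=> PD PZ Pw x; rewrite [x]monalgE.
have P0 : P 0 by rewrite -(scale0r 1); apply: PZ; rewrite -fgen_nil.
apply: big_ind => // m _.
by rewrite malgZU; apply: PZ; case: m => s.
Qed.

Lemma free_alg_indl (P : FA -> Prop) :
  (forall x y, P x -> P y -> P (x + y)) -> (forall c x, P x -> P (c *: x)) ->
  P 1 -> (forall i x, P x -> P (fgen i * x)) -> forall x, P x.
Proof.
move=> PD PZ P1 Pg; apply: free_alg_ind => //; elim=> [|i s IHs].
  by rewrite fgen_nil.
by rewrite fgen_cons; apply: Pg.
Qed.

Lemma free_alg_indr (P : FA -> Prop) :
  (forall x y, P x -> P y -> P (x + y)) -> (forall c x, P x -> P (c *: x)) ->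
  P 1 -> (forall i x, P x -> P (x * fgen i)) -> forall x, P x.
Proof.
move=> PD PZ P1 Pg; apply: free_alg_ind => //; elim/last_ind => [|s i IHs].
  by rewrite fgen_nil.
by rewrite fgen_rcons; apply: Pg.
Qed.

Lemma free_alg_hom (A : algType k) (x : 'I_g -> A) :
  exists phi : {linear FA -> A},
    [/\ phi 1 = 1, {morph phi : P Q / P * Q} & forall i, phi (fgen i) = x i].
Proof.
pose h (m : {fmonom 'I_g}) : A := \prod_(i <- fmonom_val m) x i.
have hM : mmorphism h.
  by split=> [m m'|]; rewrite /h ?fmM ?big_cat // fm1 big_nil.
pose hL := isMultiplicative.Build {fmonom 'I_g} A h hM.
pose F : {mmorphism {fmonom 'I_g} -> A} := HB.pack h hL.
pose f (P : FA) : A := mmap (in_alg A) F P.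
(* Multiplicativity on the monoid algebra rests on scalars being central in [A]. *)
have [fM f1] : multiplicative f.
  apply: commr_mmap_is_multiplicative => P m m' /=.
  by rewrite /GRing.comm -scalerAl mul1r -scalerAr mulr1.
have fl : linear f.
  move=> c P Q; rewrite /f raddfD /=; congr (_ + _).
  rewrite -[LHS]/(mmap (in_alg A) F (c *: (P : {malg k[{fmonom 'I_g}]}))).
  by rewrite mmapZ /= -scalerAl mul1r.
pose phiL := GRing.isLinear.Build k FA A *:%R f fl.
pose phi : {linear FA -> A} := HB.pack f phiL.
exists phi; split => // i.
rewrite /fgen /= /f mmapU /= scale1r mul1r /F /= /h.
by rewrite fmU big_seq1.
Qed.

End FreeAlgebra.

(** In an [lalgType] scalars move only into the left factor; for the right factor, constants are
    shown to be central. *)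
Lemma malg_scaleAr (k : fieldType) (M : monomType) (c : k) (x y : {malg k[M]}) :
  c *: (x * y) = x * (c *: y).
Proof.
have cC : c%:MP * x = x * c%:MP.
  rewrite -[LHS]/(fgmul _ _) -[RHS]/(fgmul _ _) fgmulUg fgmulgU.
  by apply: eq_bigr => m _; rewrite mulrC mul1m mulm1.
by rewrite -!mul_malgC mulrA cC mulrA.
Qed.

Lemma free_alg_scaleAr (k : fieldType) g (c : k) (x y : free_alg k g) :
  c *: (x * y) = x * (c *: y).
Proof. exact: malg_scaleAr. Qed.

Lemma presented_rel (k : fieldType) g (A : algType k) rels
    (phi : {linear free_alg k g -> A}) :
  (forall P, phi P = 0 <-> rel_ideal rels P) ->
  forall i, (i < size rels)%N ->
  phi (nth (0, 0) rels i).1 = phi (nth (0, 0) rels i).2.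
Proof.
move=> ker i lti; apply/eqP; rewrite -subr_eq0 -linearB; apply/eqP/ker.
by apply: RelIdealRel; rewrite -surjective_pairing mem_nth.
Qed.

Lemma uq_rels_morph (k : fieldType) (A B : lalgType k) (n : nat) (q : k)
    (phi : {linear A -> B}) (E F K : A) :
  phi 1 = 1 /\ {morph phi : x y / x * y} ->
  (forall i, (i < 6)%N -> phi (nth (0, 0) (uq_rels n q E F K) i).1
                      = phi (nth (0, 0) (uq_rels n q E F K) i).2) ->
  [/\ phi K ^+ n = 1, phi E ^+ n = 0, phi F ^+ n = 0,
      phi K * phi E = q ^+ 2 *: (phi E * phi K)
    & phi K * phi F = q ^- 2 *: (phi F * phi K)
      /\ phi E * phi F - phi F * phi E
         = (q - q^-1)^-1 *: (phi K - phi K ^+ n.-1)].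
Proof.
move=> [phi1 phiM] rel.
have phiX x m : phi (x ^+ m) = phi x ^+ m.
  by elim: m => [|m IHm]; rewrite ?expr0 // !exprS phiM IHm.
have r0 := rel 0 isT; rewrite /= phiX phi1 in r0.
have r1 := rel 1 isT; rewrite /= phiX linear0 in r1.
have r2 := rel 2 isT; rewrite /= phiX linear0 in r2.
have r3 := rel 3 isT; rewrite /= linearZ /= !phiM in r3.
have r4 := rel 4 isT; rewrite /= linearZ /= !phiM in r4.
have r5 := rel 5 isT; rewrite /= linearZ /= !linearB /= !phiM phiX in r5.
by rewrite scalerBr; split.
Qed.

(** * The two regular actions of $H$ on its dual *)

Section Hit.
Variables (k : fieldType) (H : falgType k).
Variables (Delta : 'Hom(H, tensor H H)) (eps : 'Hom(H, k^o)) (S : 'End(H)).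
Variable hH : is_hopf Delta eps S.
Local Notation R := (dual_alg hH).
Local Notation fn p := (p : dual_space H).

(** Usually written $h\rightharpoonup p$ and, for [hitr], $p\leftharpoonup h$. *)
Definition hitl (h : H) (p : R) : R := linfun (fun x => fn p (x * h)).
Definition hitr (h : H) (p : R) : R := linfun (fun x => fn p (h * x)).

Lemma hitlE h p x : fn (hitl h p) x = fn p (x * h).
Proof.
have l : linear (fun x => fn p (x * h) : k^o) by lin.
pose fL := GRing.isLinear.Build k H k^o *:%R _ l.
pose f : {linear H -> k^o} := HB.pack (fun x => fn p (x * h) : k^o) fL.
exact: (lfunE f x).
Qed.

Lemma hitrE h p x : fn (hitr h p) x = fn p (h * x).
Proof.
have l : linear (fun x => fn p (h * x) : k^o) by lin.
pose fL := GRing.isLinear.Build k H k^o *:%R _ l.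
pose f : {linear H -> k^o} := HB.pack (fun x => fn p (h * x) : k^o) fL.
exact: (lfunE f x).
Qed.

Lemma dual_algP (p r : R) : (forall x, fn p x = fn r x) -> p = r.
Proof. by move=> e; apply/lfunP. Qed.

Lemma dual_algD (p r : R) x : fn (p + r) x = fn p x + fn r x.
Proof. exact: add_lfunE. Qed.

Lemma dual_algZ c (p : R) x : fn (c *: p) x = c * fn p x.
Proof. exact: scale_lfunE. Qed.

Lemma dual_alg0 x : fn (0 : R) x = 0.
Proof. exact: zero_lfunE. Qed.

Lemma hitlZ h c p : hitl h (c *: p) = c *: hitl h p.
Proof. by apply: dual_algP => x; rewrite hitlE !dual_algZ hitlE. Qed.

Lemma hitrZ h c p : hitr h (c *: p) = c *: hitr h p.
Proof. by apply: dual_algP => x; rewrite hitrE !dual_algZ hitrE. Qed.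

Lemma dual_alg_1 x : fn (1 : R) x = eps x. Proof. by []. Qed.

Lemma hitl1 h : hitl h 1 = (eps h : k) *: 1.
Proof.
by apply: dual_algP => x; rewrite hitlE dual_algZ (hopf_counitM hH) mulrC.
Qed.

Lemma hitr1 h : hitr h 1 = (eps h : k) *: 1.
Proof.
by apply: dual_algP => x; rewrite hitrE dual_algZ (hopf_counitM hH).
Qed.

Lemma dual_alg_eval1M (p r : R) : fn (p * r) 1 = fn p 1 * fn r 1.
Proof. by rewrite dual_algME (hopf_comul1 hH) tliftE; [|lin..]. Qed.

Lemma dual_alg_eval1X (p : R) m : fn (p ^+ m) 1 = fn p 1 ^+ m.
Proof.
elim: m => [|m IHm]; first by rewrite !expr0; apply: hopf_counit1 hH.
by rewrite !exprS dual_alg_eval1M IHm.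
Qed.

End Hit.

(** * The small quantum group *)

Section UqSl2.
Variables (k : fieldType) (n : nat) (n_gt0 : (0 < n)%N) (q : k).
Variables (U : falgType k) (Delta : 'Hom(U, tensor U U)) (eps : 'Hom(U, k^o)).
Variables (S : 'End(U)) (E F K : U) (hU : is_uq_sl2 n q Delta eps S E F K).

Let hH := uq_hopf hU.

Lemma uq_span_phi :
  exists phi : {linear free_alg k 3 -> U},
    [/\ phi 1 = 1 /\ {morph phi : P Q / P * Q},
        [/\ phi (fgen (inord 0)) = E, phi (fgen (inord 1)) = F
          & phi (fgen (inord 2)) = K],
        forall v, exists P, phi P = v
      & forall P, phi P = 0 <-> rel_ideal (uq_rels n q (fgen (inord 0 : 'I_3))
           (fgen (inord 1)) (fgen (inord 2))) P].
Proof.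
have [phi [phiM phig phis phik]] := uq_presented hU.
exists phi; split=> //.
by rewrite !phig !(tnth_nth 0) !inordK.
Qed.

Lemma ord3_ind (P : 'I_3 -> Prop) :
  P (inord 0) -> P (inord 1) -> P (inord 2) -> forall i, P i.
Proof.
move=> P0 P1 P2 [[|[|[|m]]] lt] //.
- by rewrite (_ : Ordinal lt = inord 0) //; apply/val_inj; rewrite /= inordK.
- by rewrite (_ : Ordinal lt = inord 1) //; apply/val_inj; rewrite /= inordK.
- by rewrite (_ : Ordinal lt = inord 2) //; apply/val_inj; rewrite /= inordK.
Qed.

(** The presentation is onto, so words in $E,F,K$ span [U]; this variant grows them on the left,
    [uq_indr] on the right. *)
Lemma uq_indl (P : U -> Prop) :
  (forall x y, P x -> P y -> P (x + y)) -> (forall c x, P x -> P (c *: x)) ->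
  P 1 -> (forall x, P x -> P (E * x)) -> (forall x, P x -> P (F * x)) ->
  (forall x, P x -> P (K * x)) -> forall x, P x.
Proof.
move=> PD PZ P1 PE PF PK x.
have [phi [[phi1 phiM] [phiE phiF phiK] phis _]] := uq_span_phi.
have [Q <-] := phis x; elim/free_alg_indl: Q => [y z|c y||i y].
- by rewrite linearD; apply: PD.
- by rewrite linearZ; apply: PZ.
- by rewrite phi1.
- by move: i; apply: ord3_ind; rewrite phiM ?phiE ?phiF ?phiK; auto.
Qed.

Lemma uq_indr (P : U -> Prop) :
  (forall x y, P x -> P y -> P (x + y)) -> (forall c x, P x -> P (c *: x)) ->
  P 1 -> (forall x, P x -> P (x * E)) -> (forall x, P x -> P (x * F)) ->
  (forall x, P x -> P (x * K)) -> forall x, P x.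
Proof.
move=> PD PZ P1 PE PF PK x.
have [phi [[phi1 phiM] [phiE phiF phiK] phis _]] := uq_span_phi.
have [Q <-] := phis x; elim/free_alg_indr: Q => [y z|c y||i y].
- by rewrite linearD; apply: PD.
- by rewrite linearZ; apply: PZ.
- by rewrite phi1.
- by move: i; apply: ord3_ind; rewrite phiM ?phiE ?phiF ?phiK; auto.
Qed.

Lemma uq_relations :
  [/\ K ^+ n = 1, E ^+ n = 0, F ^+ n = 0, K * E = q ^+ 2 *: (E * K)
    & K * F = q ^- 2 *: (F * K)
      /\ E * F - F * E = (q - q^-1)^-1 *: (K - K ^+ n.-1)].
Proof.
have [phi [phiM [phiE phiF phiK] _ phik]] := uq_span_phi.
by have := uq_rels_morph phiM (presented_rel phik); rewrite phiE phiF phiK.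
Qed.

Let KX : K ^+ n = 1. Proof. by case: uq_relations. Qed.

Lemma uq_K_unit : K \is a GRing.unit.
Proof. by rewrite -(unitrX_pos _ n_gt0) KX unitr1. Qed.
Let Ku := uq_K_unit.

Lemma uq_KVX : K^-1 = K ^+ n.-1.
Proof.
by apply: (mulrI Ku); rewrite divrr // -exprS prednK.
Qed.

Lemma uq_comulX m : Delta (K ^+ m) = (K ^+ m) ⊗ (K ^+ m).
Proof.
elim: m => [|m IHm]; first by rewrite !expr0 (hopf_comul1 hH).
rewrite !exprS (hopf_comulM hH) IHm (uq_comulK hU) /tmul tliftE; [|lin..].
by rewrite tliftE; [|lin..].
Qed.

Lemma uq_comulKV : Delta K^-1 = K^-1 ⊗ K^-1.
Proof. by rewrite uq_KVX uq_comulX. Qed.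

Lemma uq_counitKV : eps K^-1 = 1.
Proof.
have := hopf_counitM hH K K^-1; rewrite divrr // (hopf_counit1 hH).
by rewrite (uq_counitK hU) mul1r => <-.
Qed.

Section Comul.
Variables (L : lmodType k) (B : U -> U -> L).
Hypotheses (B1 : forall y, linear (fun x => B x y)).
Hypotheses (B2 : forall x, linear (fun y => B x y)).

Lemma comulK : \tens_(x, y <- Delta K) B x y = B K K.
Proof. by rewrite (uq_comulK hU) tliftE. Qed.

Lemma comulKV : \tens_(x, y <- Delta K^-1) B x y = B K^-1 K^-1.
Proof. by rewrite uq_comulKV tliftE. Qed.

Let tliftD X Y : tlift B (X + Y) = tlift B X + tlift B Y.
Proof. by have := tlift_is_linear B 1 X Y; rewrite !scale1r. Qed.

Lemma comulE : \tens_(x, y <- Delta E) B x y = B 1 E + B E K.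
Proof. by rewrite (uq_comulE hU) tliftD !tliftE. Qed.

Lemma comulF : \tens_(x, y <- Delta F) B x y = B K^-1 F + B F 1.
Proof. by rewrite (uq_comulF hU) tliftD !tliftE. Qed.

End Comul.

Section ComulMul.
Variables (L : lmodType k) (B : U -> U -> L).
Hypotheses (B1 : forall y, linear (fun x => B x y)).
Hypotheses (B2 : forall x, linear (fun y => B x y)).
Variable z : U.

Lemma comul_Kl : \tens_(x, y <- Delta (K * z)) B x y
  = \tens_(x, y <- Delta z) B (K * x) (K * y).
Proof. by rewrite (comul_mul hH _ _ B1 B2) comulK //; lin. Qed.

Lemma comul_KVl : \tens_(x, y <- Delta (K^-1 * z)) B x y
  = \tens_(x, y <- Delta z) B (K^-1 * x) (K^-1 * y).
Proof. by rewrite (comul_mul hH _ _ B1 B2) comulKV //; lin. Qed.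

Lemma comul_El : \tens_(x, y <- Delta (E * z)) B x y
  = \tens_(x, y <- Delta z) (B x (E * y) + B (E * x) (K * y)).
Proof.
rewrite (comul_mul hH _ _ B1 B2) comulE; [|lin..].
by rewrite tlift_add; congr (_ + _); apply: eq_tlift => x y; rewrite mul1r.
Qed.

Lemma comul_Fl : \tens_(x, y <- Delta (F * z)) B x y
  = \tens_(x, y <- Delta z) (B (K^-1 * x) (F * y) + B (F * x) y).
Proof.
rewrite (comul_mul hH _ _ B1 B2) comulF; [|lin..].
by rewrite tlift_add; congr (_ + _); apply: eq_tlift => x y; rewrite mul1r.
Qed.

Lemma comul_Kr : \tens_(x, y <- Delta (z * K)) B x y
  = \tens_(x, y <- Delta z) B (x * K) (y * K).
Proof.
rewrite (comul_mul hH _ _ B1 B2); apply: eq_tlift => x y.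
by rewrite (comulK (B := fun x' y' => B (x * x') (y * y'))) //; lin.
Qed.

Lemma comul_KVr : \tens_(x, y <- Delta (z * K^-1)) B x y
  = \tens_(x, y <- Delta z) B (x * K^-1) (y * K^-1).
Proof.
rewrite (comul_mul hH _ _ B1 B2); apply: eq_tlift => x y.
by rewrite (comulKV (B := fun x' y' => B (x * x') (y * y'))) //; lin.
Qed.

Lemma comul_Er : \tens_(x, y <- Delta (z * E)) B x y
  = \tens_(x, y <- Delta z) (B x (y * E) + B (x * E) (y * K)).
Proof.
rewrite (comul_mul hH _ _ B1 B2); apply: eq_tlift => x y.
rewrite (comulE (B := fun x' y' => B (x * x') (y * y'))); [|lin..].
by rewrite mulr1.
Qed.

Lemma comul_Fr : \tens_(x, y <- Delta (z * F)) B x y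
  = \tens_(x, y <- Delta z) (B (x * K^-1) (y * F) + B (x * F) y).
Proof.
rewrite (comul_mul hH _ _ B1 B2); apply: eq_tlift => x y.
rewrite (comulF (B := fun x' y' => B (x * x') (y * y'))); [|lin..].
by rewrite mulr1.
Qed.

End ComulMul.

Let SM := antipodeM hH.

Lemma uq_antipodeK : S K = K^-1.
Proof.
have := proj1 (hopf_antipode hH K); rewrite comulK; [|lin..].
rewrite (uq_counitK hU) scale1r => e.
by apply: (mulIr Ku); rewrite e mulVr.
Qed.

Lemma uq_antipodeKV : S K^-1 = K.
Proof.
have KVu : K^-1 \is a GRing.unit by rewrite unitrV.
apply: (mulrI KVu); rewrite mulVr // -{1}uq_antipodeK -SM mulVr //.
exact: (antipode1 hH).
Qed.

Lemma uq_antipodeE : S E = - (E * K^-1).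
Proof.
have := proj1 (hopf_antipode hH E); rewrite comulE; [|lin..].
rewrite (uq_counitE hU) scale0r (antipode1 hH) mul1r => /eqP.
rewrite addrC addr_eq0 => /eqP e.
by apply: (mulIr Ku); rewrite e mulNr divrK.
Qed.

Lemma uq_antipodeF : S F = - (K * F).
Proof.
have := proj1 (hopf_antipode hH F); rewrite comulF; [|lin..].
by rewrite (uq_counitF hU) scale0r uq_antipodeKV mulr1 addrC => /eqP;
   rewrite addr_eq0 => /eqP.
Qed.

(** $S^2$ is multiplicative, so it is compared with conjugation by $K$ on generators. Conjugation
    being injective, so is $S$, which makes [S^-1] a genuine inverse. *)
Lemma uq_antipode2 x : S (S x) = K * x * K^-1.
Proof.
elim/uq_indl: x => [x y ex ey|c x ex||x ex|x ex|x ex].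
- by rewrite !linearD /= ex ey mulrDr mulrDl.
- by rewrite !linearZ /= ex -scalerAr -scalerAl.
- by rewrite !(antipode1 hH) mulr1 divrr.
- rewrite !SM ex uq_antipodeE linearN /= SM uq_antipodeKV uq_antipodeE.
  by rewrite mulrN opprK -!mulrA mulKr.
- rewrite !SM ex uq_antipodeF linearN /= SM uq_antipodeK uq_antipodeF.
  by rewrite !mulNr opprK -!mulrA mulKr.
- by rewrite !SM ex uq_antipodeK uq_antipodeKV -!mulrA.
Qed.

Lemma uq_antipode_inj : lker S == 0%VS.
Proof.
apply/lker0P => x y /(congr1 S); rewrite !uq_antipode2 => e.
by apply: (mulrI Ku); apply: (mulIr _ e); rewrite unitrV.
Qed.

Let S_inj := uq_antipode_inj.
Local Notation Si := (S^-1)%VF.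

Lemma uq_antipode_invK : Si K = K^-1.
Proof. by rewrite -{1}uq_antipodeKV (antipodeK S_inj). Qed.

Lemma uq_antipode_invE : Si E = - (K^-1 * E).
Proof.
rewrite -[RHS](antipodeK S_inj) linearN /= SM uq_antipodeKV uq_antipodeE.
by rewrite mulNr divrK ?opprK.
Qed.

Lemma uq_antipode_invF : Si F = - (F * K).
Proof.
rewrite -[RHS](antipodeK S_inj) linearN /= SM uq_antipodeK uq_antipodeF.
by rewrite mulrN mulKr ?opprK.
Qed.

Local Notation act := (act Delta S).
Local Notation conv := (conv Delta S).

(** * Left multiplication by $K$, $E$, $F$ in the double *)

Section Act.
Variables (g : U -> U) (y : U).
Hypothesis gl : linear g.

Lemma actK : act K g y = K * g (K^-1 * y * K).
Proof.
rewrite /act comulK; [|lin..]; rewrite comulK; [|lin..].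
by rewrite uq_antipode_invK.
Qed.

Lemma actKV : act K^-1 g y = K^-1 * g (K * (y * K^-1)).
Proof.
rewrite /act comulKV; [|lin..]; rewrite comulKV; [|lin..].
by rewrite -uq_antipodeK antipodeK // mulrA.
Qed.

Lemma actE : act E g y
  = - g (K^-1 * (E * y)) + E * g (K^-1 * y) + K * g (K^-1 * y * E).
Proof.
rewrite /act comulE; [|lin..].
rewrite (comulE (B := fun h2 h3 => h2 * g (Si h3 * y * 1))); [|lin..].
rewrite (comulK (B := fun h2 h3 => h2 * g (Si h3 * y * E))); [|lin..].
rewrite uq_antipode_invK uq_antipode_invE !mulr1 mul1r mulNr -mulrA.
by rewrite (linear_funN _ gl) !mulrA.
Qed.

Lemma actF : act F g y
  = - (K^-1 * g (F * (K * (y * K^-1)))) + F * g (y * K^-1) + g (y * F).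
Proof.
rewrite /act comulF; [|lin..].
rewrite (comulF (B := fun h2 h3 => h2 * g (Si h3 * y * K^-1))); [|lin..].
rewrite (hopf_comul1 hH) (tliftE (B := fun h2 h3 => h2 * g (Si h3 * y * F)));
  [|lin..].
rewrite (antipode_inv1 hH S_inj) uq_antipode_invF !mul1r !mulNr -!mulrA.
by rewrite (linear_funN _ gl) mulrN.
Qed.

End Act.

Lemma act_conv_K f g y : linear f -> linear g ->
  act K (conv f g) y = conv (act K f) g y.
Proof.
move=> fl gl; have cl := conv_linear Delta S fl gl.
have al z : linear (fun h => act h g z) by exact: act_linearh.
have ay h : linear (act h g) by exact: act_lineary.
rewrite actK // /conv comul_Kr; [|lin..]; rewrite comul_KVl; [|lin..].
rewrite tlift_comp; last by lin.
by apply: eq_tlift => y1 y2; rewrite actK // (actM hH S_inj) // actK //.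
Qed.

(** Both sides are sums of the same five terms. On the left they come from the coproducts of
    $K^{-1}Ey$, $K^{-1}y$ and $K^{-1}yE$; on the right the summand $E\,f(K^{-1}y_1)$ of [actE]
    unfolds into three by [actE] again, and the other two give one each. The case of $F$ is
    alike. *)
Lemma act_conv_E f g y : linear f -> linear g ->
  act E (conv f g) y = conv (act E f) g y.
Proof.
move=> fl gl; have cl := conv_linear Delta S fl gl.
have al z : linear (fun h => act h g z) by exact: act_linearh.
have ay h : linear (act h g) by exact: act_lineary.
have alN z h : act (- h) g z = - act h g z.
  exact: (linear_funN _ (al z)).
have alD z h h' : act (h + h') g z = act h g z + act h' g z.
  exact: (linear_funD _ _ (al z)).
rewrite actE //; transitivity (\tens_(y1, y2 <- Delta y)
  (- (act (f (K^-1 * y1)) g (K^-1 * (E * y2))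
      + act (f (K^-1 * (E * y1))) g (K^-1 * (K * y2)))
   + E * act (f (K^-1 * y1)) g (K^-1 * y2)
   + K * (act (f (K^-1 * y1)) g (K^-1 * y2 * E)
      + act (f (K^-1 * y1 * E)) g (K^-1 * y2 * K)))).
  rewrite !tlift_add; congr (_ + _ + _).
  - rewrite /conv comul_KVl; [|lin..]; rewrite comul_El; [|lin..].
    by rewrite (tlift_comp (f := fun x => - x)); last by lin.
  - rewrite /conv comul_KVl; [|lin..].
    by rewrite (tlift_comp (f := fun x => E * x)); last by lin.
  - rewrite /conv comul_Er; [|lin..]; rewrite comul_KVl; [|lin..].
    by rewrite (tlift_comp (f := fun x => K * x)); last by lin.
apply: eq_tlift => y1 y2; rewrite [act E f y1]actE // !alD alN.
rewrite !(actM hH S_inj) // actE // actK // mulKr // mulrDr opprD.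
by rewrite [- _ - _]addrC !addrA.
Qed.

Lemma act_conv_F f g y : linear f -> linear g ->
  act F (conv f g) y = conv (act F f) g y.
Proof.
move=> fl gl; have cl := conv_linear Delta S fl gl.
have al z : linear (fun h => act h g z) by exact: act_linearh.
have ay h : linear (act h g) by exact: act_lineary.
have alN z h : act (- h) g z = - act h g z.
  exact: (linear_funN _ (al z)).
have alD z h h' : act (h + h') g z = act h g z + act h' g z.
  exact: (linear_funD _ _ (al z)).
rewrite actF //; transitivity (\tens_(y1, y2 <- Delta y)
  (- (K^-1 * (act (f (K^-1 * (K * (y1 * K^-1)))) g (F * (K * (y2 * K^-1)))
              + act (f (F * (K * (y1 * K^-1)))) g (K * (y2 * K^-1))))
   + F * act (f (y1 * K^-1)) g (y2 * K^-1)
   + (act (f (y1 * K^-1)) g (y2 * F) + act (f (y1 * F)) g y2))).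
  rewrite !tlift_add; congr (_ + _ + _).
  - rewrite /conv comul_Fl; [|lin..]; rewrite comul_Kl; [|lin..].
    rewrite comul_KVr; [|lin..].
    by rewrite (tlift_comp (f := fun x => - (K^-1 * x))); last by lin.
  - rewrite /conv comul_KVr; [|lin..].
    by rewrite (tlift_comp (f := fun x => F * x)); last by lin.
  - by rewrite -tlift_add /conv comul_Fr //; lin.
apply: eq_tlift => y1 y2; rewrite [act F f y1]actF // !alD alN.
rewrite !(actM hH S_inj) // actF // actKV // mulKr // mulrDr opprD.
by rewrite [- _ - _]addrC !addrA.
Qed.

(* [actM] makes the set of h with this property multiplicative, so only the three
   generators have to be checked. *)
Lemma uq_act_conv : act_conv_stable Delta S.
Proof.
move=> f g + gl h; elim/uq_indl: h f
  => [h h' eh eh'|c h eh||h eh|h eh|h eh] f fl y;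
  have cl := conv_linear Delta S fl gl;
  have al z h0 f0 : linear f0 -> linear (fun h => act h f0 z)
    by move=> l0; exact: act_linearh.
- transitivity (\tens_(y1, y2 <- Delta y)
    (act (act h f y1) g y2 + act (act h' f y1) g y2)).
    rewrite tlift_add -!/(conv _ _ _) -eh // -eh' //.
    exact: (linear_funD _ _ (act_linearh _ _ _ cl)).
  apply: eq_tlift => y1 y2.
  by rewrite (linear_funD _ _ (act_linearh _ _ y1 fl))
             (linear_funD _ _ (act_linearh _ _ y2 gl)).
- rewrite (linear_funZ _ _ (act_linearh _ _ _ cl)) eh //.
  rewrite /conv (tlift_comp (f := fun z => c *: z)); last by lin.
  apply: eq_tlift => y1 y2.
  by rewrite (linear_funZ _ _ (act_linearh _ _ y1 fl))
             (linear_funZ _ _ (act_linearh _ _ y2 gl)).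
- rewrite (act1 hH) //; apply: eq_tlift => y1 y2; by rewrite (act1 hH).
- have fl' : linear (act h f) by exact: act_lineary.
  rewrite (actM hH S_inj) // (eq_act _ _ _ _ (eh f fl)) act_conv_E //.
  by apply: eq_tlift => y1 y2; rewrite -(actM hH S_inj).
- have fl' : linear (act h f) by exact: act_lineary.
  rewrite (actM hH S_inj) // (eq_act _ _ _ _ (eh f fl)) act_conv_F //.
  by apply: eq_tlift => y1 y2; rewrite -(actM hH S_inj).
- have fl' : linear (act h f) by exact: act_lineary.
  rewrite (actM hH S_inj) // (eq_act _ _ _ _ (eh f fl)) act_conv_K //.
  by apply: eq_tlift => y1 y2; rewrite -(actM hH S_inj).
Qed.

Local Notation R := (dual_alg hH).
Local Notation fn p := (p : dual_space U).
Implicit Types p r : R.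

Lemma hitlK p r : hitl K (p * r) = hitl K p * hitl K r.
Proof.
apply: dual_algP => x; rewrite hitlE !dual_algME comul_Kr; [|lin..].
by apply: eq_tlift => y z; rewrite !hitlE.
Qed.

(** Dual to the coproduct: the group-like $K$ acts by automorphisms, while $E$ and $F$ act by
    derivations twisted by $K$ and $K^{-1}$. *)
Lemma hitlEM p r : hitl E (p * r) = p * hitl E r + hitl E p * hitl K r.
Proof.
apply: dual_algP => x; rewrite hitlE dual_algD !dual_algME comul_Er; [|lin..].
by rewrite -tlift_add; apply: eq_tlift => y z; rewrite !hitlE.
Qed.

Lemma hitlFM p r : hitl F (p * r) = hitl K^-1 p * hitl F r + hitl F p * r.
Proof.
apply: dual_algP => x; rewrite hitlE dual_algD !dual_algME comul_Fr; [|lin..].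
by rewrite -tlift_add; apply: eq_tlift => y z; rewrite !hitlE.
Qed.

Lemma hitrKV p r : hitr K^-1 (p * r) = hitr K^-1 p * hitr K^-1 r.
Proof.
apply: dual_algP => x; rewrite hitrE !dual_algME comul_KVl; [|lin..].
by apply: eq_tlift => y z; rewrite !hitrE.
Qed.

Lemma hitrFM p r : hitr F (p * r) = hitr K^-1 p * hitr F r + hitr F p * r.
Proof.
apply: dual_algP => x; rewrite hitrE dual_algD !dual_algME comul_Fl; [|lin..].
by rewrite -tlift_add; apply: eq_tlift => y z; rewrite !hitrE.
Qed.

Lemma hitlKX c p m : hitl K p = c *: p -> hitl K (p ^+ m) = c ^+ m *: p ^+ m.
Proof.
move=> e; elim: m => [|m IHm].
  by rewrite !expr0 hitl1 (uq_counitK hU).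
by rewrite !exprS hitlK e IHm -scalerAl -scalerAr scalerA.
Qed.

Lemma hitrKVX c p m :
  hitr K^-1 p = c *: p -> hitr K^-1 (p ^+ m) = c ^+ m *: p ^+ m.
Proof.
move=> e; elim: m => [|m IHm].
  by rewrite !expr0 hitr1 uq_counitKV.
by rewrite !exprS hitrKV e IHm -scalerAl -scalerAr scalerA.
Qed.

Lemma hitlEX0 p m : hitl E p = 0 -> hitl E (p ^+ m) = 0.
Proof.
move=> e; elim: m => [|m IHm]; first by rewrite hitl1 (uq_counitE hU) scale0r.
by rewrite exprS hitlEM e IHm mulr0 mul0r addr0.
Qed.

Lemma hitlFX0 p m : hitl F p = 0 -> hitl F (p ^+ m) = 0.
Proof.
move=> e; elim: m => [|m IHm]; first by rewrite hitl1 (uq_counitF hU) scale0r.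
by rewrite exprS hitlFM e IHm mulr0 mul0r addr0.
Qed.

Lemma hitrFX0 p m : hitr F p = 0 -> hitr F (p ^+ m) = 0.
Proof.
move=> e; elim: m => [|m IHm]; first by rewrite hitr1 (uq_counitF hU) scale0r.
by rewrite exprS hitrFM e IHm mulr0 mul0r addr0.
Qed.

(** An invariant functional is determined by its value at 1, by induction on words. This reduces
    each power relation to three translates and one value. *)
Lemma hit_invariant p :
  hitl E p = 0 -> hitl F p = 0 -> hitl K p = p -> p = (fn p 1 : k) *: 1.
Proof.
move=> pE pF pK; apply: dual_algP => x; rewrite dual_algZ (dual_alg_1 hH).
elim/uq_indr: x => [x y ex ey|c x ex||x ex|x ex|x ex].
- by rewrite !linearD mulrDr /= ex ey.
- by rewrite !linearZ /= ex [RHS]mulrCA.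
- by rewrite (hopf_counit1 hH) mulr1.
- rewrite -hitlE pE (hopf_counitM hH) (uq_counitE hU) !mulr0.
  exact: dual_alg0.
- rewrite -hitlE pF (hopf_counitM hH) (uq_counitF hU) !mulr0.
  exact: dual_alg0.
- by rewrite -hitlE pK (hopf_counitM hH) (uq_counitK hU) mulr1.
Qed.

End UqSl2.

(** * Quantum integers at a root of unity of odd order *)

Section QuantumInteger.
Variables (k : fieldType) (n : nat) (q : k).
Hypotheses (n_ge3 : (3 <= n)%N) (n_odd : odd n) (q_prim : n.-primitive_root q).

Definition qint (m : nat) : k := (q ^+ m - q ^- m) / (q - q^-1).

Lemma prim_neq0 : q != 0.
Proof.
apply/eqP => q0; have := prim_expr_order q_prim.
by rewrite q0 expr0n gtn_eqF ?(leq_trans _ n_ge3) // => /esym/eqP; rewrite oner_eq0.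
Qed.
Let q0 := prim_neq0.

(** Oddness of $n$ enters here: $n\mid 2m$ forces $n\mid m$. *)
Lemma prim_sqr_neq1 m : (0 < m < n)%N -> q ^+ (2 * m) != 1.
Proof.
move=> /andP[m0 mn]; rewrite -(prim_order_dvd q_prim) Gauss_dvdr.
  by rewrite gtnNdvd.
by rewrite coprimen2.
Qed.

Lemma sqr_qint_den m : q ^+ m - q ^- m = (q ^+ (2 * m) - 1) / q ^+ m.
Proof.
by have qm : q ^+ m != 0 by [rewrite expf_neq0];
   rewrite mulnC exprM; field.
Qed.

Lemma qden_neq0 : q - q^-1 != 0.
Proof.
have := sqr_qint_den 1; rewrite !expr1 => ->.
by rewrite mulf_neq0 ?invr_eq0 // subr_eq0 prim_sqr_neq1 //; apply: leq_trans n_ge3.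
Qed.

Lemma qint_neq0 m : (0 < m < n)%N -> qint m != 0.
Proof.
move=> mn; rewrite mulf_neq0 ?invr_eq0 ?qden_neq0 // sqr_qint_den.
by rewrite mulf_neq0 ?invr_eq0 ?expf_neq0 // subr_eq0 prim_sqr_neq1.
Qed.

Lemma qint0 : qint 0 = 0.
Proof. by rewrite /qint !expr0 invr1 subrr mul0r. Qed.

Lemma qint_order : qint n = 0.
Proof. by rewrite /qint (prim_expr_order q_prim) invr1 subrr mul0r. Qed.

(** The two recursions correspond to the two twists: this one to powers under $E$ ([hitE_pow]),
    [qintSr] to powers under $F$ ([hitF_pow]). *)
Lemma qintSl m : qint m.+1 = q * qint m + q ^- m.
Proof.
have qm : q ^+ m != 0 by rewrite expf_neq0.
rewrite /qint !exprS; apply: (mulIf qden_neq0).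
by rewrite divfK ?qden_neq0 // mulrDl -[q * _ * _]mulrA divfK ?qden_neq0 //;
   field; rewrite q0 qm.
Qed.

Lemma qintSr m : qint m.+1 = q^-1 * qint m + q ^+ m.
Proof.
have qm : q ^+ m != 0 by rewrite expf_neq0.
rewrite /qint !exprS; apply: (mulIf qden_neq0).
by rewrite divfK ?qden_neq0 // mulrDl -[q^-1 * _ * _]mulrA divfK ?qden_neq0 //;
   field; rewrite q0 qm.
Qed.

End QuantumInteger.

Section Mx2.
Variable k : fieldType.
Implicit Types w x y z : k.

Lemma mx2_inj w x y z w' x' y' z' : mx2 w x y z = mx2 w' x' y' z' ->
  [/\ w = w', x = x', y = y' & z = z'].
Proof.
move=> /matrixP e; split.
- by have := e 0 0; rewrite !mxE.
- by have := e 0 1; rewrite !mxE.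
- by have := e 1 0; rewrite !mxE.
- by have := e 1 1; rewrite !mxE.
Qed.

Lemma mulmx2 w x y z w' x' y' z' : mx2 w x y z * mx2 w' x' y' z'
  = mx2 (w * w' + x * y') (w * x' + x * z') (y * w' + z * y') (y * x' + z * z').
Proof.
apply/matrixP => i j; rewrite !mxE !big_ord_recl big_ord0 addr0 !mxE /=.
by case: i => [[|[|]]] //= ?; case: j => [[|[|]]] //= ?.
Qed.

Lemma mx2_1 : 1 = @mx2 k 1 0 0 1.
Proof.
apply/matrixP => i j; rewrite !mxE.
by case: i => [[|[|]]] //= ?; case: j => [[|[|]]] //= ?.
Qed.

End Mx2.

(** * Spanning sets modulo a presentation *)

Section Congruence.
Variables (k : fieldType) (A : lalgType k) (rels : seq (A * A)).
Hypothesis scaleAr : forall (c : k) (x y : A), c *: (x * y) = x * (c *: y).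
Implicit Types (x y z : A) (G : A -> Prop).

(** The reduction is done modulo the ideal without forming a quotient. For an empty list of
    relations the congruence is equality ([rel_ideal_nil]), so the same lemmas serve in the free
    algebra and in [U] itself. *)
Definition rel_eq x y := rel_ideal rels (x - y).
Local Notation "x ≡ y" := (rel_eq x y) (at level 70).

Lemma rel_ideal_scale (c : k) x : rel_ideal rels x -> rel_ideal rels (c *: x).
Proof. by move=> rx; rewrite -[x]mul1r scalerAl; apply: RelIdealMl. Qed.

Lemma rel_ideal_opp x : rel_ideal rels x -> rel_ideal rels (- x).
Proof. by move=> rx; rewrite -scaleN1r; apply: rel_ideal_scale. Qed.

Lemma rel_eq_refl x : x ≡ x.
Proof. by rewrite /rel_eq subrr; constructor. Qed.

Lemma rel_eq_sym x y : x ≡ y -> y ≡ x.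
Proof. by rewrite /rel_eq -(opprB x y); apply: rel_ideal_opp. Qed.

Lemma rel_eq_trans x y z : x ≡ y -> y ≡ z -> x ≡ z.
Proof.
move=> xy yz; have := RelIdealD xy yz.
by rewrite addrA subrK.
Qed.

Lemma rel_eqMl x y z : x ≡ y -> z * x ≡ z * y.
Proof. by rewrite /rel_eq -mulrBr; apply: RelIdealMl. Qed.

Lemma rel_eqMr x y z : x ≡ y -> x * z ≡ y * z.
Proof. by rewrite /rel_eq -mulrBl; apply: RelIdealMr. Qed.

Lemma rel_eqD x y x' y' : x ≡ y -> x' ≡ y' -> x + x' ≡ y + y'.
Proof. by rewrite /rel_eq opprD addrACA; apply: RelIdealD. Qed.

(** Closure under congruence is built in, so that this is a linear span in the quotient and each
    rewriting step of a word is one constructor. *)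
Inductive spanned G : A -> Prop :=
| SpannedGen x : G x -> spanned G x
| SpannedCong x y : x ≡ y -> spanned G y -> spanned G x
| Spanned0 : spanned G 0
| SpannedD x y : spanned G x -> spanned G y -> spanned G (x + y)
| SpannedZ c x : spanned G x -> spanned G (c *: x).

Lemma spannedB G x y : spanned G x -> spanned G y -> spanned G (x - y).
Proof. by move=> sx sy; rewrite -[- y]scaleN1r; apply: SpannedD => //; apply: SpannedZ. Qed.

Lemma spanned_trans G G' x :
  (forall y, G y -> spanned G' y) -> spanned G x -> spanned G' x.
Proof.
move=> GG'; elim=> [y Gy|y z yz _ sz||y z _ sy _ sz|c y _ sy].
- exact: GG'.
- exact: SpannedCong yz sz.
- exact: Spanned0.
- exact: SpannedD.
- exact: SpannedZ.
Qed.

Lemma spanned_mull G g x :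
  (forall y, G y -> spanned G (g * y)) -> spanned G x -> spanned G (g * x).
Proof.
move=> Gg; elim=> [y Gy|y z yz _ sz||y z _ sy _ sz|c y _ sy].
- exact: Gg.
- exact: SpannedCong (rel_eqMl g yz) sz.
- by rewrite mulr0; apply: Spanned0.
- by rewrite mulrDr; apply: SpannedD.
- by rewrite -scaleAr; apply: SpannedZ.
Qed.

Lemma spanned_coef (T : finType) (m : T -> A) x :
  spanned (fun y => exists i, y = m i) x ->
  exists z : T -> k, x ≡ \sum_i z i *: m i.
Proof.
elim=> [y [i ->]|y y' yy' _ [z zE]||y y' _ [z zE] _ [z' zE']|e y _ [z zE]].
- exists (fun j => (j == i)%:R); rewrite (bigD1 i) //= eqxx scale1r.
  rewrite big1 ?addr0; first exact: rel_eq_refl.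
  by move=> j /negPf ->; rewrite scale0r.
- by exists z; apply: rel_eq_trans yy' zE.
- exists (fun=> 0); rewrite big1; first exact: rel_eq_refl.
  by move=> i _; rewrite scale0r.
- exists (fun i => z i + z' i).
  under eq_bigr => i _ do rewrite scalerDl.
  by rewrite big_split; apply: rel_eqD.
- exists (fun i => e * z i); under eq_bigr => i _ do rewrite -scalerA.
  by rewrite -scaler_sumr /rel_eq -scalerBr; apply: rel_ideal_scale.
Qed.

Lemma rel_eq_scaleMl (g h : A) c x : g * h ≡ c *: (h * g) ->
  g * (h * x) ≡ c *: (h * (g * x)).
Proof.
by move=> gh; rewrite !mulrA scalerAl; apply: rel_eqMr.
Qed.

Lemma rel_eq_scaleMX (g h : A) c m x : g * h ≡ c *: (h * g) ->
  g * (h ^+ m * x) ≡ c ^+ m *: (h ^+ m * (g * x)).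
Proof.
move=> gh; elim: m => [|m IHm]; first by rewrite !expr0 scale1r !mul1r; apply: rel_eq_refl.
rewrite exprS -!mulrA; apply: rel_eq_trans (rel_eq_scaleMl _ gh) _.
rewrite exprS -scalerA /rel_eq -scalerBr; apply: rel_ideal_scale.
by rewrite scaleAr; apply: rel_eqMl.
Qed.

Section UqPart.
Variables (n : nat) (q : k) (E F K : A).
Hypothesis n_gt0 : (0 < n)%N.
Hypotheses (q0 : q != 0).
Hypotheses (hKn : K ^+ n ≡ 1) (hEn : E ^+ n ≡ 0) (hFn : F ^+ n ≡ 0).
Hypotheses (hKE : K * E ≡ q ^+ 2 *: (E * K)).
Hypotheses (hKF : K * F ≡ q ^- 2 *: (F * K)).
Hypotheses (hEF : E * F - F * E ≡ (q - q^-1)^-1 *: (K - K ^+ n.-1)).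

(** The order is the one the pairing wants: there $F$ is peeled off on the left and $E$ on the
    right. *)
Definition uq_mono (s t r : nat) : A := F ^+ s * K ^+ t * E ^+ r.

Local Notation G0 := (fun y => exists s t r, y = uq_mono s t r).

Lemma uq_spanned_F x : spanned G0 x -> spanned G0 (F * x).
Proof.
apply: spanned_mull => _ [s [t [r ->]]]; apply: SpannedGen.
by exists s.+1, t, r; rewrite /uq_mono exprS !mulrA.
Qed.

Lemma uq_spanned_K x : spanned G0 x -> spanned G0 (K * x).
Proof.
apply: spanned_mull => _ [s [t [r ->]]]; rewrite /uq_mono -mulrA.
apply: SpannedCong (rel_eq_scaleMX _ _ hKF) _; apply/SpannedZ/SpannedGen.
by exists s, t.+1, r; rewrite /uq_mono exprS !mulrA.
Qed.

Lemma uq_spanned_KX m x : spanned G0 x -> spanned G0 (K ^+ m * x).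
Proof.
move=> sx; elim: m => [|m IHm]; first by rewrite mul1r.
by rewrite exprS -mulrA; apply: uq_spanned_K.
Qed.

(** Induction on the exponent of $F$: $EF=FE+(K-K^{n-1})/(q-q^{-1})$ lets $E$ reach a shorter power
    of $F$, at the cost of terms in $K$. Without $F$, only powers of $K$ are crossed. *)
Lemma uq_spanned_E x : spanned G0 x -> spanned G0 (E * x).
Proof.
apply: spanned_mull => _ [s [t [r ->]]]; elim: s => [|s IHs].
  rewrite /uq_mono mul1r.
  have hEK : E * K ≡ q ^- 2 *: (K * E).
    have := rel_ideal_scale (q ^- 2) (rel_eq_sym hKE).
    by rewrite scalerBr scalerA mulVf ?expf_neq0 // scale1r.
  apply: SpannedCong (rel_eq_scaleMX _ _ hEK) _; apply/SpannedZ/SpannedGen.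
  by exists 0%N, t, r.+1; rewrite /uq_mono mul1r exprS.
have sm := SpannedGen (ex_intro _ s (ex_intro _ t (ex_intro _ r erefl)))
  : spanned G0 (uq_mono s t r).
rewrite (_ : uq_mono s.+1 t r = F * uq_mono s t r); last first.
  by rewrite /uq_mono exprS !mulrA.
rewrite mulrA; have e := rel_eqD hEF (rel_eq_refl (F * E)).
rewrite subrK in e; apply: SpannedCong (rel_eqMr _ e) _.
rewrite mulrDl -scalerAl mulrBl -mulrA; apply: SpannedD; last first.
  exact: uq_spanned_F.
apply/SpannedZ/spannedB; [exact: uq_spanned_K|exact: uq_spanned_KX].
Qed.

Lemma rel_eq0_mul x y z : y ≡ 0 -> x * y * z ≡ 0.
Proof. by move=> /(rel_eqMl x)/(rel_eqMr z); rewrite mulr0 mul0r. Qed.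

Lemma rel_eq0X x m : x ^+ n ≡ 0 -> (n <= m)%N -> x ^+ m ≡ 0.
Proof.
by move=> xn /subnK <-; rewrite exprD -[_ * _]mulr1; apply: rel_eq0_mul.
Qed.

Lemma rel_eq1X x m : x ^+ n ≡ 1 -> exists2 m', (m' < n)%N & x ^+ m ≡ x ^+ m'.
Proof.
move=> xn; exists (m %% n)%N; first by rewrite ltn_mod.
rewrite {1}(divn_eq m n) exprD mulnC exprM -[X in _ ≡ X]mul1r.
apply: rel_eqMr; elim: (m %/ n)%N => [|j IHj]; first by rewrite expr0; apply: rel_eq_refl.
rewrite exprS; apply: rel_eq_trans (rel_eqMr _ xn) _; by rewrite mul1r.
Qed.

Local Notation T0 := ('I_n * 'I_n * 'I_n)%type.

Definition uq_basis (e : T0) : A := uq_mono e.1.1 e.1.2 e.2.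

Lemma uq_mono_fin s t r :
  uq_mono s t r ≡ 0 \/ exists e : T0, uq_mono s t r ≡ uq_basis e.
Proof.
rewrite /uq_mono.
have [ns|sn] := leqP n s.
  left; rewrite -[F ^+ s]mul1r -mulrA; apply: rel_eq0_mul; exact: rel_eq0X.
have [nr|rn] := leqP n r.
  left; rewrite -[X in X ≡ _]mulr1; apply: rel_eq0_mul; exact: rel_eq0X.
have [t' tn e] := rel_eq1X t hKn.
right; exists (Ordinal sn, Ordinal tn, Ordinal rn); rewrite /uq_basis /uq_mono /=.
by apply/rel_eqMr/rel_eqMl.
Qed.

Section DoublePart.
Variables (a b c d : A).
Hypotheses (han : a ^+ n ≡ 1) (hbn : b ^+ n ≡ 0) (hcn : c ^+ n ≡ 0).
Hypotheses (hba : b * a ≡ q *: (a * b)) (hca : c * a ≡ q *: (a * c)).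
Hypotheses (hbc : b * c ≡ c * b) (had : a * d ≡ q^-1 *: (b * c) + 1).
Hypotheses (hKa : K * a ≡ a * K) (hKb : K * b ≡ q ^- 2 *: (b * K)).
Hypotheses (hKc : K * c ≡ q ^+ 2 *: (c * K)).
Hypotheses (hEa : E * a ≡ q^-1 *: (a * E) - q^-1 *: c).
Hypotheses (hEb : E * b ≡ q^-1 *: (b * E) + q^-1 *: (a * K) - q^-1 *: d).
Hypotheses (hEc : E * c ≡ q *: (c * E)).
Hypotheses (hFa : F * a ≡ q^-1 *: (a * F) + b) (hFb : F * b ≡ q *: (b * F)).
Hypotheses (hFc : F * c ≡ q^-1 *: (c * F) - a * K ^+ n.-1 + d).

(** Nested to the right, so that a letter multiplied on the left meets the others one at a time,
    with [x] an arbitrary tail. *)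
Definition double_mono (i j l : nat) (x : A) : A := a ^+ i * (b ^+ j * (c ^+ l * x)).

Local Notation G := (fun y => exists i j l s t r,
  y = double_mono i j l (uq_mono s t r)).
Local Notation sp := (spanned G).

Lemma double_monoP i j l s t r : sp (double_mono i j l (uq_mono s t r)).
Proof. by apply: SpannedGen; exists i, j, l, s, t, r. Qed.

Lemma spanned_uq x : spanned G0 x -> sp x.
Proof.
apply: spanned_trans => _ [s [t [r ->]]].
by have := double_monoP 0 0 0 s t r; rewrite /double_mono !mul1r.
Qed.

Lemma spanned_a x : sp x -> sp (a * x).
Proof.
apply: spanned_mull => _ [i [j [l [s [t [r ->]]]]]].
by rewrite /double_mono mulrA -exprS; apply: double_monoP.
Qed.

Lemma spanned_X g m x : (forall y, sp y -> sp (g * y)) -> sp x -> sp (g ^+ m * x).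
Proof.
move=> gP sx; elim: m => [|m IHm]; first by rewrite mul1r.
by rewrite exprS -mulrA; apply: gP.
Qed.

Lemma spanned_b x : sp x -> sp (b * x).
Proof.
apply: spanned_mull => _ [i [j [l [s [t [r ->]]]]]].
apply: SpannedCong (rel_eq_scaleMX _ _ hba) _; apply: SpannedZ.
by rewrite [b * _]mulrA -exprS; apply: double_monoP.
Qed.

Lemma spanned_c x : sp x -> sp (c * x).
Proof.
have hcb : c * b ≡ 1 *: (b * c) by rewrite scale1r; apply: rel_eq_sym.
apply: spanned_mull => _ [i [j [l [s [t [r ->]]]]]].
apply: SpannedCong (rel_eq_scaleMX _ _ hca) _; apply: SpannedZ.
apply: spanned_X spanned_a _.
apply: SpannedCong (rel_eq_scaleMX _ _ hcb) _; apply: SpannedZ.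
apply: spanned_X spanned_b _.
rewrite [c * _]mulrA -exprS; have := double_monoP 0 0 l.+1 s t r.
by rewrite /double_mono !mul1r.
Qed.

(** $a^{n-1}$ inverts $a$ on the left, whence $d=a^{n-1}(ad)$, which involves only $a,b,c$. *)
Lemma spanned_d x : sp x -> sp (d * x).
Proof.
move=> sx; have e : d ≡ a ^+ n.-1 * (q^-1 *: (b * c) + 1).
  apply: rel_eq_trans (rel_eqMl _ had); rewrite mulrA -exprSr prednK //.
  by rewrite -[X in X ≡ _]mul1r; apply/rel_eqMr/rel_eq_sym.
apply: SpannedCong (rel_eqMr _ e) _; rewrite -mulrA.
apply: spanned_X spanned_a _; rewrite mulrDl mul1r -scalerAl -mulrA.
by apply: SpannedD => //; apply/SpannedZ/spanned_b/spanned_c.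
Qed.

Lemma spanned_K x : sp x -> sp (K * x).
Proof.
have hKa1 : K * a ≡ 1 *: (a * K) by rewrite scale1r.
apply: spanned_mull => _ [i [j [l [s [t [r ->]]]]]].
apply: SpannedCong (rel_eq_scaleMX _ _ hKa1) _; apply: SpannedZ.
apply: spanned_X spanned_a _.
apply: SpannedCong (rel_eq_scaleMX _ _ hKb) _; apply: SpannedZ.
apply: spanned_X spanned_b _.
apply: SpannedCong (rel_eq_scaleMX _ _ hKc) _; apply: SpannedZ.
apply: spanned_X spanned_c _.
by apply/spanned_uq/uq_spanned_K/SpannedGen; exists s, t, r.
Qed.

(* Moving g past one letter h of a word turns g h into w, which only involves h g
   and letters under which the span is already known to be stable. *)
Lemma spanned_past g h w m x : g * h ≡ w -> (forall y, sp y -> sp (h * y)) ->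
  (forall y, sp y -> sp (g * y) -> sp (w * y)) ->
  sp x -> sp (g * x) -> sp (g * (h ^+ m * x)).
Proof.
move=> gh hP wP sx sgx; elim: m => [|m IHm]; first by rewrite mul1r.
rewrite exprS -mulrA mulrA; apply: SpannedCong (rel_eqMr _ gh) _.
by apply: wP => //; apply: spanned_X.
Qed.

(** Crossing $a$ leaves $c$ behind, and crossing $b$ leaves $aK$ and $d$; hence the stability under
    $a,b,c,d,K$ beforehand. Letters are crossed from the outside in, the innermost case being
    [uq_spanned_E]. *)
Lemma spanned_E x : sp x -> sp (E * x).
Proof.
have sd := spanned_d; have sa := spanned_a; have sb := spanned_b.
have sc := spanned_c; have sK := spanned_K.
apply: spanned_mull => _ [i [j [l [s [t [r ->]]]]]].
have su : spanned G0 (uq_mono s t r) by apply: SpannedGen; exists s, t, r.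
have sx := spanned_uq su; have sEx := spanned_uq (uq_spanned_E su).
have sc' := spanned_X l sc sx; have sb' := spanned_X j sb sc'.
apply: (spanned_past _ hEa) => // [y sy sEy|].
  rewrite mulrBl -!scalerAl -!mulrA; apply: spannedB; apply: SpannedZ; auto.
apply: (spanned_past _ hEb) => // [y sy sEy|].
  rewrite mulrBl mulrDl -!scalerAl -!mulrA.
  by apply: spannedB; [apply: SpannedD|]; apply: SpannedZ; auto.
apply: (spanned_past _ hEc) => // y sy sEy.
by rewrite -scalerAl -mulrA; apply: SpannedZ; auto.
Qed.

Lemma spanned_F x : sp x -> sp (F * x).
Proof.
have sd := spanned_d; have sa := spanned_a; have sb := spanned_b.
have sc := spanned_c; have sK := spanned_K.
apply: spanned_mull => _ [i [j [l [s [t [r ->]]]]]].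
have su : spanned G0 (uq_mono s t r) by apply: SpannedGen; exists s, t, r.
have sx := spanned_uq su; have sFx := spanned_uq (uq_spanned_F su).
have sc' := spanned_X l sc sx; have sb' := spanned_X j sb sc'.
apply: (spanned_past _ hFa) => // [y sy sFy|].
  rewrite mulrDl -!scalerAl -!mulrA; apply: SpannedD; [apply: SpannedZ|]; auto.
apply: (spanned_past _ hFb) => // [y sy sFy|].
  by rewrite -scalerAl -mulrA; apply: SpannedZ; auto.
apply: (spanned_past _ hFc) => // y sy sFy.
rewrite mulrDl mulrBl -!scalerAl -!mulrA; apply: SpannedD; last by auto.
apply: spannedB; first by apply: SpannedZ; auto.
by apply: sa; apply: spanned_X.
Qed.

Lemma spanned_1 : sp 1.
Proof.
by have := double_monoP 0 0 0 0 0 0; rewrite /double_mono /uq_mono !mul1r.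
Qed.

Definition double_basis (e : T0 * T0) : A :=
  double_mono e.1.1.1 e.1.1.2 e.1.2 (uq_basis e.2).

Lemma double_mono_fin i j l s t r :
  double_mono i j l (uq_mono s t r) ≡ 0
  \/ exists e, double_mono i j l (uq_mono s t r) ≡ double_basis e.
Proof.
rewrite /double_mono.
have [nj|jn] := leqP n j.
  by left; rewrite mulrA; apply: rel_eq0_mul; apply: rel_eq0X.
have [nl|ln] := leqP n l.
  by left; rewrite 2!mulrA; apply: rel_eq0_mul; apply: rel_eq0X.
have [u0|[e ue]] := uq_mono_fin s t r.
  left; have := rel_eqMl (a ^+ i) (rel_eqMl (b ^+ j) (rel_eqMl (c ^+ l) u0)).
  by rewrite !mulr0.
have [i' i'n ie] := rel_eq1X i han.
right; exists ((Ordinal i'n, Ordinal jn, Ordinal ln), e).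
rewrite /double_basis /double_mono /=.
by apply: rel_eq_trans (rel_eqMr _ ie) _; do 3!apply: rel_eqMl.
Qed.

Lemma double_basis_span x : sp x ->
  exists z : T0 * T0 -> k, x ≡ \sum_e z e *: double_basis e.
Proof.
move=> sx; apply: spanned_coef; apply: spanned_trans sx.
move=> _ [i [j [l [s [t [r ->]]]]]].
have [m0|[e me]] := double_mono_fin i j l s t r.
  by apply: SpannedCong m0 _; apply: Spanned0.
by apply: SpannedCong me _; apply: SpannedGen; exists e.
Qed.

End DoublePart.

Lemma uq_basis_span x : spanned G0 x ->
  exists z : T0 -> k, x ≡ \sum_e z e *: uq_basis e.
Proof.
move=> sx; apply: spanned_coef; apply: spanned_trans sx.
move=> _ [s [t [r ->]]].
have [m0|[e me]] := uq_mono_fin s t r.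
  by apply: SpannedCong m0 _; apply: Spanned0.
by apply: SpannedCong me _; apply: SpannedGen; exists e.
Qed.

End UqPart.

End Congruence.

Lemma qcommX (k : fieldType) (A : algType k) (q : k) (u v : A) m :
  v * u = q *: (u * v) -> v * u ^+ m = q ^+ m *: (u ^+ m * v).
Proof.
move=> e; elim: m => [|m IHm]; first by rewrite !expr0 scale1r mulr1 mul1r.
by rewrite [in LHS]exprS mulrA e -scalerAl -mulrA IHm -scalerAr scalerA mulrA
  -!exprS.
Qed.

Lemma qcommXl (k : fieldType) (A : algType k) (q : k) (u v : A) m :
  v * u = q *: (u * v) -> v ^+ m * u = q ^+ m *: (u * v ^+ m).
Proof.
move=> e; elim: m => [|m IHm]; first by rewrite !expr0 scale1r mulr1 mul1r.
by rewrite [in LHS]exprSr -mulrA e -scalerAr mulrA IHm -scalerAl scalerA -mulrA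
  -exprSr -exprS.
Qed.

Lemma rel_ideal_nil (A : nzRingType) (x : A) : rel_ideal [::] x -> x = 0.
Proof.
elim=> // [y z _ -> _ ->|y z _ ->|y z _ ->].
- exact: addr0.
- exact: mulr0.
- exact: mul0r.
Qed.

Lemma rel_eq_of_eq (k : fieldType) (A : lalgType k) rels (x y : A) :
  x = y -> rel_eq rels x y.
Proof. by move=> ->; apply: rel_eq_refl. Qed.

(** Splits a statement about every index of the list of relations into one goal per relation, with
    the entry computed. *)
Ltac nth_cases :=
  first [ by [] | case=> [_|]; [cbn [nth fst snd cat double_rels uq_rels] | nth_cases] ].

Lemma double_rels_morph (k : fieldType) (A B : lalgType k) (n : nat) (q : k)
    (phi : {linear A -> B}) (a b c d E F K : A) :
  phi 1 = 1 -> {morph phi : x y / x * y} ->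
  [seq (phi lr.1, phi lr.2) | lr <- double_rels n q a b c d E F K]
  = double_rels n q (phi a) (phi b) (phi c) (phi d) (phi E) (phi F) (phi K).
Proof.
move=> phi1 phiM.
have phiX x m : phi (x ^+ m) = phi x ^+ m.
  by elim: m => [|m IHm]; rewrite ?expr0 // !exprS phiM IHm.
have phiD x y : phi (x + y) = phi x + phi y by exact: linearD.
have phiN x : phi (- x) = - phi x by exact: linearN.
have phiZ e x : phi (e *: x) = e *: phi x by exact: linearZ.
have phi0 : phi 0 = 0 by exact: linear0.
by rewrite /double_rels /uq_rels /= !(phiD, phiN, phiZ, phiM, phiX, phi1, phi0).
Qed.

(** The coproduct of $H^*$ is determined by values on products, so the product rule of a matrix
    coefficient already is its coproduct. *)
Lemma dual_comul_sum2 (k : fieldType) (H : falgType k)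
    (p p1 p2 r1 r2 : dual_space H) :
  (forall x y, p (x * y) = p1 x * r1 y + p2 x * r2 y) ->
  dual_comul p = p1 ⊗ r1 + p2 ⊗ r2.
Proof.
move=> pE; have tE (v w : dual_space H) : v ⊗ w = \sum_(i < \dim {:H})
    \sum_(j < \dim {:H}) (v (vbasis {:H})`_i * w (vbasis {:H})`_j : k)
      *: (dual_basis i ⊗ dual_basis j).
  rewrite (linear_dual_basis v (tpure_linearl (W := dual_space H) w)).
  apply: eq_bigr => i _.
  rewrite (linear_dual_basis w (tpure_linearr (dual_basis i))) scaler_sumr.
  by apply: eq_bigr => j _; rewrite scalerA.
rewrite !tE -big_split; apply: eq_bigr => i _ /=.
by rewrite -big_split; apply: eq_bigr => j _ /=; rewrite pE scalerDl.
Qed.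

Lemma dual_comul_groupLike (k : fieldType) (H : falgType k) (p : dual_space H) :
  (forall x y, p (x * y) = p x * p y) -> dual_comul p = p ⊗ p.
Proof.
move=> pM; rewrite (@dual_comul_sum2 _ _ p p 0 p p).
  have -> : (0 : dual_space H) ⊗ p = 0.
    by apply/matrixP => i j; rewrite !mxE linear0 mul0r.
  exact: addr0.
by move=> x y; rewrite zero_lfunE mul0r addr0.
Qed.

(** The span is hidden behind its closure properties, so that the caller never handles the six
    exponents. *)
Lemma double_rels_spanned (k : fieldType) (A : lalgType k) (n : nat) (q : k)
    (a b c d E F K : A) :
  (forall (c : k) (x y : A), c *: (x * y) = x * (c *: y)) ->
  (0 < n)%N -> q != 0 ->
  let rels := double_rels n q a b c d E F K in
  exists sp : A -> Prop,
  [/\ [/\ forall x y, sp x -> sp y -> sp (x + y),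
          forall c x, sp x -> sp (c *: x) & sp 1],
      [/\ forall x, sp x -> sp (a * x), forall x, sp x -> sp (b * x),
          forall x, sp x -> sp (c * x) & forall x, sp x -> sp (d * x)],
      [/\ forall x, sp x -> sp (E * x), forall x, sp x -> sp (F * x)
        & forall x, sp x -> sp (K * x)]
    & forall x, sp x -> exists z : 'I_n * 'I_n * 'I_n * ('I_n * 'I_n * 'I_n) -> k,
        rel_eq rels x (\sum_e z e *: double_basis E F K a b c e)].
Proof.
move=> sA n0 q0 rels.
(* Positions 0 to 9 hold the relations among $a,b,c,d$, positions 10 to 15 those among $E,F,K$, and
   positions 16 to 27 the mixed ones. *)
have R i : (i < 28)%N -> rel_eq rels (nth (0, 0) rels i).1 (nth (0, 0) rels i).2.
  by move=> ilt; apply: RelIdealRel; rewrite -surjective_pairing mem_nth.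
have r0 := R 0 isT; have r2 := R 2 isT; have r3 := R 3 isT; have r4 := R 4 isT.
have r6 := R 6 isT; have r8 := R 8 isT; have r9 := R 9 isT.
have r10 := R 10 isT; have r11 := R 11 isT; have r12 := R 12 isT.
have r13 := R 13 isT; have r14 := R 14 isT; have r15 := R 15 isT.
have r16 := R 16 isT; have r17 := R 17 isT; have r18 := R 18 isT.
have r20 := R 20 isT; have r21 := R 21 isT; have r22 := R 22 isT.
have r24 := R 24 isT; have r25 := R 25 isT; have r26 := R 26 isT.
rewrite {R} /= in r0 r2 r3 r4 r6 r8 r9 r10 r11 r12 r13 r14 r15 r16 r17 r18 r20 r21 r22 r24 r25 r26.
exists (spanned rels (fun y : A => exists i j l s t r : nat,
  y = double_mono a b c i j l (uq_mono E F K s t r))); split; [split | split | split | ].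
- exact: SpannedD.
- exact: SpannedZ.
- exact: spanned_1.
- exact: (spanned_a sA).
- exact: (spanned_b sA r4).
- exact: (spanned_c sA r4 r6 r8).
- exact: (spanned_d sA n0 r0 r4 r6 r8 r9).
- exact: (spanned_E sA n0 q0 r13 r14 r15 r0 r4 r6 r8 r9 r16 r17 r18 r20 r21 r22).
- exact: (spanned_F sA n0 r14 r0 r4 r6 r8 r9 r16 r17 r18 r24 r25 r26).
- exact: (spanned_K sA r14 r4 r6 r8 r16 r17 r18).
- exact: (double_basis_span n0 r10 r11 r12 r0 r2 r3).
Qed.

Lemma double_basis_morph (k : fieldType) (A B : lalgType k) (n : nat)
    (phi : {linear A -> B}) (a b c E F K : A) e :
  phi 1 = 1 -> {morph phi : x y / x * y} ->
  phi (@double_basis k A n E F K a b c e)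
  = double_basis (phi E) (phi F) (phi K) (phi a) (phi b) (phi c) e.
Proof.
move=> phi1 phiM.
have phiX x m : phi (x ^+ m) = phi x ^+ m.
  by elim: m => [|m IHm]; rewrite ?expr0 // !exprS phiM IHm.
by rewrite /double_basis /double_mono /uq_basis /uq_mono !phiM !phiX.
Qed.

Section TensorSums.
Variables (k : fieldType) (V W : vectType k) (I : finType).

Lemma linear_tpure_suml (z : I -> k) (v : I -> V) (w : W) :
  (\sum_i z i *: v i) ⊗ w = \sum_i z i *: (v i ⊗ w).
Proof.
have l := tpure_linearl (V := V) w.
pose fL := GRing.isLinear.Build k V (tensor V W) *:%R _ l.
pose f : {linear V -> tensor V W} := HB.pack (fun v => v ⊗ w) fL.
by rewrite -[LHS]/(f _) linear_sum; apply: eq_bigr => i _; rewrite linearZ_LR.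
Qed.

Lemma linear_tpure_sumr (z : I -> k) (v : V) (w : I -> W) :
  v ⊗ (\sum_i z i *: w i) = \sum_i z i *: (v ⊗ w i).
Proof.
have l := tpure_linearr (W := W) v.
pose fL := GRing.isLinear.Build k W (tensor V W) *:%R _ l.
pose f : {linear W -> tensor V W} := HB.pack (fun w => v ⊗ w) fL.
by rewrite -[LHS]/(f _) linear_sum; apply: eq_bigr => i _; rewrite linearZ_LR.
Qed.

End TensorSums.

Lemma ord7_ind (P : 'I_7 -> Prop) :
  P (inord 0) -> P (inord 1) -> P (inord 2) -> P (inord 3) -> P (inord 4) ->
  P (inord 5) -> P (inord 6) -> forall i, P i.
Proof.
move=> P0 P1 P2 P3 P4 P5 P6 i; rewrite -[i]inord_val.
by case: i => [[|[|[|[|[|[|[|m]]]]]]] lt].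
Qed.

(** * Matrix coefficients and the presentation of the double *)

Section UqDouble.
Variables (k : fieldType) (n : nat) (q : k).
Hypotheses (n_ge3 : (3 <= n)%N) (n_odd : odd n) (q_prim : n.-primitive_root q).
Variables (U : falgType k) (Delta : 'Hom(U, tensor U U)) (eps : 'Hom(U, k^o)).
Variables (S : 'End(U)) (E F K : U) (hU : is_uq_sl2 n q Delta eps S E F K).
Variables (rho : {lrmorphism U -> 'M[k]_2}).
Hypotheses (rhoE : rho E = mx2 0 1 0 0) (rhoF : rho F = mx2 0 0 1 0).
Hypothesis (rhoK : rho K = mx2 q 0 0 q^-1).
Local Notation R := (dual_alg (uq_hopf hU)).
Local Notation fn p := (p : dual_space U).
Variables (a b c d : R).
Hypothesis rho_coef :
  forall v, rho v = @mx2 k (fn a v) (fn b v) (fn c v) (fn d v).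

Let n_gt0 : (0 < n)%N. Proof. exact: leq_trans n_ge3. Qed.
Let q0 : q != 0. Proof. exact: prim_neq0 n_ge3 q_prim. Qed.

Let hH := uq_hopf hU.
Let S_inj := uq_antipode_inj n_gt0 hU.
Let hA := uq_act_conv n_gt0 hU.

Lemma repr_coefM x y :
  [/\ fn a (x * y) = fn a x * fn a y + fn b x * fn c y,
      fn b (x * y) = fn a x * fn b y + fn b x * fn d y,
      fn c (x * y) = fn c x * fn a y + fn d x * fn c y
    & fn d (x * y) = fn c x * fn b y + fn d x * fn d y].
Proof.
by have := rho_coef (x * y); rewrite rmorphM /= !rho_coef mulmx2 => /esym/mx2_inj.
Qed.

Lemma repr_coef1 : [/\ fn a 1 = 1, fn b 1 = 0, fn c 1 = 0 & fn d 1 = 1].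
Proof. by have := rho_coef 1; rewrite rmorph1 mx2_1 => /esym/mx2_inj. Qed.

Lemma repr_coefE : [/\ fn a E = 0, fn b E = 1, fn c E = 0 & fn d E = 0].
Proof. by have := rho_coef E; rewrite rhoE => /esym/mx2_inj. Qed.

Lemma repr_coefF : [/\ fn a F = 0, fn b F = 0, fn c F = 1 & fn d F = 0].
Proof. by have := rho_coef F; rewrite rhoF => /esym/mx2_inj. Qed.

Lemma repr_coefK : [/\ fn a K = q, fn b K = 0, fn c K = 0 & fn d K = q^-1].
Proof. by have := rho_coef K; rewrite rhoK => /esym/mx2_inj. Qed.

Lemma repr_coefKV : [/\ fn a K^-1 = q^-1, fn b K^-1 = 0, fn c K^-1 = 0 & fn d K^-1 = q].
Proof.
have Ku := uq_K_unit n_gt0 hU.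
have e : mx2 q 0 0 q^-1 * mx2 q^-1 0 0 q = 1 :> 'M[k]_2.
  by rewrite mulmx2 mx2_1 !mulr0 !mul0r !addr0 add0r mulfV // mulVf.
have := rho_coef K^-1; rewrite -[LHS]mulr1 -e mulrA -rhoK -rmorphM /=.
by rewrite mulVr // rmorph1 mul1r => /esym/mx2_inj.
Qed.

(** $\rho(xh)=\rho(x)\rho(h)$ makes [hitl] combine the columns of $\rho$, and
    $\rho(hx)=\rho(h)\rho(x)$ makes [hitr] combine its rows; all translates below are read off in
    this way. *)
Lemma hitE_coef :
  [/\ hitl E a = 0, hitl E b = a, hitl E c = 0 & hitl E d = c].
Proof.
have [aE bE cE dE] := repr_coefE.
split; apply: dual_algP => x; rewrite hitlE;
  have [ax bx cx dx] := repr_coefM x E; rewrite ?ax ?bx ?cx ?dx ?aE ?bE ?cE ?dE;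
  by rewrite !(mulr0, mulr1, addr0, add0r) ?dual_alg0.
Qed.

Lemma hitF_coef :
  [/\ hitl F a = b, hitl F b = 0, hitl F c = d & hitl F d = 0].
Proof.
have [aE bE cE dE] := repr_coefF.
split; apply: dual_algP => x; rewrite hitlE;
  have [ax bx cx dx] := repr_coefM x F; rewrite ?ax ?bx ?cx ?dx ?aE ?bE ?cE ?dE;
  by rewrite !(mulr0, mulr1, addr0, add0r) ?dual_alg0.
Qed.

Lemma hitK_coef :
  [/\ hitl K a = q *: a, hitl K b = q^-1 *: b,
      hitl K c = q *: c & hitl K d = q^-1 *: d].
Proof.
have [aE bE cE dE] := repr_coefK.
split; apply: dual_algP => x; rewrite hitlE dual_algZ;
  have [ax bx cx dx] := repr_coefM x K; rewrite ?ax ?bx ?cx ?dx ?aE ?bE ?cE ?dE;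
  by rewrite !(mulr0, mulr1, addr0, add0r) mulrC.
Qed.

Lemma hitKV_coef :
  [/\ hitl K^-1 a = q^-1 *: a, hitl K^-1 b = q *: b,
      hitl K^-1 c = q^-1 *: c & hitl K^-1 d = q *: d].
Proof.
have [aE bE cE dE] := repr_coefKV.
split; apply: dual_algP => x; rewrite hitlE dual_algZ;
  have [ax bx cx dx] := repr_coefM x K^-1; rewrite ?ax ?bx ?cx ?dx ?aE ?bE ?cE ?dE;
  by rewrite !(mulr0, mulr1, addr0, add0r) mulrC.
Qed.

Lemma hitrE_coef :
  [/\ hitr E a = c, hitr E b = d, hitr E c = 0 & hitr E d = 0].
Proof.
have [aE bE cE dE] := repr_coefE.
split; apply: dual_algP => x; rewrite hitrE;
  have [ax bx cx dx] := repr_coefM E x; rewrite ?ax ?bx ?cx ?dx ?aE ?bE ?cE ?dE;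
  by rewrite !(mul0r, mul1r, addr0, add0r) ?dual_alg0.
Qed.

Lemma hitrF_coef :
  [/\ hitr F a = 0, hitr F b = 0, hitr F c = a & hitr F d = b].
Proof.
have [aE bE cE dE] := repr_coefF.
split; apply: dual_algP => x; rewrite hitrE;
  have [ax bx cx dx] := repr_coefM F x; rewrite ?ax ?bx ?cx ?dx ?aE ?bE ?cE ?dE;
  by rewrite !(mul0r, mul1r, addr0, add0r) ?dual_alg0.
Qed.

Lemma hitrK_coef :
  [/\ hitr K a = q *: a, hitr K b = q *: b,
      hitr K c = q^-1 *: c & hitr K d = q^-1 *: d].
Proof.
have [aE bE cE dE] := repr_coefK.
split; apply: dual_algP => x; rewrite hitrE dual_algZ;
  have [ax bx cx dx] := repr_coefM K x; rewrite ?ax ?bx ?cx ?dx ?aE ?bE ?cE ?dE;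
  by rewrite !(mul0r, addr0, add0r).
Qed.

Lemma hitrKV_coef :
  [/\ hitr K^-1 a = q^-1 *: a, hitr K^-1 b = q^-1 *: b,
      hitr K^-1 c = q *: c & hitr K^-1 d = q *: d].
Proof.
have [aE bE cE dE] := repr_coefKV.
split; apply: dual_algP => x; rewrite hitrE dual_algZ;
  have [ax bx cx dx] := repr_coefM K^-1 x; rewrite ?ax ?bx ?cx ?dx ?aE ?bE ?cE ?dE;
  by rewrite !(mul0r, addr0, add0r).
Qed.

(* The seven identities are proved together: each of them, evaluated at x E, x F or
   x K, is a combination of all seven evaluated at x. *)
Lemma dual_quadratic :
  [/\ b * a = q *: (a * b), d * b = q *: (b * d), c * a = q *: (a * c),
      d * c = q *: (c * d) & b * c = c * b]
  /\ (a * d = q^-1 *: (b * c) + 1 /\ d * a = q *: (b * c) + 1).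
Proof.
have [aE bE cE dE] := hitE_coef; have [aF bF cF dF] := hitF_coef.
have [aK bK cK dK] := hitK_coef; have [aV bV cV dV] := hitKV_coef.
suff H x : [/\ fn (b * a) x = q * fn (a * b) x,
     fn (d * b) x = q * fn (b * d) x, fn (c * a) x = q * fn (a * c) x,
     fn (d * c) x = q * fn (c * d) x & fn (b * c) x = fn (c * b) x]
  /\ (fn (a * d) x = q^-1 * fn (b * c) x + eps x
      /\ fn (d * a) x = q * fn (b * c) x + eps x).
  split; [split|split]; apply: dual_algP => x; have [[? ? ? ? ?] [? ?]] := H x;
    by rewrite ?dual_algD ?dual_algZ ?(dual_alg_1 hH).
have HE (p r : R) y : fn (p * r) (y * E)
    = fn (p * hitl E r) y + fn (hitl E p * hitl K r) y.
  by rewrite -hitlE hitlEM dual_algD.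
have HF (p r : R) y : fn (p * r) (y * F)
    = fn (hitl K^-1 p * hitl F r) y + fn (hitl F p * r) y.
  by rewrite -hitlE hitlFM dual_algD.
have HK (p r : R) y : fn (p * r) (y * K) = fn (hitl K p * hitl K r) y.
  by rewrite -hitlE hitlK.
have vZl e (p r : R) y : fn ((e *: p) * r) y = e * fn (p * r) y.
  by rewrite -scalerAl dual_algZ.
have vZr e (p r : R) y : fn (p * (e *: r)) y = e * fn (p * r) y.
  by rewrite -scalerAr dual_algZ.
have v0l (p : R) y : fn (0 * p) y = 0 by rewrite mul0r dual_alg0.
have v0r (p : R) y : fn (p * 0) y = 0 by rewrite mulr0 dual_alg0.
elim/(uq_indr hU): x => [x y|e x||x|x|x].
- move=> [[e1 e2 e3 e4 e5] [e6 e7]] [[f1 f2 f3 f4 f5] [f6 f7]].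
  rewrite !linearD /= e1 e2 e3 e4 -e5 e6 e7 f1 f2 f3 f4 -f5 f6 f7.
  by split; split; ring.
- move=> [[e1 e2 e3 e4 e5] [e6 e7]].
  have vS (p : dual_space U) : p (e *: x) = e * p x by exact: linearZ.
  rewrite !vS e1 e2 e3 e4 -e5 e6 e7.
  by split; split; ring.
- have [a1 b1 c1 d1] := repr_coef1; rewrite !dual_alg_eval1M a1 b1 c1 d1.
  rewrite (hopf_counit1 hH); by split; split; ring.
- move=> [[e1 e2 e3 e4 e5] [e6 e7]].
  rewrite !HE aE bE cE dE aK bK cK dK !(vZl, vZr, v0l, v0r).
  rewrite ?e1 ?e2 ?e3 ?e4 -?e5 ?e6 ?e7 (hopf_counitM hH) (uq_counitE hU).
  by split; split; field.
- move=> [[e1 e2 e3 e4 e5] [e6 e7]].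
  rewrite !HF aF bF cF dF aV bV cV dV !(vZl, vZr, v0l, v0r).
  rewrite ?e1 ?e2 ?e3 ?e4 -?e5 ?e6 ?e7 (hopf_counitM hH) (uq_counitF hU).
  by split; split; field.
- move=> [[e1 e2 e3 e4 e5] [e6 e7]].
  rewrite !HK aK bK cK dK !(vZl, vZr, v0l, v0r).
  rewrite ?e1 ?e2 ?e3 ?e4 -?e5 ?e6 ?e7 (hopf_counitM hH) (uq_counitK hU).
  by split; split; field.
Qed.

(** $E$ is a twisted derivation, and since $u$ and its derivative $v$ commute up to $q$, the $m$
    Leibniz terms gather into one with coefficient $[m]_q$. For $m=n$ it vanishes. *)
Lemma hitE_pow (u v : R) m : hitl E u = v -> hitl K u = q^-1 *: u ->
  u * v = q *: (v * u) -> hitl E (u ^+ m) = qint q m *: (v * u ^+ m.-1).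
Proof.
move=> uE uK uv; elim: m => [|m IHm].
  by rewrite expr0 hitl1 (uq_counitE hU) qint0 !scale0r.
rewrite exprS hitlEM IHm uE (hitlKX m uK) (qintSl n_ge3 n_odd q_prim) scalerDl.
rewrite -!scalerAr exprVn; congr (_ + _).
(* At $m=0$ the truncated predecessor is harmless, as the coefficient $[0]_q$ vanishes. *)
case: m {IHm} => [|m]; first by rewrite qint0 mulr0 !scale0r.
by rewrite mulrA uv -scalerAl scalerA [q * _]mulrC -[v * u * _]mulrA -exprS.
Qed.

Lemma hitF_pow (u v : R) m : hitl F u = v -> hitl K^-1 u = q^-1 *: u ->
  v * u = q *: (u * v) -> hitl F (u ^+ m) = qint q m *: (u ^+ m.-1 * v).
Proof.
move=> uF uK uv; elim: m => [|m IHm].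
  by rewrite expr0 hitl1 (uq_counitF hU) qint0 !scale0r.
rewrite exprS hitlFM IHm uF uK (qintSr n_ge3 n_odd q_prim) scalerDl.
rewrite -scalerAl -scalerAr scalerA (qcommX _ uv); congr (_ + _).
case: m {IHm} => [|m]; first by rewrite qint0 mulr0 !scale0r.
by rewrite [u * _]mulrA -exprS.
Qed.

(** Each $n$-th power is invariant: one of $E,F$ kills the coefficient and so its powers, the other
    contributes the factor $[n]_q=0$, and $K$ scales by $q^{\pm n}=1$. *)
Lemma dual_powers : [/\ a ^+ n = 1, d ^+ n = 1, b ^+ n = 0 & c ^+ n = 0].
Proof.
have [aE bE cE dE] := hitE_coef; have [aF bF cF dF] := hitF_coef; have [aK bK cK dK] := hitK_coef.
have [aV bV cV dV] := hitKV_coef; have [[q1 q2 q3 q4 q5] _] := dual_quadratic.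
have [a1 b1 c1 d1] := repr_coef1.
have qn : q ^+ n = 1 by exact: prim_expr_order.
have qVn : q^-1 ^+ n = 1 by rewrite exprVn qn invr1.
have qi := qint_order q_prim.
have z : (0 : k) ^+ n = 0 by rewrite expr0n gtn_eqF.
split.
- rewrite [LHS]hit_invariant ?dual_alg_eval1X ?a1 ?expr1n ?scale1r //.
  + exact: hitlEX0.
  + by rewrite (hitF_pow _ aF aV q1) qi scale0r.
  + by rewrite (hitlKX _ aK) qn scale1r.
- rewrite [LHS]hit_invariant ?dual_alg_eval1X ?d1 ?expr1n ?scale1r //.
  + by rewrite (hitE_pow _ dE dK q4) qi scale0r.
  + exact: hitlFX0.
  + by rewrite (hitlKX _ dK) qVn scale1r.
- rewrite [LHS]hit_invariant ?dual_alg_eval1X ?b1 ?z ?scale0r //.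
  + by rewrite (hitE_pow _ bE bK q1) qi scale0r.
  + exact: hitlFX0.
  + by rewrite (hitlKX _ bK) qVn scale1r.
- rewrite [LHS]hit_invariant ?dual_alg_eval1X ?c1 ?z ?scale0r //.
  + exact: hitlEX0.
  + by rewrite (hitF_pow _ cF cV q4) qi scale0r.
  + by rewrite (hitlKX _ cK) qn scale1r.
Qed.

(** * Monomials in the coefficients and their pairing with $U$ *)

Definition dmono (i j l : nat) : R := a ^+ i * b ^+ j * c ^+ l.

Lemma hitE_dmono i j l :
  hitl E (dmono i j l) = (q ^+ l * qint q j) *: dmono i.+1 j.-1 l.
Proof.
have [aE bE cE dE] := hitE_coef; have [aK bK cK dK] := hitK_coef.
have [[q1 q2 q3 q4 q5] _] := dual_quadratic.
rewrite /dmono !hitlEM (hitlEX0 _ aE) (hitlEX0 _ cE) mulr0 add0r mul0r addr0.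
rewrite (hitE_pow _ bE bK q1) (hitlKX _ cK) -!scalerAr -scalerAl.
by rewrite scalerA [_ * (a * _)]mulrA -exprSr.
Qed.

Lemma hitK_dmono i j l :
  hitl K (dmono i j l) = (q ^+ i * q ^- j * q ^+ l) *: dmono i j l.
Proof.
have [aK bK cK dK] := hitK_coef.
rewrite /dmono !hitlK (hitlKX _ aK) (hitlKX _ bK) (hitlKX _ cK).
by rewrite -!scalerAl -!scalerAr -!scalerAl !scalerA exprVn; congr (_ *: _); ring.
Qed.

(** The unsymmetrised $q^2$-integer $1+q^2+\dots+q^{2(m-1)}$: under [hitr F], the twist by $K^{-1}$
    and the exchange $ca=qac$ give a factor $q$ each. *)
Fixpoint fint (m : nat) : k := if m is m'.+1 then q ^+ 2 * fint m' + 1 else 0.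

Lemma fintE m : (q ^+ 2 - 1) * fint m = q ^+ (2 * m) - 1.
Proof.
elim: m => [|m IHm]; first by rewrite muln0 mulr0 expr0 subrr.
rewrite /= mulrDr mulr1 mulrCA IHm mulnS exprD; ring.
Qed.

Lemma fint_neq0 m : (0 < m < n)%N -> fint m != 0.
Proof.
move=> mn; have : (q ^+ 2 - 1) * fint m != 0.
  by rewrite fintE subr_eq0 (prim_sqr_neq1 n_odd q_prim).
by rewrite mulf_eq0 negb_or => /andP[].
Qed.

Lemma hitrF_pow m : hitr F (c ^+ m) = fint m *: (a * c ^+ m.-1).
Proof.
have [aF bF cF _] := hitrF_coef; have [aV bV cV _] := hitrKV_coef.
have [[q1 q2 q3 q4 q5] _] := dual_quadratic.
elim: m => [|m IHm]; first by rewrite expr0 hitr1 (uq_counitF hU) !scale0r.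
rewrite exprS hitrFM IHm cF cV /= scalerDl scale1r; congr (_ + _).
rewrite -scalerAl -scalerAr scalerA.
case: m {IHm} => [|m]; first by rewrite /= !mulr0 !scale0r.
rewrite [c * (_ * _)]mulrA q3 -scalerAl scalerA -[a * c * _]mulrA -exprS; congr (_ *: _); ring.
Qed.

Lemma hitrF_dmono i j l :
  hitr F (dmono i j l) = (q ^- i * fint l) *: dmono i.+1 j l.-1.
Proof.
have [aF bF cF _] := hitrF_coef; have [aV bV cV _] := hitrKV_coef.
have [[q1 q2 q3 q4 q5] _] := dual_quadratic.
rewrite /dmono !hitrFM (hitrFX0 _ aF) (hitrFX0 _ bF).
rewrite mulr0 mul0r add0r mul0r addr0 hitrF_pow (hitrKV n_gt0).
rewrite (hitrKVX n_gt0 _ aV) (hitrKVX n_gt0 _ bV).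
rewrite -!scalerAl -!scalerAr !scalerA -scalerAl scalerA.
rewrite [a ^+ i * _ * _]mulrA -[a ^+ i * _ * a]mulrA (qcommXl _ q1).
rewrite -scalerAr -scalerAl scalerA [a ^+ i * _]mulrA -exprSr; congr (_ *: _).
by rewrite !exprVn; field; rewrite !expf_neq0.
Qed.

Lemma dmono_eval1 i j l :
  fn (dmono i j l) 1 = ((j == 0%N) && (l == 0%N))%:R.
Proof.
have [a1 b1 c1 d1] := repr_coef1.
rewrite /dmono !dual_alg_eval1M !dual_alg_eval1X a1 b1 c1 expr1n mul1r.
by rewrite !expr0n -natrM mulnb.
Qed.

(** Each $F$ taken off the left trades a $c$ for an $a$, so [z] is a product of powers of $q$ and of
    $q^2$-integers of positive index at most $l<n$. What remains is tested at 1, where $b$ and $c$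
    vanish. *)
Lemma dmono_evalF l i : (l < n)%N ->
  exists2 z : k, z != 0 &
  forall j s, fn (dmono i j l) (F ^+ s) = z * ((j == 0%N) && (s == l))%:R.
Proof.
elim: l i => [|l IHl] i ln.
  exists 1; first exact: oner_neq0.
  move=> j [|s]; first by rewrite expr0 dmono_eval1 mul1r.
  rewrite exprS -hitrE hitrF_dmono dual_algZ /=.
  by rewrite andbF !mulr0 mul0r.
have [z z0 zE] := IHl i.+1 (ltnW ln).
exists (q ^- i * fint l.+1 * z).
  by rewrite !mulf_neq0 ?fint_neq0 ?invr_eq0 ?expf_neq0.
move=> j [|s]; first by rewrite expr0 dmono_eval1 andbF mulr0.
by rewrite exprS -hitrE hitrF_dmono dual_algZ zE eqSS mulrA.
Qed.

Lemma dmono_evalK i j l x t : fn (dmono i j l) (x * K ^+ t)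
  = (q ^+ i * q ^- j * q ^+ l) ^+ t * fn (dmono i j l) x.
Proof.
elim: t => [|t IHt]; first by rewrite !expr0 mulr1 mul1r.
by rewrite exprSr mulrA -hitlE hitK_dmono dual_algZ IHt exprS mulrA.
Qed.

(* E acting on one side only lowers the exponent of b, F acting on the other side
   only lowers that of c, hence the pairing with PBW monomials is diagonal up to
   the powers of q produced by K. *)
Lemma pairing j i l : (j < n)%N -> (l < n)%N ->
  exists2 z : k, z != 0 &
  forall s t r, fn (dmono i j l) (F ^+ s * K ^+ t * E ^+ r)
    = z * ((r == j) && (s == l))%:R * (q ^+ (i + j + l)) ^+ t.
Proof.
elim: j i => [|j IHj] i jn ln.
  have [z z0 zE] := dmono_evalF i ln; exists z => // s t [|r].
    by rewrite expr0 mulr1 dmono_evalK zE !exprD expr0 invr1 mulr1 mulrC.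
  by rewrite exprSr mulrA -hitlE hitE_dmono dual_algZ qint0 !(mulr0, mul0r).
have [z z0 zE] := IHj i.+1 (ltnW jn) ln.
exists (q ^+ l * qint q j.+1 * z).
  by apply: mulf_neq0 => //; rewrite mulf_neq0 ?expf_neq0 //; apply: (qint_neq0 n_ge3 n_odd q_prim).
move=> s t [|r].
  have [y y0 yE] := dmono_evalF i ln.
  by rewrite expr0 mulr1 dmono_evalK yE /= !(mulr0, mul0r).
rewrite exprSr mulrA -hitlE hitE_dmono dual_algZ zE eqSS !mulrA.
(* $E$ trades a $b$ for an $a$, so the exponent $i+j+l$ is unchanged. *)
by rewrite addSn -addnS.
Qed.

Local Notation T0 := ('I_n * 'I_n * 'I_n)%type.
Local Notation u := (@uq_basis k U n E F K).
Let f (e : T0) : R := dmono e.1.1 e.1.2 e.2.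

Lemma uq_span x : exists z : T0 -> k, x = \sum_e z e *: u e.
Proof.
have [rK rE rF rKE [rKF rEF]] := uq_relations hU.
(* The empty list of relations turns congruences into equalities in [U]. *)
have [hK hE hF] := And3 (rel_eq_of_eq [::] rK) (rel_eq_of_eq [::] rE) (rel_eq_of_eq [::] rF).
have [hKE hKF hEF] := And3 (rel_eq_of_eq [::] rKE) (rel_eq_of_eq [::] rKF) (rel_eq_of_eq [::] rEF).
have sA (e : k) (y z : U) : e *: (y * z) = y * (e *: z) by rewrite scalerAr.
suff sx : spanned [::] (fun y => exists s t r, y = uq_mono E F K s t r) x.
  have [z /rel_ideal_nil/eqP] := uq_basis_span n_gt0 hK hE hF sx.
  by rewrite subr_eq0 => /eqP ->; exists z.
elim/(uq_indl hU): x => [x y|e x||x|x|x].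
- exact: SpannedD.
- exact: SpannedZ.
- by apply: SpannedGen; exists 0%N, 0%N, 0%N; rewrite /uq_mono !expr0 !mulr1.
- exact: (uq_spanned_E sA q0 hKE hKF hEF).
- exact: (uq_spanned_F sA).
- exact: (uq_spanned_K sA hKF).
Qed.

(* After [pairing], fixing (s, r) leaves a Vandermonde system at the distinct points
   q^(i + r + s), i < n. *)
Lemma uq_separated (z : T0 -> k) :
  (forall e, fn (f e) (\sum_e' z e' *: u e') = 0) -> forall e, z e = 0.
Proof.
(* The coefficients of [p] are the unknowns with $s$ and $r$ fixed; below degree $n$ [insub]
   succeeds and the default 0 is not reached. *)
move=> fz [[s t] r]; pose p := \poly_(m < n) (oapp (fun m => z (s, m, r)) 0 (insub m)).
suff p0 : p = 0.
  have := congr1 (fun p : {poly k} => p`_t) p0.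
  by rewrite /p coef_poly ltn_ord coef0 valK.
apply: (@roots_geq_poly_eq0 _ _ [seq q ^+ (i + r + s) | i <- iota 0 n]).
- apply/allP => x /mapP[i ilt ->]; move: ilt; rewrite mem_iota /= add0n => ilt.
  have [g g0 gE] := pairing i (ltn_ord r) (ltn_ord s).
  (* Testing against $a^ib^rc^s$ retains exactly the monomials $F^sK^tE^r$, and gives [g] times the
     value of [p] at $q^{i+r+s}$. *)
  have := fz (Ordinal ilt, r, s); rewrite /f /= linear_sum /=.
  under eq_bigr => e _ do rewrite linearZ /= /uq_basis /uq_mono gE.
  move=> e0; rewrite /root /p horner_poly; apply/eqP/(mulfI g0); rewrite mulr0.
  rewrite -[RHS]e0 (bigID (fun e => (e.2 == r) && (e.1.1 == s))) /=.
  rewrite [X in _ = _ + X]big1 ?addr0; last first.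
    by move=> e /negPf ers; rewrite !val_eqE ers !(mulr0, mul0r) scaler0.
  rewrite (reindex_onto (fun m => (s, m, r)) (fun e => e.1.2)) /=; last first.
    by move=> [[s' t'] r'] /= /andP[/eqP -> /eqP ->].
  rewrite mulr_sumr; apply: eq_big => m; first by rewrite !eqxx.
  by move=> _; rewrite !eqxx mulr1 valK mulrCA.
- rewrite map_inj_in_uniq ?iota_uniq // => i i'; rewrite !mem_iota /= !add0n => il i'l /eqP.
  rewrite !exprD -!mulrA; move/eqP/(mulIf _).
  rewrite mulf_neq0 ?expf_neq0 // => /(_ isT)/eqP.
  rewrite (eq_prim_root_expr q_prim) !modn_small //.
  by move/eqP.
- by rewrite size_map size_iota; apply: size_poly.
Qed.

Let Gm : 'M[k]_#|{: T0}| :=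
  \matrix_(i, j) (fn (f (enum_val i)) (u (enum_val j)) : k).

(** A row vector killed by the transpose is a combination of the [u e] annihilated by every
    [f e]. *)
Lemma gram_unit : Gm \in unitmx.
Proof.
rewrite -unitmx_tr -row_free_unit -kermx_eq0; apply/rowV0P => v.
move=> /sub_kermxP vG.
have z0 := uq_separated (z := fun e => v 0 (enum_rank e)).
apply/rowP => j; rewrite [RHS]mxE -(enum_valK j); apply: z0 => e.
rewrite linear_sum (reindex _ (onW_bij _ (@enum_val_bij T0))) /=.
have e0 : (v *m Gm^T) 0 (enum_rank e) = 0 by rewrite vG mxE.
rewrite -[RHS]e0 mxE; apply: eq_bigr => i _; rewrite linearZ enum_valK !mxE enum_rankK.
by [].
Qed.

(** Inverting the Gram matrix finds a combination of the [f e] with the values of [p] on the [u e],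
    and these span [U]. *)
Lemma dual_span (p : R) : exists y : T0 -> k, p = \sum_e y e *: f e.
Proof.
pose w : 'rV[k]_#|{: T0}| := \row_j (fn p (u (enum_val j)) : k).
pose y := w *m invmx Gm.
exists (fun e => y 0 (enum_rank e)).
apply: dual_algP => x; have [z ->] := uq_span x; rewrite !linear_sum.
apply: eq_bigr => e _; rewrite !linearZ; congr (_ *: _).
have := congr1 (fun M : 'rV_ _ => M 0 (enum_rank e)) (mulmxKV gram_unit w).
rewrite /= -/y !mxE enum_rankK => <-.
rewrite sum_lfunE (reindex _ (onW_bij _ (@enum_val_bij T0))) /=.
apply: eq_bigr => i _; rewrite enum_valK !mxE enum_rankK.
by rewrite scale_lfunE.
Qed.

(** At each $x$, [uq_separated] removes the second factor; taking the [u e] for $x$ then leaves a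
    row vector killed by the Gram matrix. *)
Lemma double_basis_free (z : T0 * T0 -> k) :
  \sum_e z e *: ((f e.1 : dual_space U) ⊗ u e.2) = 0 -> forall e, z e = 0.
Proof.
move=> z0.
have H x e' : \sum_e z (e, e') * fn (f e) x = 0.
  apply: (uq_separated (z := fun e' => \sum_e z (e, e') * fn (f e) x)) => e.
  rewrite (_ : \sum_e' _ = ev (\sum_e z e *: ((f e.1 : dual_space U) ⊗ u e.2)) x).
    by rewrite z0 (_ : ev 0 x = 0) ?linear0 // -(scale0r (0 : drinfeld_double U)) evZ scale0r.
  transitivity (\sum_e' \sum_e (z (e, e') * fn (f e) x) *: u e').
    by apply: eq_bigr => i _; rewrite scaler_suml.
  rewrite exchange_big pair_bigA /=.
  rewrite (big_morph (fun X => ev X x) (id1 := 0) (op1 := +%R)).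
  - by apply: eq_bigr => i _; rewrite evZ ev_pure scalerA; case: i.
  - by move=> X Y; rewrite evD.
  - by rewrite -(scale0r (0 : drinfeld_double U)) evZ scale0r.
move=> [e0 e']; pose y : 'rV[k]_#|{: T0}| := \row_i z (enum_val i, e').
have y0 : y *m Gm = 0.
  apply/rowP => j; rewrite !mxE -[RHS](H (u (enum_val j)) e').
  rewrite [RHS](reindex _ (onW_bij _ (@enum_val_bij T0))) /=.
  by apply: eq_bigr => i _; rewrite !mxE.
have := congr1 (fun M => (M *m invmx Gm) 0 (enum_rank e0)) y0.
by rewrite /= (mulmxK gram_unit) mul0mx !mxE enum_rankK.
Qed.

(** * Relations in the double *)

Local Notation D := (double_alg hH S_inj hA).
Local Notation od := (@double_of_dual _ _ _ _ _ hH S_inj hA).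
Local Notation oa := (@double_of_alg _ _ _ _ _ hH S_inj hA).

Let odM p r : od (p * r) = od p * od r. Proof. exact: rmorphM. Qed.
Let odX p m : od (p ^+ m) = od p ^+ m. Proof. exact: rmorphXn. Qed.
Let odZ e p : od (e *: p) = e *: od p. Proof. exact: linearZ_LR. Qed.
Let odD p r : od (p + r) = od p + od r. Proof. exact: linearD. Qed.
Let od0 : od 0 = 0. Proof. exact: linear0. Qed.
Let oaM x y : oa (x * y) = oa x * oa y. Proof. exact: rmorphM. Qed.
Let oaX x m : oa (x ^+ m) = oa x ^+ m. Proof. exact: rmorphXn. Qed.
Let oaZ e x : oa (e *: x) = e *: oa x. Proof. exact: linearZ_LR. Qed.
Let oaD x y : oa (x + y) = oa x + oa y. Proof. exact: linearD. Qed.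
Let oaN x : oa (- x) = - oa x. Proof. exact: linearN. Qed.
Let oa0 : oa 0 = 0. Proof. exact: linear0. Qed.
Let od_oa p x : od p * oa x = ((p : dual_space U) ⊗ x : drinfeld_double U).
Proof. exact: double_of_dual_alg. Qed.

Let evl (p : R) : linear (ev (od p)). Proof. exact: ev_linearr. Qed.

(** The general exchange of a generator with a functional: in [actK], [actE] and [actF] each map
    $y\mapsto p(S^{-1}(h_3)\,y\,h_1)$ is a translate of $p$. Substituting the translates of
    $a,b,c,d$ gives the twelve mixed relations. *)
Lemma double_crossK p : oa K * od p = od (hitl K (hitr K^-1 p)) * oa K.
Proof.
apply: ev_inj => x; rewrite od_oa ev_pure hitlE hitrE.
rewrite [LHS](ev_of_alg_mul hH K (od p) x) (actK n_gt0 hU _ (evl p)) ev_of_dual.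
by rewrite -scalerAr mulr1 mulrA.
Qed.

Lemma double_crossE p : oa E * od p =
  - od (hitr E (hitr K^-1 p)) + od (hitr K^-1 p) * oa E
  + od (hitl E (hitr K^-1 p)) * oa K.
Proof.
apply: ev_inj => x; rewrite !evD !od_oa !ev_pure hitlE !hitrE -scaleN1r evZ.
rewrite [LHS](ev_of_alg_mul hH E (od p) x) (actE n_gt0 hU _ (evl p)) !ev_of_dual.
by rewrite !hitrE -!scalerAr !mulr1 scaleN1r !mulrA.
Qed.

Lemma double_crossF p : oa F * od p =
  - (od (hitl K^-1 (hitr K (hitr F p))) * oa K^-1) + od (hitl K^-1 p) * oa F
  + od (hitl F p).
Proof.
apply: ev_inj => x; rewrite !evD !od_oa -scaleN1r evZ !ev_pure !hitlE !hitrE.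
rewrite [LHS](ev_of_alg_mul hH F (od p) x) (actF n_gt0 hU _ (evl p)) !ev_of_dual.
by rewrite -!scalerAr !mulr1 scaleN1r.
Qed.

Lemma double_relations i : (i < 28)%N ->
  let r := nth (0, 0)
    (double_rels n q (od a) (od b) (od c) (od d) (oa E) (oa F) (oa K)) i in
  r.1 = r.2.
Proof.
have [aE bE cE dE] := hitE_coef.
have [aF bF cF dF] := hitF_coef.
have [aK bK cK dK] := hitK_coef.
have [aV bV cV dV] := hitKV_coef.
have [raE rbE rcE rdE] := hitrE_coef.
have [raF rbF rcF rdF] := hitrF_coef.
have [raK rbK rcK rdK] := hitrK_coef.
have [raV rbV rcV rdV] := hitrKV_coef.
have [rK rE rF rKE [rKF rEF]] := uq_relations hU.
have [[q1 q2 q3 q4 q5] [q6 q7]] := dual_quadratic.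
have [an dn bn cn] := dual_powers.
have KV := uq_KVX n_gt0 hU.
have N1 (e : k) : - e = -1 * e by rewrite mulN1r.
move: i; cbn zeta; nth_cases.
- by rewrite -odX an.
- by rewrite -odX dn.
- by rewrite -odX bn od0.
- by rewrite -odX cn od0.
- by rewrite -!odM -odZ q1.
- by rewrite -!odM -odZ q2.
- by rewrite -!odM -odZ q3.
- by rewrite -!odM -odZ q4.
- by rewrite -!odM q5.
- by rewrite -!odM -odZ q6 odD.
- by rewrite -oaX rK.
- by rewrite -oaX rE oa0.
- by rewrite -oaX rF oa0.
- by rewrite -!oaM -oaZ rKE.
- by rewrite -!oaM -oaZ rKF.
- by rewrite -!oaM -oaX -!oaN -!oaD -oaZ rEF.
- by rewrite double_crossK raV hitlZ aK scalerA mulVf // scale1r.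
- by rewrite double_crossK rbV hitlZ bK scalerA odZ -scalerAl -[q ^- 2]exprVn expr2.
- by rewrite double_crossK rcV hitlZ cK scalerA odZ -scalerAl expr2.
- by rewrite double_crossK rdV hitlZ dK scalerA mulfV // scale1r.
- rewrite double_crossE raV hitlZ hitrZ aE raE scaler0 od0 mul0r addr0 addrC.
  by rewrite !odZ -scalerAl.
- rewrite double_crossE rbV hitlZ hitrZ bE rbE !odZ -!scalerAl.
  by rewrite -addrA addrC.
- rewrite double_crossE rcV hitlZ hitrZ cE rcE !scaler0 od0 mul0r addr0 oppr0 add0r.
  by rewrite odZ -scalerAl.
- rewrite double_crossE rdV hitlZ hitrZ dE rdE !scaler0 od0 oppr0 add0r.
  by rewrite !odZ -!scalerAl.
(* Writing 0 as a multiple of 0 lets [hitrZ] and [hitlZ] show that its translates vanish. *)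
- rewrite double_crossF raF -(scale0r (0 : R)) !hitrZ !hitlZ !scale0r od0 mul0r oppr0.
  by rewrite add0r aV aF odZ -scalerAl.
- rewrite double_crossF rbF -(scale0r (0 : R)) !hitrZ !hitlZ !scale0r od0 mul0r oppr0.
  by rewrite add0r bV bF odZ -scalerAl od0 addr0.
- rewrite double_crossF rcF raK hitlZ aV scalerA mulfV // scale1r cV cF odZ.
  by rewrite -scalerAl KV oaX [X in X + _]addrC.
- rewrite double_crossF rdF rbK hitlZ bV scalerA dV dF !odZ od0 addr0.
  by rewrite -!scalerAl KV oaX addrC -expr2.
Qed.

Local Notation Si := (S^-1)%VF.

(** The matrix with rows $(d,-q^{-1}b)$ and $(-qc,a)$ is conjugate to the transpose of $\rho$, hence
    reverses products just as $\rho\circ S^{-1}$ does: [step] extends agreement from generators to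
    words. *)
Lemma repr_antipode_inv x :
  [/\ fn a (Si x) = fn d x, fn b (Si x) = - (q^-1 * fn b x),
      fn c (Si x) = - (q * fn c x) & fn d (Si x) = fn a x].
Proof.
have M := repr_coefM.
have [a1 b1 c1 d1] := repr_coef1.
have [aE bE cE dE] := repr_coefE.
have [aF bF cF dF] := repr_coefF.
have [aK bK cK dK] := repr_coefK.
have [aV bV cV dV] := repr_coefKV.
have SM := antipode_invM hH S_inj.
have step g y :
   [/\ fn a (Si g) = fn d g, fn b (Si g) = - (q^-1 * fn b g),
      fn c (Si g) = - (q * fn c g) & fn d (Si g) = fn a g] ->
   [/\ fn a (Si y) = fn d y, fn b (Si y) = - (q^-1 * fn b y),
      fn c (Si y) = - (q * fn c y) & fn d (Si y) = fn a y] ->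
   [/\ fn a (Si (g * y)) = fn d (g * y),
      fn b (Si (g * y)) = - (q^-1 * fn b (g * y)),
      fn c (Si (g * y)) = - (q * fn c (g * y))
    & fn d (Si (g * y)) = fn a (g * y)].
  move=> [ag bg cg dg] [ay by_ cy dy]; rewrite !SM.
  have [-> -> -> ->] := M (Si y) (Si g); have [-> -> -> ->] := M g y.
  by rewrite ag bg cg dg ay by_ cy dy; split; field.
elim/(uq_indl hU): x => [x y|e x||x|x|x].
- move=> [ax bx cx dx] [ay by_ cy dy]; rewrite !linearD /=.
  by rewrite ax bx cx dx ay by_ cy dy; split; ring.
- have vS (p : R) z : fn p (e *: z) = e * fn p z by exact: linearZ.
  move=> [ax bx cx dx]; rewrite !(linearZ_LR Si) !vS.
  by rewrite ax bx cx dx; split; ring.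
- by rewrite (antipode_inv1 hH S_inj) a1 b1 c1 d1; split; ring.
- apply: step; rewrite (uq_antipode_invE n_gt0 hU) !linearN /=.
  have [-> -> -> ->] := M K^-1 E.
  by rewrite aE bE cE dE aV bV cV dV; split; ring.
- apply: step; rewrite (uq_antipode_invF n_gt0 hU) !linearN /=.
  have [-> -> -> ->] := M F K.
  by rewrite aF bF cF dF aK bK cK dK; split; ring.
- apply: step; rewrite (uq_antipode_invK n_gt0 hU).
  by rewrite aK bK cK dK aV bV cV dV; split; ring.
Qed.

Lemma double_basis_pure (e : 'I_n * 'I_n * 'I_n * ('I_n * 'I_n * 'I_n)) :
  double_basis (oa E) (oa F) (oa K) (od a) (od b) (od c) e
  = (dmono e.1.1.1 e.1.1.2 e.1.2 : dual_space U) ⊗ uq_basis E F K e.2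
  :> drinfeld_double U.
Proof.
transitivity (od (dmono e.1.1.1 e.1.1.2 e.1.2) * oa (uq_basis E F K e.2)).
  rewrite /double_basis /double_mono /uq_basis /uq_mono /dmono.
  by rewrite !rmorphM !rmorphXn !mulrA.
exact: double_of_dual_alg.
Qed.

Lemma double_presented : presented_by (double_mul Delta S) (double_one eps)
  [tuple of_dual a; of_dual b; of_dual c; of_dual d;
         of_alg eps E; of_alg eps F; of_alg eps K]
  (double_rels n q (fgen (inord 0 : 'I_7)) (fgen (inord 1))
     (fgen (inord 2)) (fgen (inord 3)) (fgen (inord 4))
     (fgen (inord 5)) (fgen (inord 6))).
Proof.
have [phi [phi1 phiM phig]] := free_alg_hom
  (tnth [tuple od a; od b; od c; od d; oa E; oa F; oa K]).
have ga : phi (fgen (inord 0)) = od a by rewrite phig (tnth_nth 0) inordK.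
have gb : phi (fgen (inord 1)) = od b by rewrite phig (tnth_nth 0) inordK.
have gc : phi (fgen (inord 2)) = od c by rewrite phig (tnth_nth 0) inordK.
have gd : phi (fgen (inord 3)) = od d by rewrite phig (tnth_nth 0) inordK.
have gE : phi (fgen (inord 4)) = oa E by rewrite phig (tnth_nth 0) inordK.
have gF : phi (fgen (inord 5)) = oa F by rewrite phig (tnth_nth 0) inordK.
have gK : phi (fgen (inord 6)) = oa K by rewrite phig (tnth_nth 0) inordK.
have [sp [[spD spZ sp1] [spa spb spc spd] [spE spF spK] spb']] :=
  double_rels_spanned (fgen (inord 0)) (fgen (inord 1)) (fgen (inord 2))
    (fgen (inord 3)) (fgen (inord 4)) (fgen (inord 5)) (fgen (inord 6))
    (@free_alg_scaleAr k 7) n_gt0 q0.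
have spP P : sp P.
  elim/free_alg_indl: P => [x y|e x||i x spx];
    [exact: spD | exact: spZ | exact: sp1 | move: i; apply: ord7_ind].
  - exact: spa.
  - exact: spb.
  - exact: spc.
  - exact: spd.
  - exact: spE.
  - exact: spF.
  - exact: spK.
have relM := double_rels_morph n q (phi := phi) (fgen (inord 0)) (fgen (inord 1)) (fgen (inord 2))
    (fgen (inord 3)) (fgen (inord 4)) (fgen (inord 5)) (fgen (inord 6)) phi1 phiM.
rewrite ga gb gc gd gE gF gK in relM.
have basM e := double_basis_morph (n := n) (phi := phi) (fgen (inord 0))
    (fgen (inord 1)) (fgen (inord 2)) (fgen (inord 4)) (fgen (inord 5)) (fgen (inord 6)) e phi1 phiM.
move: (fgen (inord 0)) (fgen (inord 1)) (fgen (inord 2)) (fgen (inord 3))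
  (fgen (inord 4)) (fgen (inord 5)) (fgen (inord 6)) ga gb gc gd gE gF gK spb' relM basM
  {spa spb spc spd spE spF spK} => ea eb ec ed eE eF eK ga gb gc gd gE gF gK spb relM basM.
(* One inclusion of the kernel, used again below to compare an element with its normal form. *)
have sound P : rel_ideal (double_rels n q ea eb ec ed eE eF eK) P -> phi P = 0.
  have phi0 : phi 0 = 0 by exact: linear0.
  elim=> [l r lr||x y _ x0 _ y0|x y _ y0|x y _ x0].
  - have lr' := map_f (fun lr => (phi lr.1, phi lr.2)) lr; rewrite relM in lr'.
    have /(nthP (0, 0)) [i ilt e] := lr'.
    have := double_relations ilt.
    rewrite e /= => e'; have -> : phi (l - r) = phi l - phi r by exact: linearB.
    by rewrite e' subrr.
  - exact: phi0.
  - have -> : phi (x + y) = phi x + phi y by exact: linearD.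
    by rewrite x0 y0 addr0.
  - by rewrite phiM y0 mulr0.
  - by rewrite phiM x0 mul0r.
exists phi; split.
- by split.
- exact: phig.
- pose im (X : D) := exists P, phi P = X.
  have imD X Y : im X -> im Y -> im (X + Y).
    by move=> [P <-] [Q <-]; exists (P + Q); exact: linearD.
  have imZ e X : im X -> im (e *: X).
    by move=> [P <-]; exists (e *: P); exact: linearZ.
  have im0 : im 0 by exists 0; exact: linear0.
  apply: double_ind; [exact: imD | exact: imZ | move=> p h].
  have [y ->] := dual_span p.
  have [z ->] := uq_span h.
  rewrite linear_tpure_suml; apply: (big_ind im);
    [exact: im0 | exact: imD | move=> e _; apply: (imZ)].
  rewrite linear_tpure_sumr; apply: (big_ind im);
    [exact: im0 | exact: imD | move=> e' _; apply: (imZ)].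
  by exists (double_basis eE eF eK ea eb ec (e, e'));
    rewrite basM ga gb gc gE gF gK double_basis_pure.
move=> P; split; last exact: sound.
(* [P] is congruent to a combination of the $n^6$ monomials with coefficients [z]. By soundness the
   same combination in the double is the image of [P], which is 0, so independence leaves [P]
   congruent to 0. *)
move=> P0; have [z zE] := spb P (spP P).
have phiS := sound _ zE.
have phiB x y : phi (x - y) = phi x - phi y by exact: linearB.
have phiZ e x : phi (e *: x) = e *: phi x by exact: linearZ.
have phiSum (G : _ -> free_alg k 7) : phi (\sum_e G e) = \sum_e phi (G e) by exact: linear_sum.
rewrite phiB P0 sub0r phiSum in phiS; move/eqP: phiS; rewrite oppr_eq0 => /eqP phiS.
have z0 := double_basis_free (z := z).
suff e0 e : z e = 0.
  move: zE; rewrite /rel_eq big1 ?subr0 // => e _; by rewrite e0 scale0r.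
apply: z0; rewrite -[RHS]phiS; apply: eq_bigr => i _.
by rewrite phiZ basM ga gb gc gE gF gK double_basis_pure.
Qed.

End UqDouble.

Theorem theoremA7 (k : closedFieldType) (char0 : [pchar k] =i pred0)
    (n : nat) (n_ge3 : (3 <= n)%N) (n_odd : odd n)
    (q : k) (q_prim : n.-primitive_root q)
    (U : falgType k) (Delta : 'Hom(U, tensor U U)) (eps : 'Hom(U, k^o))
    (S : 'End(U)) (E F K : U) (U_uq : is_uq_sl2 n q Delta eps S E F K)
    (rho : {lrmorphism U -> 'M[k]_2})
    (rhoE : rho E = mx2 0 1 0 0) (rhoF : rho F = mx2 0 0 1 0)
    (rhoK : rho K = mx2 q 0 0 q^-1)
    (a b c d : dual_space U)
    (rho_coef : forall v, rho v = @mx2 k (a v) (b v) (c v) (d v)) :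
  let mulD := double_mul Delta S in
  let oneD := double_one eps in
  let DeltaD := double_comul Delta in
  let epsD := double_counit eps in
  let a := of_dual a in let b := of_dual b in
  let c := of_dual c in let d := of_dual d in
  let Ki := of_alg eps K^-1 in
  let E := of_alg eps E in let F := of_alg eps F in let K := of_alg eps K in
  [/\ presented_by mulD oneD [tuple a; b; c; d; E; F; K]
        (double_rels n q (fgen (inord 0 : 'I_7)) (fgen (inord 1))
           (fgen (inord 2)) (fgen (inord 3)) (fgen (inord 4))
           (fgen (inord 5)) (fgen (inord 6))),
      [/\ DeltaD a = a ⊗ a + c ⊗ b, DeltaD b = b ⊗ a + d ⊗ b,
          DeltaD c = a ⊗ c + c ⊗ d & DeltaD d = b ⊗ c + d ⊗ d]
      /\ [/\ DeltaD K = K ⊗ K, DeltaD E = oneD ⊗ E + E ⊗ K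
           & DeltaD F = Ki ⊗ F + F ⊗ oneD],
      [/\ epsD a = 1, epsD d = 1 & epsD K = 1]
      /\ [/\ epsD b = 0, epsD c = 0, epsD E = 0 & epsD F = 0]
    & exists SD : 'End(drinfeld_double U),
        [/\ unique (fun T : 'End(drinfeld_double U) =>
                      is_antipode mulD oneD DeltaD epsD T) SD,
            [/\ SD a = d, SD b = - (q^-1 *: b), SD c = - (q *: c) & SD d = a]
          & [/\ SD K = Ki, SD E = - mulD E Ki & SD F = - mulD K F]]].

Proof.
move=> mulD oneD DeltaD epsD a' b' c' d' Ki E' F' K'.
have n_gt0 : (0 < n)%N by exact: leq_trans n_ge3.
have hH := uq_hopf U_uq.
have S_inj := uq_antipode_inj n_gt0 U_uq.
have hA := uq_act_conv n_gt0 U_uq.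
have [a1 b1 c1 d1] := repr_coef1 (a := a) (b := b) (c := c) (d := d) (hU := U_uq) rho_coef.
have coM := repr_coefM (a := a) (b := b) (c := c) (d := d) (hU := U_uq) rho_coef.
(* The co-opposite first factor exchanges the legs, which is why $\Delta(a)$ contains $c\otimes b$
   where the matrix product rule has $b(x)c(y)$. *)
have Dp (p : dual_space U) : DeltaD (of_dual p)
   = \tens_(p1, p2 <- dual_comul p) (of_dual p2 ⊗ of_dual p1).
  rewrite /DeltaD double_comul_pure; apply: eq_tlift => p1 p2.
  by rewrite (hopf_comul1 hH) tliftE //; lin.
have D2 (p p1 p2 r1 r2 : dual_space U) :
    (forall x y, p (x * y) = p1 x * r1 y + p2 x * r2 y) ->
    DeltaD (of_dual p) = of_dual r1 ⊗ of_dual p1 + of_dual r2 ⊗ of_dual p2.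
  move=> pE; rewrite Dp (dual_comul_sum2 pE).
  have tl : linear (tlift (fun p1 p2 : dual_space U => of_dual p2 ⊗ of_dual p1)).
    exact: tlift_is_linear.
  have ol := @of_dual_linear k U.
  by rewrite (linear_funD _ _ tl) !tliftE //; lin.
have Dh h : DeltaD (of_alg eps h)
   = \tens_(h1, h2 <- Delta h) (of_alg eps h1 ⊗ of_alg eps h2).
  rewrite /DeltaD double_comul_pure dual_comul_groupLike; last first.
    exact: (hopf_counitM hH).
  by rewrite tliftE //; lin.
have al := of_alg_linear eps.
split.
- exact: (double_presented n_ge3 n_odd q_prim (hU := U_uq) rhoE rhoF rhoK rho_coef).
- split; split.
  + by apply: D2 => x y; have [] := coM x y.
  + by apply: D2 => x y; have [] := coM x y.
  + by apply: D2 => x y; have [] := coM x y.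
  + by apply: D2 => x y; have [] := coM x y.
  + by rewrite /K' Dh (comulK U_uq) //; lin.
  + by rewrite /E' Dh (comulE U_uq) //; lin.
  + by rewrite /F' Dh (comulF U_uq) //; lin.
- rewrite /epsD !double_counit_pure (hopf_counit1 hH) a1 b1 c1 d1.
  rewrite (uq_counitK U_uq) (uq_counitE U_uq) (uq_counitF U_uq).
  by rewrite !mulr1 !mulr0.
(* On each of the two subalgebras the other factor of the formula is the unit, leaving $p\circ
   S^{-1}$ or $S$. *)
have Sd (p : dual_space U) : double_antipode Delta eps S (of_dual p) = of_dual (p \o S^-1)%VF.
  rewrite double_antipode_pure (antipode1 hH).
  exact: (double_mul1 hH S_inj).
have Sa h : double_antipode Delta eps S (of_alg eps h) = of_alg eps (S h).
  rewrite double_antipode_pure.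
  have -> : (eps \o S^-1)%VF = eps.
    by apply/lfunP => x; rewrite comp_lfunE (counit_antipode_inv hH S_inj).
  exact: (double_mulr1 hH S_inj).
have rS := repr_antipode_inv n_ge3 q_prim (hU := U_uq) rhoE rhoF rhoK rho_coef.
have ol := @of_dual_linear k U.
exists (double_antipode Delta eps S); split.
- split; first exact: (double_antipodeP hH S_inj hA).
  by move=> T; apply: (double_antipode_unique hH S_inj hA).
- split; rewrite Sd.
  + by congr of_dual; apply/lfunP => x; rewrite comp_lfunE; have [] := rS x.
  + rewrite -(linear_funZ _ _ ol) -(linear_funN _ ol).
    congr of_dual; apply/lfunP => x; rewrite comp_lfunE opp_lfunE scale_lfunE.
    by have [] := rS x.
  + rewrite -(linear_funZ _ _ ol) -(linear_funN _ ol).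
    congr of_dual; apply/lfunP => x; rewrite comp_lfunE opp_lfunE scale_lfunE.
    by have [] := rS x.
  + by congr of_dual; apply/lfunP => x; rewrite comp_lfunE; have [] := rS x.
- split; rewrite Sa.
  + by rewrite (uq_antipodeK n_gt0 U_uq).
  + rewrite (uq_antipodeE n_gt0 U_uq) (linear_funN _ al).
    by rewrite (of_algM hH S_inj).
  + rewrite (uq_antipodeF n_gt0 U_uq) (linear_funN _ al).
    by rewrite (of_algM hH S_inj).
Qed.
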